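(* Let $(W,S)$ be a Coxeter system with $S=\{s,t\}$, $s\neq t$, such that $st$ has finite order $2m$ with $m\geq 2$. Then $s$ and $t$ are not conjugate in $W$, so that $\bar S$ is identified with $\{s,t\}$ and $\mathbb{Z}[\bar S]=\mathbb{Z}s\oplus\mathbb{Z}t$. With the definitions given in the context: (i) Conjecture A holds for $(W,S)$; (ii) the essential hyperplanes of $(W,S)$ are exactly $\mathcal{H}_s$, $\mathcal{H}_t$, $\mathcal{H}_{s-t}$ and $\mathcal{H}_{s+t}$; (iii) Conjecture B$^-$ holds for $(W,S)$.
   Context: **Positive subsets.** Let $\Lambda$ be a free abelian group of finite rank and $V=\mathbb{R}\otimes_{\mathbb Z}\Lambda$. A subset $X\subseteq\Lambda$ is *positive* if $\Lambda=X\cup(-X)$, $X+X\subseteq X$ and $X\cap(-X)$ is a subgroup of $\Lambda$. $\mathcal{P}os(\Lambda)$ is the set of positive subsets. For $E\subseteq\Lambda$ put $\mathcal{U}(E)=\{X\in\mathcal{P}os(\Lambda): X\cap E=\varnothing\}$ and $\mathcal{U}(\lambda)=\mathcal{U}(\{\lambda\})$. $\mathcal{P}os(\Lambda)$ has the topology whose base of open sets is the family $\mathcal{U}(E)$, $E$ finite. **Arrangements.** For $\lambda\in\Lambda\setminus\{0\}$ the *rational hyperplane* $\mathcal{H}_\lambda$ is $\{X\in\mathcal{P}os(\Lambda):\lambda\in X\cap(-X)\}$; one has $\mathcal{P}os(\Lambda)=\mathcal{U}(\lambda)\sqcup\mathcal{H}_\lambda\sqcup\mathcal{U}(-\lambda)$,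 and this partition depends only on $\mathcal{H}_\lambda$. Let $\mathfrak{A}$ be a finite set of rational hyperplanes. $X,Y$ are $\mathfrak{A}$-equivalent if, for each $\mathcal{H}_\lambda\in\mathfrak{A}$, they lie in the same one of the three pieces $\mathcal{U}(\lambda),\mathcal{H}_\lambda,\mathcal{U}(-\lambda)$. The equivalence classes are the *$\mathfrak{A}$-facets*; an *$\mathfrak{A}$-chamber* is a facet meeting no hyperplane of $\mathfrak{A}$. For facets, $\mathcal{F}\preccurlyeq\mathcal{F}'$ means $\overline{\mathcal{F}}\subseteq\overline{\mathcal{F}'}$ (closures). **Cells.** Let $(W,S)$ be a Coxeter system with length function $\ell$. $\bar S$ is the set of classes of $S$ under conjugacy in $W$ and $\mathbb{Z}[\bar S]$ the free $\mathbb{Z}$-module on $\bar S$. Let $\Gamma$ be a totally ordered abelian group and $\varphi:\bar S\to\Gamma$ a map; write $\varphi(s)$ for the value at the class of $s\in S$. $\mathbb{Z}[\Gamma]=\bigoplus_\gamma\mathbb{Z}e^\gamma$ is the group ring. The Hecke algebra $\mathcal{H}(W,S,\varphi)$ is the free $\mathbb{Z}[\Gamma]$-module with basis $(T_w)_{w\in W}$ and $\mathbb{Z}[\Gamma]$-bilinear multiplication determined by $T_wT_{w'}=T_{ww'}$ if $\ell(ww')=\ell(w)+\ell(w')$ and $(T_s-e^{\varphi(s)})(T_s+e^{-\varphi(s)})=0$ for $s\in S$. The bar involution is the ring automorphism with $\overline{e^\gamma}=e^{-\gamma}$, $\overline{T_w}=T_{w^{-1}}^{-1}$. For $w\in W$,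 $C_w$ is the unique bar-invariant element of $T_w+\bigoplus_{x\in W}\mathbb{Z}[\Gamma_{<0}]T_x$, where $\mathbb{Z}[\Gamma_{<0}]=\bigoplus_{\gamma<0}\mathbb{Z}e^\gamma$; $(C_w)_{w\in W}$ is a $\mathbb{Z}[\Gamma]$-basis. The preorder $\leqslant_L^\varphi$ (resp. $\leqslant_R^\varphi$, resp. $\leqslant_{LR}^\varphi$) is the transitive closure of the relation ''$C_x$ has nonzero coefficient in $hC_y$ (resp. $C_yh$, resp. $hC_yh'$) for some $h,h'\in\mathcal{H}(W,S,\varphi)$'' between $x$ and $y$; $\sim_?^\varphi$ is the associated equivalence relation, whose classes are the left ($?=L$), right ($?=R$), two-sided ($?=LR$) cells for $(W,S,\varphi)$. For a left cell $C$ and $w\in C$, $M_C^\varphi$ is the left $\mathcal{H}(W,S,\varphi)$-module $\bigoplus_{x\leqslant_L w}\mathbb{Z}[\Gamma]C_x\big/\bigoplus_{x\leqslant_L w,\,x\notin C}\mathbb{Z}[\Gamma]C_x$; viewing $\mathbb{Q}$ as a $\mathbb{Z}[\Gamma]$-algebra via $e^\gamma\mapsto 1$, $\mathbb{Q}\otimes_{\mathbb{Z}[\Gamma]}M_C^\varphi$ is a $\mathbb{Q}W$-module ($T_w$ acting as $w$), and when $W$ is finite $\chi_C^\varphi$ denotes its character. For $X\in\mathcal{P}os(\mathbb{Z}[\bar S])$ let $\Gamma_X=\mathbb{Z}[\bar S]/(X\cap(-X))$, totally ordered by $\gamma\le_X\gamma'$ iff $\gamma'-\gamma$ has a representative in $X$,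 and let $\varphi_X:\bar S\to\Gamma_X$ be the canonical map. Write $\sim_?^X$, $\chi_C^X$ for $\sim_?^{\varphi_X}$, $\chi_C^{\varphi_X}$. **Conjecture A for $(W,S)$.** Call a finite set $\mathfrak{A}$ of rational hyperplanes of $\mathcal{P}os(\mathbb{Z}[\bar S])$ *complete* if $\mathcal{H}_\omega\in\mathfrak{A}$ for all $\omega\in\bar S$; for a facet $\mathcal{F}$ of a complete $\mathfrak{A}$, let $W_{\mathcal{F}}$ be the subgroup of $W$ generated by the union of the $\omega\in\bar S$ with $\mathcal{F}\subseteq\mathcal{H}_\omega$. Conjecture A: there is a complete finite $\mathfrak{A}$ such that for every $?\in\{L,R,LR\}$: (a) if $X,Y$ lie in the same $\mathfrak{A}$-facet $\mathcal{F}$, then $\sim_?^X$ and $\sim_?^Y$ coincide (denote this relation $\sim_?^{\mathcal{F}}$); (b) for every $\mathfrak{A}$-facet $\mathcal{F}$, the equivalence classes of $\sim_?^{\mathcal{F}}$ are the minimal nonempty subsets $C\subseteq W$ such that (b1) for every chamber $\mathcal{C}$ with $\mathcal{F}\preccurlyeq\mathcal{C}$, $C$ is a union of $\sim_?^{\mathcal{C}}$-classes, and (b2) $C$ is stable under translation by $W_{\mathcal{F}}$ (on the left if $?=L$, on the right if $?=R$, on both sides if $?=LR$). **Essential hyperplanes.** If Conjecture A holds, the essential hyperplanes are the members of the smallest complete finite arrangement for which (a) and (b) hold. **Conjecture B$^-$ for $(W,S)$** ($W$ finite, Conjecture A holding, $\mathfrak{A}$ the set of essential hyperplanes). For every $X\in\mathcal{P}os(\mathbb{Z}[\bar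 S])$, every left cell $C$ for $(W,S,\varphi_X)$, every $\mathfrak{A}$-chamber $\mathcal{C}$ with $X\in\overline{\mathcal{C}}$ and every $Y\in\mathcal{C}$, writing $C=C_1\sqcup\cdots\sqcup C_d$ with $C_i$ left cells for $(W,S,\varphi_Y)$, one has $\chi_C^X=\sum_{i=1}^d\chi_{C_i}^Y$. *)

(* Defs.v *)
From HB Require Import structures.
From mathcomp Require Import all_boot all_order all_algebra all_fingroup.
From mathcomp Require Import finmap.
From mathcomp Require Import generic_quotient ring_quotient.
From mathcomp Require Import mathcomp_extra boolp classical_sets functions.
From mathcomp Require Import cardinality filter topology.

Set Implicit Arguments.
Unset Strict Implicit.
Unset Printing Implicit Defensive.

Import Order.TTheory GRing.Theory Num.Theory.

Local Open Scope ring_scope.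

Record orderedZmod := OrderedZmod {
  oz_sort :> zmodType;
  oz_le : rel oz_sort;
  oz_le_refl : reflexive oz_le;
  oz_le_anti : antisymmetric oz_le;
  oz_le_trans : transitive oz_le;
  oz_le_total : total oz_le;
  oz_le_add2l : forall x y z, oz_le y z -> oz_le (x + y) (x + z)
}.

Definition oz_lt (G : orderedZmod) (x y : G) := (x != y) && oz_le x y.

Definition groupRing (G : zmodType) := {fsfun G -> int with 0}.

HB.instance Definition _ (G : zmodType) := Choice.on (groupRing G).

Section GroupRing.
Local Open Scope fset_scope.
Local Open Scope ring_scope.
Context (G : zmodType).
Implicit Types (a b c : groupRing G) (g : G) (A B : {fset G}).

Definition gr_exp g : groupRing G := [fsfun x in [fset g] => 1].
Definition gr_zero : groupRing G := [fsfun].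
Definition gr_opp a : groupRing G := [fsfun g in finsupp a => - a g].
Definition gr_add a b : groupRing G :=
  [fsfun g in finsupp a `|` finsupp b => (a g + b g)%R].
Definition gr_mul a b : groupRing G :=
  [fsfun g in [fset (x + y)%R | x in finsupp a, y in finsupp b] =>
     \sum_(x <- finsupp a) a x * b (g - x)].

Lemma gr_expE g x : gr_exp g x = (x == g)%:R.
Proof. by rewrite fsfunE inE; case: eqP. Qed.

Lemma gr_zeroE g : gr_zero g = 0. Proof. by rewrite fsfunE. Qed.

Lemma gr_oppE a g : gr_opp a g = - a g.
Proof. by rewrite fsfunE; case: finsuppP; rewrite ?oppr0. Qed.

Lemma gr_addE a b g : gr_add a b g = a g + b g.
Proof.
by rewrite fsfunE inE; do 2?case: finsuppP => ? /=; rewrite ?addr0 ?add0r.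
Qed.

Lemma gr_mulE A a b g : finsupp a `<=` A ->
  gr_mul a b g = \sum_(x <- A) a x * b (g - x).
Proof.
move=> sA; rewrite -[RHS](big_fset_incl _ sA) /=; last first.
  by move=> x _ /fsfun_dflt ->; rewrite mul0r.
rewrite fsfunE; case: ifPn => // /negP gN; apply/esym/big1_seq => x /= xa.
case: (finsuppP b (g - x)) => [_|gx]; first by rewrite mulr0.
by case: gN; apply/imfset2P; exists x => //; exists (g - x) => //; rewrite addrC subrK.
Qed.

Lemma gr_addA : associative gr_add.
Proof. by move=> a b c; apply/fsfunP => g; rewrite !gr_addE addrA. Qed.
Lemma gr_addC : commutative gr_add.
Proof. by move=> a b; apply/fsfunP => g; rewrite !gr_addE addrC. Qed.
Lemma gr_add0 : left_id gr_zero gr_add.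
Proof. by move=> a; apply/fsfunP => g; rewrite gr_addE gr_zeroE add0r. Qed.
Lemma gr_addN : left_inverse gr_zero gr_opp gr_add.
Proof.
by move=> a; apply/fsfunP => g; rewrite gr_addE gr_oppE gr_zeroE addNr.
Qed.

HB.instance Definition _ := GRing.isZmodule.Build (groupRing G)
  gr_addA gr_addC gr_add0 gr_addN.

Lemma gr_mulA : associative gr_mul.
Proof.
move=> a b c; apply/fsfunP => g; set A := finsupp a; set B := finsupp b.
pose Z := [fset (x + y)%R | x in A, y in B].
have sZ : finsupp (gr_mul a b) `<=` Z by exact: (finsupp_sub _ (fun=> 0)).
rewrite (gr_mulE _ _ (fsubset_refl A)) (gr_mulE _ _ sZ).
under [RHS]eq_bigr => z _ do rewrite (gr_mulE _ _ (fsubset_refl A)) mulr_suml.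
rewrite exchange_big /= [LHS]big_seq [RHS]big_seq; apply: eq_bigr => x xA.
under [RHS]eq_bigr => z _ do rewrite -mulrA.
rewrite -mulr_sumr (gr_mulE _ _ (fsubset_refl B)); congr (_ * _).
have sxB : [fset (x + y)%R | y in B] `<=` Z.
  by apply/fsubsetP => _ /imfsetP[y /= yB ->]; apply/imfset2P; exists x => //; exists y.
rewrite -(big_fset_incl _ sxB) /=; last first.
  move=> z _ zN; case: (finsuppP b (z - x)) => [_|zB]; first by rewrite mul0r.
  have := in_imfset imfset_key (+%R x) zB.
  by rewrite [(x + _)%R]addrC subrK (negPf zN).
rewrite big_imfset /=; last by move=> y z _ _ /addrI.
by apply: eq_bigr => y _; rewrite [(x + y - x)%R]addrAC subrr add0r opprD addrA.
Qed.

Lemma gr_mulC : commutative gr_mul.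
Proof.
move=> a b; apply/fsfunP => g; set A := finsupp a; set B := finsupp b.
pose gA := [fset (g - x)%R | x in A].
rewrite (gr_mulE _ _ (fsubset_refl A)) (gr_mulE _ _ (fsubsetUl B gA)).
rewrite -(big_fset_incl _ (fsubsetUr B gA)) /=; last first.
  move=> z _ zN; case: (finsuppP a (g - z)) => [_|zA]; first by rewrite mulr0.
  have := in_imfset imfset_key (fun x => g - x)%R zA.
  by rewrite subKr (negPf zN).
rewrite big_imfset /=; last by move=> y z _ _ /addrI/oppr_inj.
by apply: eq_bigr => x _; rewrite subKr mulrC.
Qed.

Lemma gr_mul1 : left_id (gr_exp 0) gr_mul.
Proof.
move=> a; apply/fsfunP => g.
rewrite (gr_mulE (A := [fset 0%R])); last by rewrite finsupp_sub.
by rewrite big_seq_fset1 gr_expE eqxx mul1r subr0.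
Qed.

Lemma gr_mulDl : left_distributive gr_mul (@GRing.add (groupRing G)).
Proof.
move=> a b c; apply/fsfunP => g.
set A := finsupp a `|` finsupp b.
rewrite gr_addE (gr_mulE (A := A)) ?finsupp_sub // .
rewrite (gr_mulE _ _ (fsubsetUl _ (finsupp b) : _ `<=` A)).
rewrite (gr_mulE _ _ (fsubsetUr (finsupp a) _ : _ `<=` A)) -big_split /=.
by apply: eq_bigr => x _; rewrite gr_addE mulrDl.
Qed.

Lemma gr_1neq0 : gr_exp 0 != 0 :> groupRing G.
Proof.
apply/eqP => /fsfunP/(_ 0); rewrite gr_expE eqxx gr_zeroE.
by move=> /eqP; rewrite oner_eq0.
Qed.

HB.instance Definition _ := GRing.Zmodule_isComNzRing.Build (groupRing G)
  gr_mulA gr_mulC gr_mul1 gr_mulDl gr_1neq0.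

(* the ring involution e^g |-> e^(-g) *)
Definition gr_conj a : groupRing G :=
  [fsfun g in [fset (- x)%R | x in finsupp a] => a (- g)].

(* the ring morphism e^g |-> 1 to the rationals *)
Definition gr_aug a : rat := (\sum_(g <- finsupp a) a g)%:~R.

End GroupRing.

Section PositiveSubsets.
Local Open Scope classical_set_scope.
Local Open Scope ring_scope.
Context (L : zmodType).
Implicit Types (X : set L) (l : L).

Definition symm_part X : set L := X `&` (-%R @` X).

Definition positive X : Prop :=
  [/\ X `|` (-%R @` X) = setT,
      [set x + y | x in X & y in X] `<=` X
    & zmod_closed (mem (symm_part X))].

Record Pos := MkPos { pos_set :> set L; pos_setP : positive pos_set }.

HB.instance Definition _ := gen_eqMixin Pos.
HB.instance Definition _ := gen_choiceMixin Pos.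

(* the topology of Pos L has the U(E), E finite, as a base of open sets *)
Definition basicU (E : set L) : set Pos := [set X : Pos | X `&` E = set0].

Lemma basicU_cover : \bigcup_(E in @finite_set L) basicU E = setT.
Proof.
apply/seteqP; split=> // X _; exists set0 => //=.
by rewrite /basicU /= setI0.
Qed.

Lemma basicU_join (E F : set L) (X : Pos) :
  finite_set E -> finite_set F -> basicU E X -> basicU F X ->
  exists G, [/\ finite_set G, basicU G X & basicU G `<=` basicU E `&` basicU F].
Proof.
rewrite /basicU /= => fE fF EX FX; exists (E `|` F); split=> /=.
- by rewrite finite_setU.
- by rewrite setIUr EX FX setU0.
- by move=> Y /=; rewrite setIUr setU_eq0.
Qed.

HB.instance Definition _ :=
  isBaseTopological.Build Pos basicU_cover basicU_join.

Definition halfU l : set Pos := basicU [set l].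
Definition hyperplane l : set Pos := [set X : Pos | symm_part X l].

End PositiveSubsets.

Section QuotientGroup.
Local Open Scope classical_set_scope.
Local Open Scope quotient_scope.
Local Open Scope ring_scope.
Context (L : zmodType) (X : Pos L).

Definition symm_pred : {pred L} := fun x => x \in symm_part X.

Lemma symm_pred_closed : zmod_closed symm_pred.
Proof. by case: (pos_setP X). Qed.

HB.instance Definition _ :=
  GRing.isZmodClosed.Build L symm_pred symm_pred_closed.

Definition GammaZ : zmodType := Quotient.quot symm_pred.

Definition toGamma (x : L) : GammaZ := \pi_GammaZ x.

Definition Gamma_le (g h : GammaZ) : bool :=
  `[< exists2 x : L, pos_set X x & toGamma x = h - g >].

Lemma toGammaB x y : toGamma (x - y) = toGamma x - toGamma y.
Proof. exact: raddfB. Qed.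

Lemma toGamma_eq0 x : (toGamma x == 0) = (x \in symm_part X).
Proof.
by have /esym := Quotient.idealrBE symm_pred x 0; rewrite subr0 raddf0.
Qed.

Lemma pos_addr x y : pos_set X x -> pos_set X y -> pos_set X (x + y).
Proof. by case: (pos_setP X) => _ + _ Xx Xy; apply; exists x => //; exists y. Qed.

Lemma pos_total x : pos_set X x \/ pos_set X (- x).
Proof.
case: (pos_setP X) => + _ _; move=> /seteqP[_ /(_ x Logic.I)] [|[y Xy <-]]; first by left.
by right; rewrite opprK.
Qed.

Lemma symm_partE x : symm_part X x <-> pos_set X x /\ pos_set X (- x).
Proof.
split=> [[Xx [y Xy yx]]|[Xx Xnx]]; first by rewrite -{2}yx opprK; split.
by split=> //; exists (- x); rewrite ?opprK.
Qed.

Lemma pos_toGamma x y : toGamma x = toGamma y -> pos_set X x -> pos_set X y.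
Proof.
move=> /eqP; rewrite -subr_eq0 -toGammaB toGamma_eq0 => /set_mem/symm_partE[_].
by rewrite opprB => Xyx Xx; rewrite -(subrK x y); apply: pos_addr.
Qed.

Lemma Gamma_leE x y : Gamma_le (toGamma x) (toGamma y) <-> pos_set X (y - x).
Proof.
rewrite /Gamma_le -toGammaB; split=> [/asboolP[z Xz /pos_toGamma]|]; first exact.
by move=> H; apply/asboolP; exists (y - x).
Qed.

Lemma toGamma_surj g : exists x, g = toGamma x.
Proof. by exists (repr g); rewrite /toGamma reprK. Qed.

Lemma Gamma_le_refl : reflexive Gamma_le.
Proof.
move=> g; have [x ->] := toGamma_surj g; apply/Gamma_leE; rewrite subrr.
by have [|] := pos_total 0; rewrite ?oppr0.
Qed.

Lemma Gamma_le_anti : antisymmetric Gamma_le.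
Proof.
move=> g h; have [x ->] := toGamma_surj g; have [y ->] := toGamma_surj h.
move=> /andP[/Gamma_leE xy /Gamma_leE yx]; apply/eqP.
rewrite -subr_eq0 -toGammaB toGamma_eq0; apply/mem_set/symm_partE.
by rewrite opprB.
Qed.

Lemma Gamma_le_trans : transitive Gamma_le.
Proof.
move=> h g k; have [x ->] := toGamma_surj g; have [y ->] := toGamma_surj h.
have [z ->] := toGamma_surj k => /Gamma_leE xy /Gamma_leE yz; apply/Gamma_leE.
by rewrite -(subrK y z) -addrA; apply: pos_addr.
Qed.

Lemma Gamma_le_total : total Gamma_le.
Proof.
move=> g h; have [x ->] := toGamma_surj g; have [y ->] := toGamma_surj h.
have [/Gamma_leE ->//|] := pos_total (y - x).
by rewrite opprB => /Gamma_leE ->; rewrite orbT.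
Qed.

Lemma Gamma_le_add2l g h k : Gamma_le h k -> Gamma_le (g + h) (g + k).
Proof.
by move=> /asboolP[x Xx xE]; apply/asboolP; exists x; rewrite // xE opprD addrACA subrr add0r.
Qed.

Definition Gamma : orderedZmod :=
  OrderedZmod Gamma_le_refl Gamma_le_anti Gamma_le_trans Gamma_le_total
    Gamma_le_add2l.

End QuotientGroup.

Section Coxeter.
Local Open Scope group_scope.
Context (W : finGroupType) (S : {set W}).

(* W is the group presented by the generators S subject to the relations
   (s t)^m(s,t) = 1, where m(s,t) is the order of s t in W (so m(s,s) = 1) *)
Definition coxeter_system : Prop :=
  [/\ {in S, forall s, #[s] = 2%N},
      <<S>> = [set: W]
    & forall (G : groupType) (f : W -> G),
        {in S &, forall s t, (f s * f t) ^+ #[s * t] = 1} ->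
        exists2 g : W -> G, {morph g : x y / x * y} & {in S, g =1 f}].

(* least n such that w is a product of n elements of S;
   if S generates W, every element is such a product with n < #|W| *)
Definition cox_len (w : W) : nat := find (fun n => w \in S ^+ n) (iota 0 #|W|).

Definition Sclasses : {set {set W}} := [set (s ^: [set: W]) :&: S | s in S].

(* the finite type of elements of S-bar; such an element is a subset of S *)
Definition Sbar := {o : {set W} | o \in Sclasses}.

HB.instance Definition _ := Finite.on Sbar.

Definition ZSbar : zmodType := {ffun Sbar -> int}.

Definition ebar (o : Sbar) : ZSbar := [ffun o' => (o' == o)%:R%R].

(* the basis element of Z[S-bar] given by the class of s, for s in S *)
Definition egen (s : W) : ZSbar := [ffun o : Sbar => (s \in val o)%:R%R].

End Coxeter.

Inductive side := LeftSide | RightSide | TwoSided.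

Section Hecke.
Local Open Scope ring_scope.
Context (W : finGroupType) (S : {set W}) (G : orderedZmod).
Context (phi : Sbar S -> G).

Local Notation R := (groupRing G).

(* h : hecke stands for the sum of the h w *: T_w *)
Definition hecke := {ffun W -> R^o}.

HB.instance Definition _ := GRing.Lmodule.on hecke.

Definition hT (w : W) : hecke := [ffun x => (x == w)%:R].

(* for o : Sbar S, the elements of val o are the s in S whose class is o, so
   that phi o is the parameter written phi(s) for each of them *)
Definition hecke_mul_spec (mul : hecke -> hecke -> hecke) : Prop :=
  [/\ associative mul,
      forall a h h' k, mul (a *: h + h') k = a *: mul h k + mul h' k,
      forall a h k k', mul h (a *: k + k') = a *: mul h k + mul h k',
      forall w w', cox_len S (w * w')%g = (cox_len S w + cox_len S w')%N ->
        mul (hT w) (hT w') = hT (w * w')%g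
    & forall (o : Sbar S) (s : W), s \in val o ->
        mul (hT s - gr_exp (phi o) *: hT 1%g)
            (hT s + gr_exp (- phi o) *: hT 1%g) = 0].

(* there is exactly one multiplication satisfying hecke_mul_spec when (W, S) is
   a Coxeter system; in the same way, the other uses of xget below select the
   unique element of a set *)
Definition hecke_mul : hecke -> hecke -> hecke :=
  xget (fun _ _ => 0) [set mul | hecke_mul_spec mul]%classic.

Local Notation "h ** k" := (hecke_mul h k)
  (at level 40, left associativity, format "h  **  k").

Definition hecke_inv (h : hecke) : hecke :=
  xget 0 [set k : hecke | h ** k = hT 1%g /\ k ** h = hT 1%g]%classic.

(* the bar involution is forced by its additivity and its values
   e^g |-> e^(-g) and T_w |-> (T_(w^-1))^-1 *)
Definition hecke_bar (h : hecke) : hecke :=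
  \sum_(w : W) gr_conj (h w) *: hecke_inv (hT w^-1%g).

Definition gr_negative (a : R) : Prop :=
  forall g, g \in finsupp a -> oz_lt g 0.

Definition KL_spec (w : W) (c : hecke) : Prop :=
  hecke_bar c = c /\ forall x, gr_negative ((c - hT w) x).

Definition hC (w : W) : hecke := xget 0 [set c | KL_spec w c]%classic.

(* coordinates of h in the basis (C_w) *)
Definition hC_coord (h : hecke) : {ffun W -> R} :=
  xget [ffun=> 0]
    [set c : {ffun W -> R} | h = \sum_(w : W) c w *: hC w]%classic.

Definition mul_side (k : side) (h h' c : hecke) : hecke :=
  match k with
  | LeftSide => h ** c
  | RightSide => c ** h
  | TwoSided => h ** c ** h'
  end.

Definition cell_step (k : side) : rel W := fun x y =>
  `[< exists h h' : hecke, hC_coord (mul_side k h h' (hC y)) x != 0 >].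

(* connect is the reflexive transitive closure; cell_step is already
   reflexive (take h = h' = T_1) *)
Definition cell_le (k : side) : rel W := connect (cell_step k).

Definition cell_eq (k : side) : rel W := fun x y =>
  cell_le k x y && cell_le k y x.

Definition cells (k : side) : {set {set W}} :=
  equivalence_partition (cell_eq k) [set: W].

(* For a left cell C, the classes of the C_x, x in C, form a basis of the
   left cell module M_C, and also of its specialization over rat; the
   following is the matrix of the action of T_w on the latter *)
Definition cell_mx (C : {set W}) (w : W) : 'M[rat]_#|C| :=
  \matrix_(i, j) gr_aug (hC_coord (hT w ** hC (enum_val j)) (enum_val i)).

Definition cell_char (C : {set W}) (w : W) : rat := \tr (cell_mx C w).

End Hecke.

Section Arrangements.
Local Open Scope classical_set_scope.
Local Open Scope ring_scope.
Context (L : zmodType).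
Implicit Types (A : set (set (Pos L))) (F : set (Pos L)).

Definition arrangement A : Prop :=
  finite_set A /\ A `<=` [set hyperplane l | l in [set l : L | l != 0]].

Definition arr_equiv A (X Y : Pos L) : Prop :=
  forall l : L, l != 0 -> A (hyperplane l) ->
    [/\ halfU l X <-> halfU l Y,
        hyperplane l X <-> hyperplane l Y
      & halfU (- l) X <-> halfU (- l) Y].

Definition facet A F : Prop := exists X, F = [set Y | arr_equiv A X Y].

Definition chamber A F : Prop :=
  facet A F /\ forall H, A H -> F `&` H = set0.

Definition facet_le F F' : Prop := closure F `<=` closure F'.

End Arrangements.

Section Semicontinuity.
Context (W : finGroupType) (S : {set W}).
Local Notation P := (Pos (ZSbar S)).
Implicit Types (A : set (set P)) (F : set P) (C : {set W}) (X Y : P).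

Definition phiX X (o : Sbar S) : Gamma X := toGamma X (ebar o).

Definition complete_arr A : Prop := forall o : Sbar S, A (hyperplane (ebar o)).

Definition W_facet F : {group W} :=
  <<\bigcup_(o : Sbar S | `[< (F `<=` hyperplane (ebar o))%classic >]) val o>>%G.

(* the relation ~_F, i.e. ~_X for any X in F (condition (a) below makes this
   independent of X) *)
Definition facet_eq (k : side) F : rel W := fun x y =>
  `[< exists2 X, F X & cell_eq (phiX X) k x y >].

Definition facet_cells (k : side) F : {set {set W}} :=
  equivalence_partition (facet_eq k F) [set: W].

Definition condA A (k : side) : Prop :=
  forall F, facet A F -> forall X Y, F X -> F Y ->
    cell_eq (phiX X) k =2 cell_eq (phiX Y) k.

Definition condB1 A (k : side) F C : Prop :=
  forall D, chamber A D -> facet_le F D ->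
    exists2 Q : {set {set W}}, Q \subset facet_cells k D & C = finset.cover Q.

Definition condB2 (k : side) F C : Prop :=
  match k with
  | LeftSide => (W_facet F * C)%g \subset C
  | RightSide => (C * W_facet F)%g \subset C
  | TwoSided => (W_facet F * C * W_facet F)%g \subset C
  end.

Definition condB A (k : side) : Prop :=
  forall F, facet A F -> forall C,
    C \in facet_cells k F <->
    minset (fun D => (D != finset.set0) && `[< condB1 A k F D /\ condB2 k F D >]) C.

Definition admissible A : Prop :=
  [/\ arrangement A, complete_arr A & forall k, condA A k /\ condB A k].

Definition conjectureA : Prop := exists A, admissible A.

Definition essential A : Prop :=
  admissible A /\ forall B, admissible B -> (A `<=` B)%classic.

Definition conjectureBminus : Prop :=
  forall A, essential A ->
  forall X C, C \in cells (phiX X) LeftSide ->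
  forall D Y, chamber A D -> closure D X -> D Y ->
    exists Q : {set {set W}},
      [/\ finset.partition Q C, Q \subset cells (phiX Y) LeftSide
        & forall w, cell_char (phiX X) C w =
            (\sum_(C' in Q) cell_char (phiX Y) C' w)%R].

End Semicontinuity.

(* Main.v *)
From HB Require Import structures.
Require Import Defs.
From mathcomp Require Import all_boot all_order all_algebra all_fingroup.
From mathcomp Require Import cyclic finmap zify ring.
From mathcomp Require Import boolp classical_sets cardinality topology.

Set Implicit Arguments.
Unset Strict Implicit.
Unset Printing Implicit Defensive.

Import Order.TTheory GRing.Theory Num.Theory.

(* Every element of [W] is an alternating word in the two generators, so the
   whole theory can be made explicit.  Up to signs, which are absorbed in the
   parameters, the weights at the two generators are in one of four relative
   positions: both zero, equal and nonzero, one dominating the other, which is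
   nonzero, or one of them zero.  In each position the Kazhdan-Lusztig basis and
   the action of the generators on it have a closed form, from which cells and
   left cell characters are read off; the characters depend only on the signs of
   the nonzero weights.

   The four hyperplanes [H_s], [H_t], [H_(s-t)], [H_(s+t)] separate the relative
   positions and the signs, which gives (a).  If [X] and [Z] are positive, the
   order of [X] refined lexicographically by that of [Z] is positive and has [X]
   in the closure of its facet.  A suitable [Z] produces a chamber (two chambers
   when the weights are equal) next to the facet of [X], and the cells of [X] are
   obtained by merging the cells of these chambers and translating by the
   parabolic subgroup of the facet, which gives (b).  A complete arrangement
   without [H_(s-t)] or [H_(s+t)] would identify a point of that hyperplane with
   a chamber next to it, although a generator forms a left cell only in the
   chamber. *)

(** * Alternating words in a dihedral group *)

(** Cells are bounded from both sides. Spans of Kazhdan-Lusztig elements that are stable under the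
    generators yield invariants of left cells: right descents and membership in a few small sets.
    Conversely, nonzero structure constants link the elements that these invariants do not separate.
    The anti-involution sending [T_w] to [T_(w^-1)] carries this over to right cells, and sets
    stable under inversion bound two-sided cells. Characters are compared without being decomposed.
    Every left cell is all of [W], a set of at most two elements, or what remains of the left ideal
    of a descent, or of its complement, after such a set is removed. On small sets the generators
    act monomially modulo lower terms; at [e^gamma = 1] the ideal becomes an induced module,
    independent of the order on weights. A vanishing weight takes an arbitrary sign in an adjacent
    chamber, harmlessly: a two-element cell carries the sum of the linear characters for both signs.
    Evenness of the order of [s t] keeps the generators non-conjugate; its being at least 4 keeps
    words of length two outside the exceptional cells. *)

Section DihedralWords.
Local Open Scope group_scope.

Record dihedral (W : finGroupType) := Dihedral {
  dgen : bool -> W;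
  dm : nat;
  dm_ge2 : 1 < dm;
  dgen_inv : forall b, dgen b * dgen b = 1;
  dgen_order : #[dgen true * dgen false] = (2 * dm)%N;
  dgen_full : <<[set dgen true; dgen false]>> = [set: W] }.

Context (W : finGroupType) (D : dihedral W).
Local Notation gen := (dgen D).
Local Notation m := (dm D).

Definition dS : {set W} := [set gen true; gen false].
Definition dn : nat := (2 * m)%N.
Local Notation n := dn.

Lemma dn_ge4 : 3 < n.
Proof. have := dm_ge2 D; rewrite /n; lia. Qed.

Lemma odd_dn : odd n = false.
Proof. by rewrite /n oddM. Qed.

Fixpoint wd (b : bool) (k : nat) : W :=
  if k is k'.+1 then gen b * wd (~~ b) k' else 1.

Lemma wdS b k : wd b k.+1 = gen b * wd (~~ b) k. Proof. by []. Qed.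

Lemma wdD b j k : wd b (j + k) = wd b j * wd (b (+) odd j) k.
Proof.
elim: j b => [|j IH] b; first by rewrite /= mul1g addbF.
by rewrite addSn /= IH mulgA addbN addNb.
Qed.

Lemma wdSr b k : wd b k.+1 = wd b k * gen (b (+) odd k).
Proof. by rewrite -addn1 wdD /= mulg1. Qed.

Lemma dgenV b : (gen b)^-1 = gen b.
Proof. by apply/eqP; rewrite eq_invg_mul dgen_inv. Qed.

Lemma genK b : cancel (mulg (gen b)) (mulg (gen b)).
Proof. by move=> x; rewrite mulgA dgen_inv mul1g. Qed.

Lemma genKr b : cancel (mulg^~ (gen b)) (mulg^~ (gen b)).
Proof. by move=> x; rewrite -mulgA dgen_inv mulg1. Qed.

Lemma gen_wd b k : gen b * wd b k.+1 = wd (~~ b) k.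
Proof. by rewrite /= genK. Qed.

Lemma wdV b k : (wd b k)^-1 = wd (b (+) ~~ odd k) k.
Proof.
elim: k b => [|k IH] b; first by rewrite /= invg1.
by rewrite wdSr invMg dgenV IH /= negbK; case: b; case: (odd k).
Qed.

Lemma wd_double b i : wd b (2 * i) = (gen b * gen (~~ b)) ^+ i.
Proof.
elim: i => [|i IH]; first by rewrite muln0 expg0.
by rewrite mulnS wdD [odd 2]/= addbF IH expgS /= mulg1.
Qed.

Lemma order_gen2 b : #[gen b * gen (~~ b)] = n.
Proof.
case: b; first exact: dgen_order.
by rewrite -orderV invMg !dgenV; exact: dgen_order.
Qed.

Lemma gen_neq1 b : gen b != 1.
Proof.
apply/eqP => b1; have := dgen_order D; have := dm_ge2 D.
have : #[gen (~~ b)] <= 2 by rewrite dvdn_leq // order_dvdn expgS expg1 dgen_inv.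
by case: b b1 => /= ->; rewrite ?mul1g ?mulg1; lia.
Qed.

Lemma wd_eq1 b j : (wd b j == 1) = (2 * n %| j).
Proof.
have [[i ->]|[i ->]] : (exists i, j = (2 * i)%N) \/ (exists i, j = (i + 1 + i)%N).
    by have := odd_double_half j; case: (odd j) => <-; [right|left]; exists j./2; lia.
  by rewrite dvdn_pmul2l // wd_double -order_dvdn order_gen2.
(* A word of odd length is a palindrome, hence a conjugate of a generator and not trivial. *)
have -> : (2 * n %| i + 1 + i) = false by apply/negP => /dvdnP[z]; lia.
rewrite 2!wdD [wd _ 1]/= mulg1.
have -> : b (+) odd (i + 1) = b (+) ~~ odd i by rewrite oddD addbT.
rewrite -wdV; apply/negP => /eqP e; have /eqP[] := gen_neq1 (b (+) odd i).
apply: (mulgI (wd b i)); apply: (mulIg (wd b i)^-1).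
by rewrite e mulg1 mulgV.
Qed.

(** The Cayley graph is a cycle of length [2 * n]; the two words run around it in opposite
    directions and end at the same vertex. *)
Lemma wd_full b k : k <= 2 * n -> wd b k = wd (~~ b) (2 * n - k).
Proof.
move=> kn; apply: (mulIg (wd (~~ b) (2 * n - k))^-1).
rewrite mulgV wdV oddB // oddM /=.
have -> : ~~ b (+) ~~ odd k = b (+) odd k by case: b; case: (odd k).
by rewrite -wdD subnKC //; apply/eqP; rewrite wd_eq1.
Qed.

(** By [wd_full] both words can be made to start with the same letter, and then equality means that
    [2 * n] divides the difference of the lengths. *)
Lemma wd_eq b c k i : k <= n -> i <= n ->
  (wd b k == wd c i) = (k == i) && [|| b == c, k == 0 | k == n].
Proof.
have n4 := dn_ge4.
have key d j j' : j <= j' -> (wd d j == wd d j') = (2 * n %| j' - j).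
  move=> jj; rewrite -{1}(subnKC jj) wdD -[X in X == _]mulg1.
  by rewrite (inj_eq (mulgI _)) eq_sym wd_eq1.
move=> kn iN; have [->|] := eqVneq b c; rewrite ?andbT.
  wlog ki : k i kn iN / k <= i => [H|].
    by case: (leqP k i) => [|/ltnW] ki; [|rewrite eq_sym [RHS]eq_sym]; apply: H.
  rewrite key //; apply/dvdnP/eqP => [[[|z]]|->]; [lia | lia | by exists 0; lia].
move=> nbc; have -> : c = ~~ b by case: b c nbc => [] [].
have -> : wd (~~ b) i = wd b (2 * n - i) by rewrite wd_full ?negbK //; lia.
rewrite key; last lia.
by apply/dvdnP/idP => [[[|[|z]]]|H]; [lia | lia | lia | exists (k == 0); lia].
Qed.

Lemma wd_n b c : wd b n = wd c n.
Proof. by apply/eqP; rewrite wd_eq ?eqxx ?orbT. Qed.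

Lemma wd_exists w : exists b k, k <= n /\ w = wd b k.
Proof.
have n4 := dn_ge4.
have : w \in <<[set gen true; gen false]>> by rewrite dgen_full inE.
case/gen_prodgP => i [c cP ->] {w}; elim: i c cP => [|i IH] c cP.
  by rewrite big_ord0; exists true, 0.
rewrite big_ord_recl; have [j|b [k [kn ->]]] := IH (fun j => c (lift ord0 j)).
  exact: cP.
have [d ->] : exists d, c ord0 = gen d.
  by have := cP ord0; rewrite !inE => /orP[] /eqP ->; [exists true | exists false].
have [->|nbd] := eqVneq d b.
  case: k kn => [|k] kn; first by exists b, 1%N; rewrite /= mulg1; split => //; lia.
  by exists (~~ b), k; rewrite gen_wd; split => //; lia.
have -> : b = ~~ d by case: b d nbd => [] [].
have [->|kn'] := eqVneq k n.
  exists (~~ d), n.-1; rewrite (wd_n _ d); split; first by lia.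
  by rewrite -{1}[n](@prednK n) ?gen_wd //; lia.
by exists d, k.+1; split; first lia.
Qed.

(** Splits according to whether [gen b] is a left descent. The longest element, which has both
    descents, falls under the first alternative only; hence the strict bounds. *)
Lemma wd_case b w :
  (exists2 k, k < n & w = wd b k.+1) \/ (exists2 k, k < n & w = wd (~~ b) k).
Proof.
have n4 := dn_ge4.
have [c [k [kn ->]]] := wd_exists w; have [->|nbc] := eqVneq c b.
  case: k kn => [|k] kn; [right; exists 0 => // | left; exists k => //]; lia.
have -> : c = ~~ b by case: b c nbc => [] [].
have [->|kn'] := eqVneq k n; last by right; exists k => //; lia.
by left; exists n.-1; rewrite ?prednK ?(wd_n _ b) //; lia.
Qed.

Local Notation len := (cox_len dS).

(** [cox_len] searches below [#|W|] only; this puts all lengths up to [n] within its range. *)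
Lemma card_gt_dn : n < #|W|.
Proof.
have inj : injective (fun k : 'I_n.+1 => wd true k).
  move=> i j /eqP; rewrite wd_eq -1?ltnS ?ltn_ord // => /andP[/eqP/val_inj //].
by have := max_card (mem (codom (fun k : 'I_n.+1 => wd true k))); rewrite card_codom // card_ord.
Qed.

Lemma wd_expS b k : wd b k \in dS ^+ k.
Proof.
elim: k b => [|k IH] b; first by rewrite expg0 inE.
by rewrite expgS /= mem_mulg // !inE; case: b; rewrite eqxx ?orbT.
Qed.

Lemma expS_wd w j : w \in dS ^+ j -> exists b i, [/\ i <= j, i <= n & w = wd b i].
Proof.
have n4 := dn_ge4.
elim: j w => [|j IH] w; first by rewrite expg0 => /set1P ->; exists true, 0.
rewrite expgS => /mulsgP[x y xS /IH[b [i [ij iN ->]]] ->].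
have [d ->] : exists d, x = gen d.
  by move: xS; rewrite !inE => /orP[] /eqP ->; [exists true | exists false].
have [->|nbd] := eqVneq d b.
  case: i ij iN => [|i] ij iN.
    by exists b, 1%N; rewrite /= mulg1; split => //; lia.
  by exists (~~ b), i; rewrite gen_wd; split => //; lia.
have -> : b = ~~ d by case: b d nbd => [] [].
have [iE|kn'] := eqVneq i n; last by exists d, i.+1; split => //; lia.
exists (~~ d), n.-1; rewrite iE (wd_n _ d); split; [lia|lia|].
by rewrite -{1}[n](@prednK n) ?gen_wd //; lia.
Qed.

Lemma len_wd b k : k <= n -> len (wd b k) = k.
Proof.
move=> kn; have cn := card_gt_dn; rewrite /cox_len.
have hasP : has (fun i => wd b k \in dS ^+ i) (iota 0 #|W|).
  by apply/hasP; exists k; rewrite ?wd_expS // mem_iota; lia.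
have fl := hasP; rewrite has_find size_iota in fl.
have := nth_find 0 hasP; rewrite nth_iota // add0n => /expS_wd[c [i [ij iN]]].
move/eqP; rewrite wd_eq // => /andP[/eqP ki _].
apply/eqP; rewrite eqn_leq; apply/andP; split; last by lia.
rewrite leqNgt; apply/negP => /(before_find 0).
by rewrite nth_iota ?wd_expS //; lia.
Qed.

Definition ldes b w : bool := len (gen b * w) < len w.

Lemma len_le w : len w <= n.
Proof. by have [b [k [kn ->]]] := wd_exists w; rewrite len_wd. Qed.

Lemma ldes_wd b k : k < n -> ldes b (wd b k.+1).
Proof. by move=> kn; rewrite /ldes gen_wd !len_wd //; lia. Qed.

Lemma ldes_wdN b k : k < n -> ldes b (wd (~~ b) k) = false.
Proof. by move=> kn; rewrite /ldes -wdS !len_wd //; lia. Qed.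

(* The number of letters [c] in a reduced word of [w]; both reduced words of
   the longest element agree on it because [dn] is even. *)
Definition lcnt c w : nat :=
  if c == ldes true w then uphalf (len w) else (len w)./2.

Lemma lcnt_wd c b k : k <= n -> lcnt c (wd b k) = if c == b then uphalf k else k./2.
Proof.
move=> kn; rewrite /lcnt len_wd //; have n4 := dn_ge4.
case: (eqVneq k n) => [->|kn'].
  by rewrite uphalf_half odd_dn add0n !if_same.
case: b => /=; last by rewrite (ldes_wdN true) //; lia.
case: k kn kn' => [|k] kn kn'; first by rewrite !if_same.
by rewrite ldes_wd.
Qed.

Lemma lcnt_len w : len w = (lcnt true w + lcnt false w)%N.
Proof.
have [b [k [kn ->]]] := wd_exists w; rewrite !lcnt_wd // len_wd //.
by rewrite -[LHS]odd_double_half -addnn uphalf_half; case: b => /=; lia.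
Qed.

(** In an alternating word both counts are half of the length up to rounding, so a strictly shorter
    word has no more of either letter. This keeps the exponents in [Gam_neg] from being negative. *)
Lemma lcnt_le c y w : len y < len w -> lcnt c y <= lcnt c w.
Proof.
have [b [k [kn ->]]] := wd_exists w; have [d [i [iN ->]]] := wd_exists y.
by rewrite !lcnt_wd // !len_wd // !uphalf_half; do 2 case: ifP => _; lia.
Qed.

Lemma lenV w : len w^-1 = len w.
Proof. by have [b [k [kn ->]]] := wd_exists w; rewrite wdV !len_wd. Qed.

Lemma lcnt_gen c b w : ldes b w = false -> lcnt c (gen b * w) = ((c == b) + lcnt c w)%N.
Proof.
have [[k kn ->]|[k kn ->]] := wd_case b w; first by rewrite ldes_wd.
rewrite ldes_wdN // => _; rewrite -wdS !lcnt_wd //; last exact: ltnW.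
by case: b c => [] [] /=; rewrite ?uphalf_half; lia.
Qed.

Lemma len_gen b w : len (gen b * w) = if ldes b w then (len w).-1 else (len w).+1.
Proof.
have [[k kn ->]|[k kn ->]] := wd_case b w.
  by rewrite ldes_wd // gen_wd !len_wd //; lia.
by rewrite ldes_wdN // -wdS !len_wd //; lia.
Qed.

Lemma ldes_gen b w : ldes b (gen b * w) = ~~ ldes b w.
Proof.
have [[k kn ->]|[k kn ->]] := wd_case b w.
  by rewrite ldes_wd // gen_wd ldes_wdN.
by rewrite ldes_wdN // -wdS ldes_wd.
Qed.

Lemma ldesE c b k : k <= n -> ldes c (wd b k) = (0 < k) && ((c == b) || (k == n)).
Proof.
case: k => [|k] kn; first by rewrite -[wd b 0]/(wd (~~ c) 0) ldes_wdN //; have := dn_ge4; lia.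
have [->|cb] := eqVneq c b; first by rewrite ldes_wd.
have [->|kn'] := eqVneq k.+1 n; last first.
  have -> : b = ~~ c by case: b c cb => [] [].
  by rewrite ldes_wdN //; lia.
by have n4 := dn_ge4; rewrite (wd_n _ c) -[n]prednK ?ldes_wd //; lia.
Qed.

Definition rdes c w := ldes c w^-1.

Lemma rdesE c b k : k <= n ->
  rdes c (wd b k) = (0 < k) && ((c == b (+) ~~ odd k) || (k == n)).
Proof. by move=> kn; rewrite /rdes wdV ldesE. Qed.

Lemma wd_canon w : w = wd (ldes true w) (len w).
Proof.
have [b [k [kn ->]]] := wd_exists w; rewrite len_wd // ldesE //.
apply/eqP; rewrite wd_eq // eqxx /=; case: k kn => [|k] kn; first by rewrite orbT.
by case: (_ == n); rewrite ?orbT // orbF; case: b.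
Qed.

(** The homomorphism to Z/2 that is 1 on [gen c] and 0 on the other generator. It exists because [n]
    is even, and it shows that the generators are not conjugate. *)
Definition par c w := odd (lcnt c w).

Lemma par_gen c b w : par c (gen b * w) = (c == b) (+) par c w.
Proof.
case E : (ldes b w); last by rewrite /par lcnt_gen // oddD; case: (c == b).
have := @lcnt_gen c b (gen b * w); rewrite ldes_gen E genK => /(_ erefl) e.
by rewrite /par e oddD; case: (c == b); case: (odd _).
Qed.

Lemma par1 c : par c 1 = false.
Proof. by rewrite /par -[1]/(wd true 0) lcnt_wd // if_same. Qed.

Lemma parM c v w : par c (v * w) = par c v (+) par c w.
Proof.
have [b [k [_ ->]]] := wd_exists v; elim: k b => [|k IH] b.
  by rewrite mul1g par1.
by rewrite wdS -mulgA !par_gen IH addbA.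
Qed.

Lemma gen_conj_eq b c x : gen b * x = x * gen c -> b = c.
Proof.
move=> e; have := congr1 (par b) e.
rewrite !parM addbC => /addbI; rewrite -[gen b]mulg1 -[gen c]mulg1 !par_gen par1.
by case: b c {e} => [] [].
Qed.

Lemma gen_class_eq b c : gen b \in gen c ^: [set: W] -> b = c.
Proof.
case/imsetP => x _ e; apply: (@gen_conj_eq _ _ x^-1).
by rewrite e conjgE ?mulgA mulgK.
Qed.

(** A form of the exchange condition: left multiplication by [gen b] can alter the right descent at
    [gen c] only when it coincides with right multiplication by [gen c]. *)
Lemma rdes_gen c b w : rdes c (gen b * w) = rdes c w \/ gen b * w = w * gen c.
Proof.
have n4 := dn_ge4.
have [[k kn ->]|[k kn ->]] := wd_case b w.
  rewrite gen_wd !rdesE //; last exact: ltnW.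
  case: k kn => [|k] kn.
    have [->|cb] := eqVneq c b; first by right; rewrite /= mulg1 dgen_inv.
    by left; rewrite /= addbF (negPf cb) /=; lia.
  have -> : (k.+1 == n) = false by lia.
  have [kn'|kn'] := eqVneq k.+2 n; last first.
    by left; rewrite /=; case: (b); case: (odd k).
  have [cE|cE] := eqVneq c (~~ b (+) odd k); first by left; rewrite cE /=; case: (b); case: (odd k).
  right; rewrite kn' (wd_n b (~~ b)) -kn' [in RHS]wdSr.
  suff -> : ~~ b (+) odd k.+1 = c by rewrite genKr.
  by move: cE; rewrite /=; case: (c); case: (b); case: (odd k).
rewrite -wdS !rdesE //; last exact: ltnW.
case: k kn => [|k] kn.
  have [->|cb] := eqVneq c b; first by right; rewrite /= mul1g mulg1.
  by left; rewrite /= addbF (negPf cb) /=; lia.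
have -> : (k.+1 == n) = false by lia.
have [kn'|kn'] := eqVneq k.+2 n; last first.
  by left; rewrite /=; case: (b); case: (odd k).
have [cE|cE] := eqVneq c (~~ b (+) odd k); first by left; rewrite cE /=; case: (b); case: (odd k).
right; rewrite kn' (wd_n b (~~ b)) -kn' [in LHS]wdSr.
suff -> : ~~ b (+) odd k.+1 = c by [].
by move: cE; rewrite /=; case: (c); case: (b); case: (odd k).
Qed.

Lemma ldes_genr b c w : ldes b (w * gen c) = ldes b w \/ gen b * w = w * gen c.
Proof.
have := rdes_gen b c w^-1; rewrite /rdes invMg dgenV invgK => -[]; first by left.
by move/(congr1 (@invg W)); rewrite !invMg !invgK !dgenV => ->; right.
Qed.

Lemma ldes_rdes b c w : gen b * w = w * gen c -> ldes b w = rdes c w.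
Proof. by rewrite /rdes /ldes => ->; rewrite -(lenV (w * _)) -(lenV w) invMg dgenV. Qed.

Lemma rdes_genr c w : rdes c (w * gen c) = ~~ rdes c w.
Proof. by rewrite /rdes invMg dgenV ldes_gen. Qed.

Lemma len_genr b w : len (w * gen b) = if rdes b w then (len w).-1 else (len w).+1.
Proof. by rewrite -lenV invMg dgenV len_gen lenV. Qed.

End DihedralWords.

(** * Conjugacy classes of the generators *)

Section Classes.
Local Open Scope group_scope.
Context (W : finGroupType) (D : dihedral W).

Lemma classI_dS b : (dgen D b ^: [set: W]) :&: dS D = [set dgen D b].
Proof.
apply/setP => x; rewrite !inE; apply/andP/eqP => [[xc]|->]; last first.
  by rewrite class_refl; case: b; rewrite eqxx ?orbT.
by case/orP => /eqP E; move: xc; rewrite E => /gen_class_eq <-.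
Qed.

Lemma SclassesE : Sclasses (dS D) = [set [set dgen D true]; [set dgen D false]].
Proof.
apply/setP => o; rewrite !inE; apply/imsetP/orP => [[x]|].
  by rewrite !inE => /orP[] /eqP -> ->; rewrite classI_dS; [left|right].
by case=> /eqP ->; [exists (dgen D true)|exists (dgen D false)];
  rewrite ?classI_dS // !inE eqxx ?orbT.
Qed.

Lemma osb_proof b : [set dgen D b] \in Sclasses (dS D).
Proof. by rewrite SclassesE !inE; case: b; rewrite eqxx ?orbT. Qed.

Definition osb b : Sbar (dS D) := exist _ [set dgen D b] (osb_proof b).

Lemma dgen_inj : injective (dgen D).
Proof.
move=> b c E; apply: (@gen_class_eq _ D); rewrite E; exact: class_refl.
Qed.

Lemma osbP (o : Sbar (dS D)) : exists b, o = osb b.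
Proof.
case: o => o oP; have := oP; rewrite {1}SclassesE !inE => /orP[] /eqP E;
  [exists true|exists false]; exact: val_inj.
Qed.

Lemma osb_inj : injective osb.
Proof. by move=> b c /(congr1 val) /= /set1_inj /dgen_inj. Qed.

Lemma mem_osb b x : (x \in val (osb b)) = (x == dgen D b).
Proof. by rewrite inE. Qed.

End Classes.

(** * The group ring *)

Section GroupRingTheory.
Local Open Scope fset_scope.
Local Open Scope ring_scope.
Context (G : zmodType).
Implicit Types (a b c : groupRing G) (g h : G).

Lemma grD a b g : (a + b) g = a g + b g. Proof. exact: gr_addE. Qed.
Lemma grN a g : (- a) g = - a g. Proof. exact: gr_oppE. Qed.
Lemma gr0 g : (0 : groupRing G) g = 0. Proof. exact: gr_zeroE. Qed.
Lemma grMz a z g : (a *~ z) g = a g *~ z.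
Proof.
have Hn (n : nat) : (a *+ n) g = a g *+ n.
  by elim: n => [|n IH]; rewrite ?gr0 // !mulrS grD IH.
by case: z => n; rewrite -?pmulrn ?NegzE ?mulrNz ?grN -?pmulrn Hn.
Qed.
Lemma gr_sum (I : Type) (r : seq I) (P : pred I) (F : I -> groupRing G) g :
  (\sum_(i <- r | P i) F i) g = \sum_(i <- r | P i) F i g.
Proof. by elim/big_rec2: _ => [|i x y _ <-]; rewrite ?gr0 ?grD. Qed.

Lemma gr_exp0 : gr_exp (0 : G) = 1. Proof. by []. Qed.

Lemma gr_expD g h : gr_exp (g + h) = gr_exp g * gr_exp h.
Proof.
apply/fsfunP => x.
rewrite [RHS](@gr_mulE _ [fset g]) ?finsupp_sub //.
by rewrite big_seq_fset1 !gr_expE eqxx mul1r subr_eq addrC.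
Qed.

Lemma gr_decomp a : a = \sum_(g <- finsupp a) gr_exp g *~ a g.
Proof.
apply/fsfunP => x; rewrite gr_sum; under eq_bigr do rewrite grMz gr_expE.
case: (boolP (x \in finsupp a)) => xa.
  rewrite (big_fsetD1 x) //= eqxx big1_fset ?addr0 ?intz //.
  by move=> y; rewrite !inE eq_sym => /andP[/negPf -> _] _; rewrite mul0rz.
rewrite fsfun_dflt // big1_fset // => y ya _; case: eqP => [yx|]; rewrite ?mul0rz //.
by rewrite yx ya in xa.
Qed.

(** Exponentials span the group ring additively, so multiplicativity can be checked on them. This
    serves both [gr_conj] and [gr_aug]. *)
Lemma gr_mul_morph (R : pzRingType) (f : groupRing G -> R) :
  (forall a b, f (a - b) = f a - f b) ->
  (forall g h, f (gr_exp (g + h)) = f (gr_exp g) * f (gr_exp h)) ->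
  forall a b, f (a * b) = f a * f b.
Proof.
move=> fB fM.
have f0 : f 0 = 0 by rewrite -(subrr 0) fB subrr.
have fN a : f (- a) = - f a by rewrite -sub0r fB f0 sub0r.
have fD a b : f (a + b) = f a + f b by rewrite -{1}[b]opprK fB fN opprK.
have fMn a n : f (a *+ n) = f a *+ n.
  by elim: n => [|n IH]; rewrite ?f0 // !mulrS fD IH.
have fMz a z : f (a *~ z) = f a *~ z.
  by case: z => n; rewrite -?pmulrn ?NegzE ?mulrNz ?fN -?pmulrn fMn.
have fS r (F : G -> groupRing G) : f (\sum_(g <- r) F g) = \sum_(g <- r) f (F g).
  by elim/big_rec2: _ => [|i x y _ <-]; rewrite ?f0 ?fD.
move=> a b; rewrite [a in LHS]gr_decomp [b in LHS]gr_decomp mulr_suml fS.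
rewrite [a in RHS]gr_decomp fS mulr_suml; apply: eq_bigr => g _.
rewrite mulr_sumr fS [b in RHS]gr_decomp fS mulr_sumr; apply: eq_bigr => h _.
rewrite mulrzAl mulrzAr -gr_expD !fMz fM.
by rewrite mulrzAl mulrzAr.
Qed.

Lemma gr_conjE a g : gr_conj a g = a (- g).
Proof.
rewrite fsfunE; case: ifPn => // /negP gN; case: finsuppP => // ga.
by case: gN; apply/imfsetP; exists (- g) => //; rewrite opprK.
Qed.

Lemma gr_conj_exp g : gr_conj (gr_exp g) = gr_exp (- g).
Proof. by apply/fsfunP => x; rewrite gr_conjE !gr_expE eqr_oppLR. Qed.

Lemma gr_conjB a b : gr_conj (a - b) = gr_conj a - gr_conj b.
Proof. by apply/fsfunP => x; rewrite !(gr_conjE, grD, grN). Qed.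

Lemma gr_conj_monoid : monoid_morphism (@gr_conj G).
Proof.
split; first by rewrite -gr_exp0 gr_conj_exp oppr0.
by apply: gr_mul_morph gr_conjB _ => g h; rewrite !gr_conj_exp opprD gr_expD.
Qed.

HB.instance Definition _ :=
  GRing.isZmodMorphism.Build (groupRing G) (groupRing G) (@gr_conj G) gr_conjB.
HB.instance Definition _ :=
  GRing.isMonoidMorphism.Build (groupRing G) (groupRing G) (@gr_conj G) gr_conj_monoid.

Lemma gr_augE a (A : {fset G}) : finsupp a `<=` A ->
  gr_aug a = (\sum_(g <- A) a g)%:~R.
Proof.
move=> sA; rewrite /gr_aug; congr (_%:~R); apply: big_fset_incl => // x _.
by move/fsfun_dflt.
Qed.

Lemma gr_augB a b : gr_aug (a - b) = gr_aug a - gr_aug b.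
Proof.
pose A := finsupp a `|` finsupp b.
have sA : finsupp (a - b) `<=` A.
  apply/fsubsetP => x; rewrite inE; apply: contraLR; rewrite negb_or => /andP[xa xb].
  by rewrite mem_finsupp negbK grD grN !fsfun_dflt.
rewrite (gr_augE sA) (gr_augE (fsubsetUl _ (finsupp b))) (gr_augE (fsubsetUr (finsupp a) _)).
by rewrite -rmorphB /= -sumrB; congr (_%:~R); apply: eq_bigr => x _; rewrite grD grN.
Qed.

Lemma gr_aug_exp g : gr_aug (gr_exp g) = 1.
Proof.
by rewrite (@gr_augE _ [fset g]) ?finsupp_sub // big_seq_fset1 gr_expE eqxx.
Qed.

Lemma gr_aug_monoid : monoid_morphism (@gr_aug G).
Proof.
split; first by rewrite -gr_exp0 gr_aug_exp.
by apply: gr_mul_morph gr_augB _ => g h; rewrite !gr_aug_exp mulr1.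
Qed.

HB.instance Definition _ :=
  GRing.isZmodMorphism.Build (groupRing G) rat (@gr_aug G) gr_augB.
HB.instance Definition _ :=
  GRing.isMonoidMorphism.Build (groupRing G) rat (@gr_aug G) gr_aug_monoid.

End GroupRingTheory.

(** * Elements of the group ring supported in negative degrees *)

Section OrderedGroupRing.
Local Open Scope fset_scope.
Local Open Scope ring_scope.
Context (G : orderedZmod).
Implicit Types (a b c : groupRing G) (g h : G).

Lemma oz_ltNge g h : oz_lt g h = ~~ oz_le h g.
Proof.
rewrite /oz_lt; have := oz_le_total g h; have := @oz_le_anti G g h.
case: eqP => [->|gh] /= A; first by rewrite oz_le_refl.
by case: (oz_le h g) A; case: (oz_le g h) => //= A; case: gh; apply: A.
Qed.

Lemma oz_leD g g' h h' : oz_le g g' -> oz_le h h' -> oz_le (g + h) (g' + h').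
Proof.
move=> gg hh; apply: (oz_le_trans (oz_le_add2l g hh)).
by rewrite ![_ + h']addrC; apply: oz_le_add2l.
Qed.

Lemma oz_ltW g h : oz_lt g h -> oz_le g h. Proof. by case/andP. Qed.

Lemma oz_leN g h : oz_le (- g) (- h) = oz_le h g.
Proof.
have H x y : oz_le x y -> oz_le (- y) (- x).
  by move/(oz_le_add2l (- x - y)); rewrite addrAC addNr add0r subrK.
by apply/idP/idP => [/H|/H //]; rewrite !opprK.
Qed.

Lemma oz_ltN g h : oz_lt (- g) (- h) = oz_lt h g.
Proof. by rewrite !oz_ltNge oz_leN. Qed.

Lemma oz_ltB g h : oz_lt (g - h) 0 = oz_lt g h.
Proof.
rewrite !oz_ltNge; congr (~~ _); apply/idP/idP => [/(oz_le_add2l h)|/(oz_le_add2l (- h))].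
  by rewrite addr0 addrC subrK.
by rewrite addNr addrC.
Qed.

Lemma oz_lt_leD g g' h h' : oz_lt g g' -> oz_le h h' -> oz_lt (g + h) (g' + h').
Proof.
rewrite !oz_ltNge => gg hh; apply: contra gg => /oz_leD H.
have := H (- h') (- h); rewrite oz_leN => /(_ hh).
by rewrite !addrK.
Qed.

Definition gr_nonpos a := forall g, g \in finsupp a -> oz_le g 0.

Lemma gr_negative0 : gr_negative (0 : groupRing G).
Proof. by move=> g; rewrite mem_finsupp gr0 eqxx. Qed.

Lemma gr_negativeD a b : gr_negative a -> gr_negative b -> gr_negative (a + b).
Proof.
move=> na nb g; rewrite mem_finsupp grD => ab.
case: (boolP (g \in finsupp a)) => [/na //|ga].
by apply: nb; move: ab; rewrite fsfun_dflt // add0r mem_finsupp.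
Qed.

Lemma gr_negativeN a : gr_negative a -> gr_negative (- a).
Proof. by move=> na g; rewrite mem_finsupp grN oppr_eq0 -mem_finsupp => /na. Qed.

Lemma gr_nonposN a : gr_nonpos a -> gr_nonpos (- a).
Proof. by move=> na g; rewrite mem_finsupp grN oppr_eq0 -mem_finsupp => /na. Qed.

Lemma gr_negativeW a : gr_negative a -> gr_nonpos a.
Proof. by move=> na g /na /oz_ltW. Qed.

Lemma finsuppM a b g : g \in finsupp (a * b) ->
  exists x y, [/\ x \in finsupp a, y \in finsupp b & g = x + y].
Proof.
rewrite mem_finsupp [_ g]fsfunE; case: ifP => [|_ /eqP //].
by case/imfset2P => x xa [y yb ->] _; exists x, y; split.
Qed.

Lemma gr_negativeM a b : gr_negative a -> gr_nonpos b -> gr_negative (a * b).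
Proof.
move=> na nb _ /finsuppM[x [y [/na xa /nb yb ->]]].
by rewrite -[0]addr0; apply: oz_lt_leD.
Qed.

Lemma gr_nonposM a b : gr_nonpos a -> gr_nonpos b -> gr_nonpos (a * b).
Proof.
move=> na nb _ /finsuppM[x [y [/na xa /nb yb ->]]].
by rewrite -[0]addr0; apply: oz_leD.
Qed.

Lemma finsupp_exp g : finsupp (gr_exp g) = [fset g].
Proof. by apply/fsetP => x; rewrite mem_finsupp gr_expE inE pnatr_eq0 eqb0 negbK. Qed.

Lemma gr_negative_exp g : oz_lt g 0 -> gr_negative (gr_exp g).
Proof. by move=> g0 x; rewrite finsupp_exp inE => /eqP ->. Qed.

Lemma gr_nonpos_exp g : oz_le g 0 -> gr_nonpos (gr_exp g).
Proof. by move=> g0 x; rewrite finsupp_exp inE => /eqP ->. Qed.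

Lemma gr_nonpos1 : gr_nonpos 1.
Proof. by rewrite -gr_exp0; apply/gr_nonpos_exp/oz_le_refl. Qed.

(** The support would be symmetric under negation and lie strictly below zero. Uniqueness of the
    Kazhdan-Lusztig elements rests on this. *)
Lemma gr_negative_conj a : gr_negative a -> gr_conj a = a -> a = 0.
Proof.
move=> na ca; apply/fsfunP => g; rewrite gr0.
case: (finsuppP a g) => // ga; have := na _ ga.
have /na : - g \in finsupp a by rewrite mem_finsupp -gr_conjE ca -mem_finsupp.
rewrite -[X in oz_lt _ X -> _]oppr0 oz_ltN oz_ltNge => /negP H /oz_ltW /H [].
Qed.

End OrderedGroupRing.

(** * The Hecke algebra over a commutative ring *)

Section HeckeOperators.
Local Open Scope ring_scope.
Context (W : finGroupType) (D : dihedral W) (R : comNzRingType).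
(* The quadratic relation reads [(T_b - u b) (T_b + ui b) = 0]; for the Hecke
   algebra of [phi] one may take [u b] to be [e^phi] or [- e^(-phi)] at will, so
   that the sign of [phi] is absorbed in [u]. *)
Context (u ui : bool -> R).
Local Notation gen := (dgen D).
Local Notation len := (cox_len (dS D)).
Local Notation ldes := (ldes D).
Local Notation rdes := (rdes D).
Local Notation wd := (wd D).
Local Notation H := {ffun W -> R^o}.
Implicit Types (h k l : H) (b c : bool) (w x y : W).

Definition xi b : R := u b - ui b.

Definition gT w : H := [ffun x => (x == w)%:R].

(** The coordinates of [T_b h], and below of [h T_b]. The multiplication is built from these
    operators rather than conversely, so that associativity comes from their commuting. *)
Definition Lop b h : H :=
  [ffun w => h (gen b * w)%g + (if ldes b w then xi b * h w else 0)].
Definition Rop b h : H :=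
  [ffun w => h (w * gen b)%g + (if rdes b w then xi b * h w else 0)].

Lemma heckeD h k w : (h + k) w = h w + k w. Proof. by rewrite ffunE. Qed.
Lemma heckeZ (a : R) h w : (a *: h) w = a * h w. Proof. by rewrite ffunE. Qed.
Lemma hecke0 w : (0 : H) w = 0. Proof. by rewrite ffunE. Qed.
Lemma heckeN h w : (- h) w = - h w. Proof. by rewrite ffunE. Qed.
Lemma hecke_sum (I : Type) (r : seq I) (P : pred I) (F : I -> H) w :
  (\sum_(i <- r | P i) F i) w = \sum_(i <- r | P i) F i w.
Proof. by rewrite sum_ffunE. Qed.

Lemma LopE b h w : Lop b h w = h (gen b * w)%g + (if ldes b w then xi b * h w else 0).
Proof. by rewrite ffunE. Qed.
Lemma RopE b h w : Rop b h w = h (w * gen b)%g + (if rdes b w then xi b * h w else 0).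
Proof. by rewrite ffunE. Qed.
Lemma gTE w x : gT w x = (x == w)%:R. Proof. by rewrite ffunE. Qed.

Lemma Lop_linear b : linear (Lop b).
Proof.
move=> a h k; apply/ffunP => w; rewrite !(LopE, RopE, heckeD, heckeZ); case: ifP => _; ring.
Qed.

Lemma Rop_linear b : linear (Rop b).
Proof.
move=> a h k; apply/ffunP => w; rewrite !(LopE, RopE, heckeD, heckeZ); case: ifP => _; ring.
Qed.

HB.instance Definition _ b := GRing.isLinear.Build R H H _ (Lop b) (@Lop_linear b).
HB.instance Definition _ b := GRing.isLinear.Build R H H _ (Rop b) (@Rop_linear b).

(** If [gen b * w] and [w * gen c] differ, each multiplication leaves the descents on the other side
    unchanged. If they are equal then [b = c], and both descents flip together. *)
Lemma Lop_Rop b c h : Lop b (Rop c h) = Rop c (Lop b h).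
Proof.
apply/ffunP => w; rewrite !(LopE, RopE) mulgA.
have [e|ne] := eqVneq (gen b * w)%g (w * gen c)%g.
  have bc := gen_conj_eq e; subst c.
  have -> : rdes b (gen b * w)%g = ~~ rdes b w by rewrite e rdes_genr.
  have -> : ldes b (w * gen b)%g = ~~ rdes b w by rewrite -e ldes_gen (ldes_rdes e).
  by rewrite e (ldes_rdes e); case: (rdes b w).
have [->|] := rdes_gen D c b w; last by move/eqP; rewrite (negPf ne).
have [->|] := ldes_genr D b c w; last by move/eqP; rewrite (negPf ne).
case: (ldes b w); case: (rdes c w); ring.
Qed.

Fixpoint Lwd b i h : H := if i is i'.+1 then Lop b (Lwd (~~ b) i' h) else h.

Lemma Lwd_linear b i : linear (Lwd b i).
Proof. by elim: i b => [|i IH] b a h k //=; rewrite IH linearP. Qed.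

HB.instance Definition _ b i := GRing.isLinear.Build R H H _ (Lwd b i) (@Lwd_linear b i).

Lemma Lwd_Rop b i c h : Lwd b i (Rop c h) = Rop c (Lwd b i h).
Proof. by elim: i b => [|i IH] b //=; rewrite IH Lop_Rop. Qed.

Lemma hecke_sumT h : h = \sum_w (h w : R) *: gT w.
Proof.
apply/ffunP => x; rewrite hecke_sum; under eq_bigr do rewrite heckeZ gTE.
rewrite (bigD1 x) //= eqxx mulr1 big1 ?addr0 //.
by move=> y yx; rewrite eq_sym (negPf yx) mulr0.
Qed.

Lemma Lop_T b w : Lop b (gT w) =
  gT (gen b * w)%g + (if ldes b w then xi b *: gT w else 0).
Proof.
apply/ffunP => x; rewrite heckeD !(LopE, RopE, gTE) -[(_ * x)%g == w](inj_eq (mulgI (gen b))) genK.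
congr (_ + _); have [->|xw] := eqVneq x w; first by case: ifP; rewrite ?heckeZ ?hecke0 // gTE eqxx.
by rewrite mulr0 if_same; case: ifP; rewrite ?hecke0 // heckeZ gTE (negPf xw) mulr0.
Qed.

Lemma Rop_T b w : Rop b (gT w) =
  gT (w * gen b)%g + (if rdes b w then xi b *: gT w else 0).
Proof.
apply/ffunP => x; rewrite heckeD !(LopE, RopE, gTE) -[(x * _)%g == w](inj_eq (mulIg (gen b))) genKr.
congr (_ + _); have [->|xw] := eqVneq x w; first by case: ifP; rewrite ?heckeZ ?hecke0 // gTE eqxx.
by rewrite mulr0 if_same; case: ifP; rewrite ?hecke0 // heckeZ gTE (negPf xw) mulr0.
Qed.

Lemma Lwd_T b i w : len (wd b i * w)%g = (i + len w)%N ->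
  Lwd b i (gT w) = gT (wd b i * w)%g.
Proof.
elim: i b => [|i IH] b; first by rewrite mul1g.
rewrite wdS -mulgA => E; set y := (wd (~~ b) i * w)%g in E *.
have ley : (len y <= i + len w)%N.
  rewrite /y; elim: (i) (~~ b) => [|j IHj] c; first by rewrite mul1g.
  rewrite wdS -mulgA len_gen addSn; have := IHj (~~ c); case: ifP => _ //.
  by move=> le; rewrite (leq_trans (leq_pred _)) // leqW.
have := E; rewrite len_gen; case: ifP => d E'; first by lia.
rewrite /= IH -/y; last by lia.
by rewrite Lop_T d addr0.
Qed.

Definition Tact w h : H := Lwd (ldes true w) (len w) h.

Lemma Tact_T w x : len (w * x)%g = (len w + len x)%N ->
  Tact w (gT x) = gT (w * x)%g.
Proof. by move=> E; rewrite /Tact Lwd_T -?wd_canon. Qed.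

Lemma len1 : len 1%g = 0%N. Proof. exact: (len_wd (D := D) true (leq0n _)). Qed.

Definition hmul h k : H := \sum_w (h w : R) *: Tact w k.

(** The endomorphisms of the right regular module. Such a map is determined by its value at the
    generator [T_1]; associativity and the anti-multiplicativity of [flip] follow from this
    principle. *)
Definition good (F : H -> H) : Prop := linear F /\ forall c h, F (Rop c h) = Rop c (F h).

Lemma T_Rop w : w != 1%g -> exists b x, [/\ len w = (len x).+1 & gT w = Rop b (gT x)].
Proof.
move=> w1; have [b [k [kn wE]]] := wd_exists D w.
case: k kn wE => [|k] kn wE; first by rewrite wE eqxx in w1.
exists (b (+) odd k), (wd b k); rewrite wE !len_wd ?(ltnW kn) //; split=> //.
rewrite Rop_T -wdSr rdesE ?(ltnW kn) //.
have -> : (b (+) odd k == b (+) ~~ odd k) = false by case: b {wE}; case: (odd k).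
by rewrite (ltn_eqF kn) /= andbF addr0.
Qed.

Lemma good_eq F F' : good F -> good F' -> F (gT 1%g) = F' (gT 1%g) -> F =1 F'.
Proof.
move=> [lF cF] [lF' cF'] e1.
pose FL := GRing.isLinear.Build R H H _ F lF.
pose FL' := GRing.isLinear.Build R H H _ F' lF'.
pose f : {linear H -> H} := HB.pack F FL.
pose f' : {linear H -> H} := HB.pack F' FL'.
have FT w : F (gT w) = F' (gT w).
  have [i] := ubnP (len w); elim: i w => // i IH w lwi.
  have [->//|/T_Rop[b [x [lw ->]]]] := eqVneq w 1%g.
  by rewrite cF cF' IH //; lia.
move=> h; rewrite [h]hecke_sumT -[F]/(f : _ -> _) -[F']/(f' : _ -> _) !linear_sum.
by apply: eq_bigr => w _; rewrite !linearZ /= FT.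
Qed.

Lemma hmul_linear_r h : linear (hmul h).
Proof.
move=> a k l; rewrite /hmul scaler_sumr -big_split /=; apply: eq_bigr => w _.
by rewrite /Tact linearP scalerDr !scalerA [a * _]mulrC.
Qed.

Lemma hmul_linear_l a h h' k : hmul (a *: h + h') k = a *: hmul h k + hmul h' k.
Proof.
rewrite /hmul scaler_sumr -big_split /=; apply: eq_bigr => w _.
by rewrite heckeD heckeZ scalerDl scalerA.
Qed.

Lemma hmul_good h : good (hmul h).
Proof.
split=> [|c k]; first exact: hmul_linear_r.
by rewrite /hmul linear_sum; apply: eq_bigr => w _; rewrite /Tact Lwd_Rop linearZ.
Qed.

Lemma hmul1r h : hmul h (gT 1%g) = h.
Proof.
rewrite [RHS]hecke_sumT; apply: eq_bigr => w _.
by rewrite Tact_T ?mulg1 // len1 addn0.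
Qed.

Lemma hmulT w k : hmul (gT w) k = Tact w k.
Proof.
rewrite /hmul (bigD1 w) //= gTE eqxx scale1r big1 ?addr0 // => x xw.
by rewrite gTE (negPf xw) scale0r.
Qed.

Lemma hmulA : associative hmul.
Proof.
move=> h k l; move: l; apply: good_eq.
- split=> [a l l'|c l]; first by rewrite !(hmul_linear_r _ a).
  by rewrite !(hmul_good _).2.
- exact: hmul_good.
by rewrite !hmul1r.
Qed.

Lemma hmul1l k : hmul (gT 1%g) k = k.
Proof. by rewrite hmulT /Tact len1. Qed.

Lemma hmul_gen b k : hmul (gT (gen b)) k = Lop b k.
Proof.
rewrite hmulT; move: k; apply: good_eq.
- by split=> [|c k]; [exact: Lwd_linear | rewrite /Tact Lwd_Rop].
- by split=> [|c k]; [exact: Lop_linear | rewrite Lop_Rop].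
rewrite Tact_T ?mulg1 ?len1 ?addn0 // Lop_T mulg1.
have -> : ldes b 1%g = false by rewrite -[1%g]/(wd b 0) ldesE.
by rewrite addr0.
Qed.

Section Specification.
Context (p q : bool -> R).
Context (xi_pq : forall b, xi b = p b - q b).
Context (pq1 : forall b, p b * q b = 1).

(** [p] and [q] are the parameters of the given quadratic relation, whereas [u] and [ui] may be the
    other pair with the same difference [xi]. *)
Definition gspec (mul : H -> H -> H) : Prop :=
  [/\ associative mul,
      forall (a : R) h h' k, mul (a *: h + h') k = a *: mul h k + mul h' k,
      forall (a : R) h k k', mul h (a *: k + k') = a *: mul h k + mul h k',
      forall w w', len (w * w')%g = (len w + len w')%N ->
        mul (gT w) (gT w') = gT (w * w')%g
    & forall b, mul (gT (gen b) - p b *: gT 1%g) (gT (gen b) + q b *: gT 1%g) = 0].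

Lemma ldes1 b : ldes b 1%g = false.
Proof. by rewrite -[1%g]/(wd b 0) ldesE. Qed.

Lemma ldes_self b : ldes b (gen b) = true.
Proof. by rewrite -[gen b]mulg1 ldes_gen ldes1. Qed.

Lemma len_dgen b : len (gen b) = 1%N.
Proof. by rewrite -[gen b]mulg1 len_gen ldes1 len1. Qed.

Lemma hmul_spec : gspec hmul.
Proof.
split; first exact: hmulA.
- exact: hmul_linear_l.
- by move=> a h k k'; rewrite hmul_linear_r.
- by move=> w w' E; rewrite hmulT Tact_T.
move=> b.
have -> : gT (gen b) - p b *: gT 1%g = (- p b) *: gT 1%g + gT (gen b).
  by rewrite scaleNr addrC.
rewrite hmul_linear_l hmul1l hmul_gen [Lop b _]linearD /= [Lop b (_ *: _)]linearZ /= !Lop_T xi_pq.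
rewrite ldes1 ldes_self mulg1 dgen_inv addr0; apply/ffunP => w.
rewrite !(heckeD, heckeZ) hecke0.
transitivity ((1 - p b * q b) * gT 1%g w); [ring | by rewrite pq1 subrr mul0r].
Qed.

Lemma spec_unique mul : gspec mul -> mul = hmul.
Proof.
case=> mA mL mR mT mQ.
have m1 k : mul (gT 1%g) k = k.
  have E w : mul (gT 1%g) (gT w) = gT w by rewrite mT ?mul1g ?len1.
  pose f := HB.pack_for {linear H -> H} (mul (gT 1%g))
    (GRing.isLinear.Build R H H _ (mul (gT 1%g)) (fun a k k' => mR a (gT 1%g) k k')).
  rewrite [k]hecke_sumT -[LHS]/(f _) linear_sum; apply: eq_bigr => w _.
  by rewrite linearZ /= E.
have mG b k : mul (gT (gen b)) k = Lop b k.
  pose f := HB.pack_for {linear H -> H} (mul (gT (gen b)))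
    (GRing.isLinear.Build R H H _ (mul (gT (gen b))) (fun a k k' => mR a (gT (gen b)) k k')).
  have E0 w : ldes b w = false -> mul (gT (gen b)) (gT w) = gT (gen b * w)%g.
    by move=> d; rewrite mT // len_gen d len_dgen.
  have quad : mul (gT (gen b)) (gT (gen b)) = gT 1%g + xi b *: gT (gen b).
    have := mQ b.
    have -> : gT (gen b) - p b *: gT 1%g = (- p b) *: gT 1%g + gT (gen b).
      by rewrite scaleNr addrC.
    rewrite mL m1 [X in mul _ X]addrC mR xi_pq E0 ?ldes1 // mulg1 => E.
    apply/ffunP => w; have := congr1 (fun h : H => h w) E.
    rewrite !(heckeD, heckeZ) hecke0 => e.
    transitivity (mul (gT (gen b)) (gT (gen b)) w - 0 + (1 - p b * q b) * gT 1%g w).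
      by rewrite pq1; ring.
    by rewrite -e; ring.
  rewrite [k]hecke_sumT -[LHS]/(f _) !linear_sum; apply: eq_bigr => w _.
  rewrite !linearZ /=; congr (_ *: _); rewrite Lop_T.
  case d : (ldes b w); last by rewrite E0 // addr0.
  (* If [gen b] is a left descent, [T_w] factors through [T_b] and the quadratic relation
     applies. *)
  have E : gT w = mul (gT (gen b)) (gT (gen b * w)%g).
    by rewrite E0 ?genK // ldes_gen d.
  by rewrite {1}E mA quad addrC mL m1 -E addrC.
apply/funext => h; apply/funext => k.
pose f := HB.pack_for {linear H -> H} (mul^~ k)
    (GRing.isLinear.Build R H H _ (mul^~ k) (fun a h h' => mL a h h' k)).
rewrite [in LHS](hecke_sumT h) -[LHS]/(f _) linear_sum; apply: eq_bigr => w _.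
rewrite linearZ /=; congr (_ *: _).
have [b [i [iN ->]]] := wd_exists D w.
have -> : Tact (wd b i) k = hmul (gT (wd b i)) k by rewrite hmulT.
elim: i b iN => [|i IH] b iN; first by rewrite m1 hmul1l.
have E m' : gspec m' -> gT (wd b i.+1) = m' (gT (gen b)) (gT (wd (~~ b) i)).
  by case=> _ _ _ -> //; rewrite -wdS !len_wd ?(ltnW iN) // len_dgen.
rewrite [in LHS](E mul) // [in RHS](E hmul) //; last exact: hmul_spec.
by rewrite -mA -hmulA mG hmul_gen IH // ltnW.
Qed.

End Specification.

End HeckeOperators.

(** * Families that are unitriangular for a degree function *)

Section Triangular.
Local Open Scope ring_scope.
Context (T : finType) (d : T -> nat) (R : nzRingType).
Implicit Types (c : T -> T -> R) (k h : T -> R).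

Definition tri c : Prop :=
  forall x, c x x = 1 /\ forall y, c x y != 0 -> y = x \/ (d y < d x)%N.

Lemma down_ind (P : T -> Prop) :
  (forall x, (forall y, (d x < d y)%N -> P y) -> P x) -> forall x, P x.
Proof.
move=> IH x; pose N := (\max_y d y)%N.
have dN y : (d y <= N)%N by exact: leq_bigmax.
have [i] := ubnP (N - d x)%N; elim: i x => // i IHi x xi; apply: IH => y xy.
by apply: IHi; have := dN y; lia.
Qed.

Lemma tri_sum c k x : tri c -> (forall y, (d x < d y)%N -> k y = 0) ->
  \sum_y k y * c y x = k x.
Proof.
move=> tc k0; rewrite (bigD1 x) //= (tc x).1 mulr1 big1 ?addr0 // => y yx.
have [->|/(tc y).2[xy|/k0 ->]] := eqVneq (c y x) 0; rewrite ?mulr0 ?mul0r //.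
by rewrite xy eqxx in yx.
Qed.

Lemma tri_free c k : tri c -> (forall y, \sum_x k x * c x y = 0) -> forall x, k x = 0.
Proof.
by move=> tc k0; apply: down_ind => x IH; rewrite -(k0 x) tri_sum.
Qed.

Lemma tri_span c h : tri c -> exists k : {ffun T -> R}, forall y, h y = \sum_x k x * c x y.
Proof.
move=> tc; have dN y : (d y < (\max_y d y).+1)%N by rewrite ltnS leq_bigmax.
move: (\max_y _).+1%N dN => i dN.
have {dN} : forall y, h y != 0 -> (d y < i)%N by [].
elim: i h => [|i IH] h hi.
  exists [ffun=> 0] => y; rewrite big1 => [|x _]; last by rewrite ffunE mul0r.
  by apply/eqP/negPn/negP => /hi.
(* In the top degree the coefficients are those of [h] itself; subtracting their contribution lowers
   the support. *)
pose k0 x := if d x == i then h x else 0.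
have [|k kE] := IH (fun y => h y - \sum_x k0 x * c x y).
  move=> y; rewrite ltnNge; apply: contraNN => iy; rewrite tri_sum //.
    rewrite /k0; case: ifP => di; rewrite ?subrr // subr0.
    by apply/negPn/negP => /hi; move/negbT: di; lia.
  by move=> z yz; rewrite /k0; case: eqP => // di; apply/eqP/negPn/negP => /hi; lia.
exists [ffun x => k x + k0 x] => y.
under eq_bigr do rewrite ffunE mulrDl.
by rewrite big_split /= -kE subrK.
Qed.

End Triangular.

(** * The bar involution and uniqueness of Kazhdan-Lusztig elements *)

Section BarInvolution.
Local Open Scope ring_scope.
Context (W : finGroupType) (D : dihedral W) (R : comNzRingType) (u ui : bool -> R).
Local Notation gen := (dgen D).
Local Notation n := (dn D).
Local Notation len := (cox_len (dS D)).
Local Notation ldes := (ldes D).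
Local Notation rdes := (rdes D).
Local Notation wd := (wd D).
Local Notation H := {ffun W -> R^o}.
Local Notation Lop := (Lop D u ui).
Local Notation Rop := (Rop D u ui).
Local Notation xi := (xi u ui).
Local Notation mul := (hmul D u ui).
Local Notation gT := (gT R).
Implicit Types (h k l : H) (b c : bool) (w x y : W).

Lemma Lop2 b h : Lop b (Lop b h) = h + xi b *: Lop b h.
Proof.
apply/ffunP => w; rewrite !(heckeD, heckeZ) !LopE genK ldes_gen.
by case: (ldes b w) => /=; ring.
Qed.

Lemma Rop_T1 b : Rop b (gT 1%g) = gT (gen b).
Proof. by rewrite Rop_T mul1g /rdes invg1 ldes1 addr0. Qed.

Lemma Lop_T1 b : Lop b (gT 1%g) = gT (gen b).
Proof. by rewrite Lop_T mulg1 ldes1 addr0. Qed.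

Lemma hmul_Rop b h k : mul h (Rop b k) = Rop b (mul h k).
Proof. exact: (hmul_good _ _ _ h).2. Qed.

Lemma hmul_genr b h : mul h (gT (gen b)) = Rop b h.
Proof. by rewrite -Rop_T1 hmul_Rop hmul1r. Qed.

(** The anti-automorphism [T_w] to [T_(w^-1)], through which right cells reduce to left cells. *)
Definition flip h : H := [ffun w => h w^-1%g].

Lemma flipE h w : flip h w = h w^-1%g. Proof. exact: ffunE. Qed.

Lemma flip_linear : linear flip.
Proof. by move=> a h k; apply/ffunP => w; rewrite !(flipE, heckeD, heckeZ). Qed.
HB.instance Definition _ := GRing.isLinear.Build R H H _ flip flip_linear.

Lemma flipK : involutive flip.
Proof. by move=> h; apply/ffunP => w; rewrite !flipE invgK. Qed.

Lemma flip_T w : flip (gT w) = gT w^-1%g.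
Proof. by apply/ffunP => x; rewrite flipE !gTE -(inj_eq invg_inj) invgK. Qed.

Lemma flip_Lop b h : flip (Lop b h) = Rop b (flip h).
Proof. by apply/ffunP => w; rewrite flipE LopE RopE !flipE invMg dgenV. Qed.

Lemma flip_Rop b h : flip (Rop b h) = Lop b (flip h).
Proof. by rewrite -{1}[h]flipK -flip_Lop flipK. Qed.

Lemma flip_mul h k : flip (mul h k) = mul (flip k) (flip h).
Proof.
suff E : mul (flip k) =1 (fun h' => flip (mul (flip h') k)) by rewrite E flipK.
apply: good_eq; first exact: hmul_good.
  split=> [a l l'|c l].
    by rewrite linearP hmul_linear_l linearP.
  by rewrite flip_Rop -!hmul_gen -hmulA hmul_gen flip_Lop.
by rewrite hmul1r flip_T invg1 hmul1l.
Qed.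

Definition isinv h k := mul h k = gT 1%g /\ mul k h = gT 1%g.

Lemma isinv_unique h k k' : isinv h k -> isinv h k' -> k = k'.
Proof.
move=> [hk kh] [hk' k'h].
by rewrite -[k](hmul1r D u ui) -hk' hmulA kh hmul1l.
Qed.

(** Left multiplication by the inverse of [T_b], which the quadratic relation gives as
    [T_b - xi b]. *)
Definition Lbar b h : H := Lop b h - xi b *: h.

Lemma Lbar_linear b : linear (Lbar b).
Proof.
by move=> a h k; apply/ffunP => w; rewrite /Lbar !(heckeD, heckeN, heckeZ, LopE); case: ifP => _; ring.
Qed.
HB.instance Definition _ b := GRing.isLinear.Build R H H _ (Lbar b) (@Lbar_linear b).

Lemma Lop_Lbar b h : Lop b (Lbar b h) = h.
Proof. by rewrite /Lbar linearB linearZ /= Lop2 addrK. Qed.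

Lemma Lbar_Lop b h : Lbar b (Lop b h) = h.
Proof. by rewrite /Lbar Lop2 addrK. Qed.

Lemma mul_Lop b h k : mul (Lop b h) k = Lop b (mul h k).
Proof. by rewrite -!hmul_gen hmulA. Qed.

Lemma mul_Lbar b h k : mul (Lbar b h) k = Lbar b (mul h k).
Proof.
rewrite /Lbar addrC -scaleNr hmul_linear_l scaleNr addrC; congr (_ - _).
by rewrite mul_Lop.
Qed.

Fixpoint barW b i : H := if i is i'.+1 then Lbar b (barW (~~ b) i') else gT 1%g.

Lemma barW_inv b i : (i <= n)%N -> isinv (gT (wd b i)^-1%g) (barW b i).
Proof.
elim: i b => [|i IH] b iN; first by rewrite invg1; split; rewrite hmul1l.
have [hk kh] := IH (~~ b) (ltnW iN).
have -> : gT (wd b i.+1)^-1%g = Rop b (gT (wd (~~ b) i)^-1%g).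
  by rewrite Rop_T /rdes invgK ldes_wdN // addr0 wdS invMg dgenV.
split; first by rewrite -hmul_genr -hmulA hmul_gen Lop_Lbar.
by rewrite /= mul_Lbar hmul_Rop kh Rop_T1 -Lop_T1 Lbar_Lop.
Qed.

Definition barT w : H := barW (ldes true w) (len w).

Lemma barT_inv w : isinv (gT w^-1%g) (barT w).
Proof. by have := barW_inv (ldes true w) (len_le D w); rewrite -wd_canon. Qed.

(** The longest element has two reduced words and [barT] uses one of them; the products along both
    words are inverse to the same element. *)
Lemma barT_wd b i : (i <= n)%N -> barT (wd b i) = barW b i.
Proof. by move=> iN; apply: isinv_unique (barT_inv _) (barW_inv _ iN). Qed.

Lemma barT1 : barT 1%g = gT 1%g.
Proof. exact: (barT_wd true (leq0n _)). Qed.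

Lemma barT_gen b w : ldes b w = false -> barT (gen b * w)%g = Lbar b (barT w).
Proof.
have [[k kn ->]|[k kn ->]] := wd_case D b w; first by rewrite ldes_wd.
by move=> _; rewrite -wdS !barT_wd // ltnW.
Qed.

Lemma barT_flip w : flip (barT w) = barT w^-1%g.
Proof.
apply: isinv_unique (barT_inv _); have [hk kh] := barT_inv w.
by rewrite /isinv invgK -[w in gT w]invgK -flip_T -!flip_mul kh hk flip_T invg1.
Qed.

Lemma barT_tri : tri len (fun w x => barT w x).
Proof.
move=> w; have [b [i [iN ->]]] := wd_exists D w.
suff [B1 B2] : barW b i (wd b i) = 1 /\ forall y, barW b i y != 0 -> y = wd b i \/ (len y < len (wd b i))%N.
  by rewrite barT_wd.
elim: i b iN => [|i IH] b iN.
  split=> [|y]; rewrite gTE; first by rewrite eqxx.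
  by have [->|_] := eqVneq y 1%g; [left | rewrite mulr0n eqxx].
have [I1 I2] := IH (~~ b) (ltnW iN); rewrite /= -/(wd b i.+1).
split=> [|y]; rewrite /Lbar !(heckeD, heckeN, heckeZ) LopE.
  by rewrite gen_wd ldes_wd // I1 addrK.
have [y0 |y0] := eqVneq (barW (~~ b) i (gen b * y)%g) 0.
  rewrite y0 => H1; have : barW (~~ b) i y != 0.
    by apply: contraNneq H1 => ->; rewrite !mulr0 if_same addr0 subr0.
  case/I2 => [->|]; first by right; rewrite !len_wd // ltnW.
  by rewrite !len_wd ?(ltnW iN) // => lt; right; rewrite (leq_trans lt).
move=> _; case/I2: y0 => [e|]; first by left; rewrite wdS -e genK.
rewrite !len_wd ?(ltnW iN) // => lt; right.
by move: lt; rewrite len_gen; case: ifP => _; lia.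
Qed.

Context (conj : {rmorphism R -> R}).
Context (conj_u : forall b, conj (u b) = ui b) (conj_ui : forall b, conj (ui b) = u b).

Definition bar h : H := \sum_w (conj (h w) : R) *: barT w.

Lemma bar_semilinear (a : R) h k : bar (a *: h + k) = conj a *: bar h + bar k.
Proof.
rewrite /bar scaler_sumr -big_split /=; apply: eq_bigr => w _.
by rewrite heckeD heckeZ rmorphD rmorphM scalerDl scalerA.
Qed.

Lemma bar_T w : bar (gT w) = barT w.
Proof.
rewrite /bar (bigD1 w) //= gTE eqxx rmorph1 scale1r big1 ?addr0 // => x xw.
by rewrite gTE (negPf xw) rmorph0 scale0r.
Qed.

Lemma bar0 : bar 0 = 0.
Proof. by rewrite /bar big1 // => w _; rewrite hecke0 rmorph0 scale0r. Qed.

Lemma barD h k : bar (h + k) = bar h + bar k.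
Proof. by rewrite -{1}[h]scale1r bar_semilinear rmorph1 scale1r. Qed.

Lemma barZ (a : R) h : bar (a *: h) = conj a *: bar h.
Proof. by rewrite -[a *: h]addr0 bar_semilinear bar0 addr0. Qed.

Lemma bar_sum (F : W -> H) : bar (\sum_w F w) = \sum_w bar (F w).
Proof. by elim/big_rec2: _ => [|i x y _ <-]; rewrite ?bar0 ?barD. Qed.

Lemma conj_xi b : conj (xi b) = - xi b.
Proof. by rewrite /xi rmorphB conj_u conj_ui opprB. Qed.

Lemma bar_Lop b h : bar (Lop b h) = Lbar b (bar h).
Proof.
rewrite [h]hecke_sumT [Lop b _]linear_sum !bar_sum [Lbar b _]linear_sum /=; apply: eq_bigr => w _.
rewrite linearZ /= !barZ linearZ /=; congr (_ *: _); rewrite Lop_T barD !bar_T.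
case d : (ldes b w); last by rewrite bar0 addr0 barT_gen.
rewrite barZ bar_T conj_xi; have := @barT_gen b (gen b * w)%g.
rewrite ldes_gen d genK => /(_ erefl) ->.
set B := barT _; transitivity (Lop b (Lbar b B) - xi b *: Lbar b B) => //.
by rewrite Lop_Lbar scaleNr.
Qed.

(** Left multiplication by [T_b + ui b], which is invariant under the bar involution and equals
    [C_b] as soon as [ui b] is negative. *)
Definition Cop b h : H := Lop b h + ui b *: h.

Lemma bar_Cop b h : bar (Cop b h) = Cop b (bar h).
Proof.
rewrite /Cop barD barZ bar_Lop conj_ui /Lbar -addrA; congr (_ + _).
by rewrite /xi scalerBl opprB subrK.
Qed.

Lemma bar_flip h : bar (flip h) = flip (bar h).
Proof.
rewrite [h]hecke_sumT [X in bar X = _]linear_sum !bar_sum [flip _ in RHS]linear_sum /=; apply: eq_bigr => w _.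
by rewrite !linearZ /= !barZ linearZ /= flip_T !bar_T barT_flip.
Qed.

Context (neg : R -> Prop).
Context (negB : forall a a' : R, neg a -> neg a' -> neg (a - a')).
Context (neg_conj : forall a, neg a -> conj a = a -> a = 0).

Definition KL w h : Prop := bar h = h /\ forall x, neg ((h - gT w) x).

Lemma barE_max h x : (forall y, (len x < len y)%N -> h y = 0) -> bar h x = conj (h x).
Proof.
move=> h0; rewrite /bar hecke_sum; under eq_bigr do rewrite heckeZ.
by apply: (tri_sum (c := fun w x => barT w x) barT_tri) => y /h0 ->; rewrite rmorph0.
Qed.

(** The bar involution is unitriangular, so a top coefficient of the difference is fixed by [conj];
    being negative as well, it vanishes, and the argument descends in length. *)
Lemma KL_unique w h k : KL w h -> KL w k -> h = k.
Proof.
move=> [bh nh] [bk nk]; apply/eqP; rewrite -subr_eq0; apply/eqP.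
suff E x : (h - k) x = 0 by apply/ffunP => x; rewrite E hecke0.
move: x; apply: (down_ind (d := len)) => x IH; apply: neg_conj; last first.
  rewrite -barE_max // -scaleN1r addrC bar_semilinear bh bk rmorphN1.
  by [].
have := negB (nh x) (nk x); congr neg.
by rewrite !(heckeD, heckeN); ring.
Qed.

(** The defining conditions bound the degrees of the coefficients but not the support. The descent
    of [KL_unique] shows that only [w] itself occurs at or above its length. *)
Lemma KL_tri (c : W -> H) : (forall w, KL w (c w)) -> tri len (fun w x => c w x).
Proof.
move=> cKL w; have [bw nw] := cKL w.
have far : forall x, (len w <= len x)%N -> x != w -> c w x = 0.
  apply: (down_ind (d := len)) => x IH lx xw; apply: neg_conj.
    by have := nw x; rewrite !(heckeD, heckeN) gTE (negPf xw) subr0.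
  rewrite -barE_max ?bw // => y xy; apply: IH => //; first by lia.
  by apply: contraTneq xy => ->; rewrite -leqNgt.
split=> [|y].
  apply/eqP; rewrite -subr_eq0; apply/eqP; apply: neg_conj.
    by have := nw w; rewrite !(heckeD, heckeN) gTE eqxx.
  rewrite rmorphB rmorph1 -barE_max ?bw // => y xy; apply: far; first exact: ltnW.
  by apply: contraTneq xy => ->; rewrite ltnn.
have [->|yw] := eqVneq y w; first by left.
by move=> H1; right; rewrite ltnNge; apply: contraNN H1 => /far ->.
Qed.

Lemma KL_flip w h : KL w h -> KL w^-1%g (flip h).
Proof.
case=> bh nh; split; first by rewrite bar_flip bh.
move=> x; have := nh x^-1%g; rewrite -flip_T; congr neg.
by rewrite !(heckeD, heckeN, flipE).
Qed.

End BarInvolution.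

(** * Kazhdan-Lusztig bases *)

Section KLBases.
Local Arguments wd : simpl never.
Local Open Scope ring_scope.
Context (W : finGroupType) (D : dihedral W) (R : comNzRingType) (u ui : bool -> R).
Local Notation gen := (dgen D).
Local Notation n := (dn D).
Local Notation len := (cox_len (dS D)).
Local Notation ldes := (ldes D).
Local Notation wd := (wd D).
Local Notation lcnt := (lcnt D).
Local Notation par := (par D).
Local Notation H := {ffun W -> R^o}.
Local Notation Lop := (Lop D u ui).
Local Notation Cop := (Cop D u ui).
Local Notation xi := (xi u ui).
Local Notation gT := (gT R).
Context (u_ui : forall b, u b * ui b = 1).
Implicit Types (h k l : H) (b c : bool) (w x y : W).

Lemma Cop_wd b h i : (i < n)%N ->
  Cop b h (wd b i.+1) = h (wd (~~ b) i) + u b * h (wd b i.+1).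
Proof.
by move=> iN; rewrite /Cop heckeD heckeZ LopE gen_wd ldes_wd // /xi; ring.
Qed.

Lemma Cop_wdN b h i : (i < n)%N ->
  Cop b h (wd (~~ b) i) = h (wd b i.+1) + ui b * h (wd (~~ b) i).
Proof. by move=> iN; rewrite /Cop heckeD heckeZ LopE -wdS ldes_wdN // addr0. Qed.

(* The equation [Cop b h = (u b + ui b) *: h] in coordinates. *)
Definition eigen b h := forall i, (i < n)%N -> h (wd (~~ b) i) = ui b * h (wd b i.+1).

Lemma eigenD b h k : eigen b h -> eigen b k -> eigen b (h + k).
Proof. by move=> eh ek i iN; rewrite !heckeD eh // ek // mulrDr. Qed.

Lemma eigenZ b (a : R) h : eigen b h -> eigen b (a *: h).
Proof. by move=> eh i iN; rewrite !heckeZ eh // mulrCA. Qed.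

Lemma eigen0 b : eigen b 0.
Proof. by move=> i iN; rewrite !hecke0 mulr0. Qed.

(** Every value of [Cop b] is an eigenvector, hence determined by its coordinates at the elements
    with left descent [gen b]. *)
Lemma CopP b h k : eigen b k ->
  (forall i, (i < n)%N -> k (wd b i.+1) = h (wd (~~ b) i) + u b * h (wd b i.+1)) ->
  Cop b h = k.
Proof.
move=> ek E; apply/ffunP => w; have [[i iN ->]|[i iN ->]] := wd_case D b w.
  by rewrite Cop_wd // E.
rewrite Cop_wdN // ek // E // mulrDr mulrA [ui b * u b]mulrC u_ui mul1r.
by rewrite addrC.
Qed.

Lemma Cop_eigen b h : eigen b h -> Cop b h = (u b + ui b) *: h.
Proof.
move=> eh; apply: CopP => [|i iN]; first exact: eigenZ.
by rewrite heckeZ eh // mulrDl addrC.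
Qed.

Fixpoint mon (v : bool -> R) b i : R := if i is i'.+1 then v b * mon v (~~ b) i' else 1.

Lemma mon2 v b i : mon v b i.+2 = v b * v (~~ b) * mon v b i.
Proof. by rewrite /= negbK mulrA. Qed.

Lemma mon_n v b c : mon v b n = mon v c n.
Proof.
rewrite /dn; elim: (dm D) => [|i IH]; first by rewrite muln0.
by rewrite mulnS !mon2 IH; congr (_ * _); case: b c {IH} => [] [] //=; rewrite mulrC.
Qed.

Definition wmon v w : R := mon v (ldes true w) (len w).

Lemma wmon_wd v b i : (i <= n)%N -> wmon v (wd b i) = mon v b i.
Proof.
move=> iN; rewrite /wmon len_wd // ldesE //.
have [->|iN'] := eqVneq i n; first exact: mon_n.
by case: i iN iN' => [|i] _ _ //; rewrite orbF; case: b.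
Qed.

Lemma wmon_inv w : wmon u w * wmon ui w = 1.
Proof.
rewrite /wmon; elim: (len w) (ldes true w) => [|i IH] b /=; first by rewrite mulr1.
by rewrite mulrACA u_ui mul1r IH.
Qed.

(* The element whose Kazhdan-Lusztig polynomials are all equal to 1. *)
Definition Gam w : H :=
  [ffun y => if (y == w) || (len y < len w)%N then wmon u y * wmon ui w else 0].

Lemma GamE w y :
  Gam w y = if (y == w) || (len y < len w)%N then wmon u y * wmon ui w else 0.
Proof. exact: ffunE. Qed.

Lemma Gam_wd b c i j : (i <= n)%N -> (j <= n)%N ->
  Gam (wd b i) (wd c j) =
  if (j == i) && [|| c == b, j == 0%N | j == n] || (j < i)%N then mon u c j * mon ui b i else 0.
Proof. by move=> iN jN; rewrite GamE wd_eq // !len_wd // !wmon_wd. Qed.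

Lemma eigen_Gam b i : (0 < i <= n)%N -> eigen b (Gam (wd b i)).
Proof.
case: i => [//|i] /andP[_ iN] j jN; rewrite !Gam_wd //; last exact: ltnW.
rewrite [~~ b == b](_ : _ = false) ?(ltn_eqF jN) /=; last by case: b.
rewrite eqSS ltnS eqxx andbT; have -> : (j == i.+1) && ((j == 0%N) || false) = false by lia.
rewrite orFb ltnS leq_eqVlt; case: (_ || _); last by rewrite mulr0.
by rewrite !mulrA [ui b * u b]mulrC u_ui mul1r.
Qed.

(** The factor of the second term compensates for the changed first letter. In [KL_E] it is fixed by
    [conj]; when one parameter dominates it is not, and [Gam] has to be corrected. *)
Lemma Cop_Gam b i : (i < n)%N ->
  Cop b (Gam (wd (~~ b) i)) =
  Gam (wd b i.+1) + (if (1 < i)%N then (u b * ui (~~ b)) *: Gam (wd b i.-1) else 0).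
Proof.
move=> iN; apply: CopP => [|j jN].
  apply: eigenD; first by apply: eigen_Gam.
  case: ifP => i1; last exact: eigen0.
  by apply/eigenZ/eigen_Gam; lia.
have E1 : Gam (wd b i.+1) (wd b j.+1) = Gam (wd (~~ b) i) (wd (~~ b) j).
  rewrite !Gam_wd // ?(ltnW iN) ?(ltnW jN) // eqSS ltnS !eqxx /= !andbT.
  by case: (_ || _) => //; rewrite mulrACA u_ui mul1r.
rewrite heckeD E1; congr (_ + _).
have -> : (if (1 < i)%N then (u b * ui (~~ b)) *: Gam (wd b i.-1) else 0) (wd b j.+1) =
  if (1 < i)%N then u b * ui (~~ b) * Gam (wd b i.-1) (wd b j.+1) else 0.
  by case: ifP; rewrite ?heckeZ ?hecke0.
rewrite !Gam_wd ?(ltnW iN) //; last by lia.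
rewrite [b == ~~ b](_ : _ = false); last by case: b {E1}.
have -> : (j.+1 == i) && [|| false, j.+1 == 0%N | j.+1 == n] = false by lia.
rewrite eqxx andbT orFb; case: ltnP => i1; last first.
  by have -> : (j.+1 < i)%N = false; [lia | rewrite mulr0].
have -> : (j.+1 == i.-1) || (j.+1 < i.-1)%N = (j.+1 < i)%N by lia.
case: ifP => // _; rewrite ?mulr0 //.
case: i iN i1 {E1} => [|i] // _ _ /=; rewrite negbK; ring.
Qed.

Lemma Gam1 : Gam 1%g = gT 1%g.
Proof.
apply/ffunP => w; rewrite GamE gTE len1 ltn0 orbF; case: eqP => [->|//].
by rewrite -[RHS](wmon_inv 1%g).
Qed.

Section Bar.
Context (conj : {rmorphism R -> R}).
Context (conj_u : forall b, conj (u b) = ui b) (conj_ui : forall b, conj (ui b) = u b).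
Context (neg np : R -> Prop).
Context (neg0 : neg 0) (negD : forall a a' : R, neg a -> neg a' -> neg (a + a'))
  (negN : forall a : R, neg a -> neg (- a))
  (negM : forall a a' : R, neg a -> np a' -> neg (a * a'))
  (negW : forall a : R, neg a -> np a) (np1 : np 1)
  (npM : forall a a' : R, np a -> np a' -> np (a * a')) (npui : forall b, np (ui b)).
Local Notation bar := (bar D u ui conj).
Local Notation KL := (KL D u ui conj neg).

Lemma bar_Gam1 : bar (Gam 1%g) = Gam 1%g.
Proof. by rewrite Gam1 bar_T barT1. Qed.

Lemma np_exp (a : R) i : np a -> np (a ^+ i).
Proof. by move=> na; elim: i => [|i IH]; rewrite ?expr0 // exprS; apply: npM. Qed.

Lemma neg_exp (a : R) i : neg a -> (0 < i)%N -> neg (a ^+ i).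
Proof. by case: i => // i na _; rewrite exprS; apply/negM/np_exp/negW. Qed.

Lemma wmonE v w : wmon v w = v true ^+ lcnt true w * v false ^+ lcnt false w.
Proof.
have [b [i [iN ->]]] := wd_exists D w; rewrite wmon_wd // !lcnt_wd //.
rewrite (_ : mon v b i = v b ^+ uphalf i * v (~~ b) ^+ i./2); last first.
  elim: i b {iN} => [|i IH] b; first by rewrite !expr0 mulr1.
  by rewrite [mon _ _ _]/= IH negbK [uphalf i.+1]/= exprS -mulrA [v (~~ b) ^+ _ * _]mulrC.
by case: b => //=; rewrite mulrC.
Qed.

Lemma exp_ratio b i j : (i <= j)%N -> u b ^+ i * ui b ^+ j = ui b ^+ (j - i).
Proof.
by move=> ij; rewrite -{1}(subnKC ij) exprD mulrA -exprMn u_ui expr1n mul1r.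
Qed.

(** The coefficient at a shorter [y] is a product of powers of the [ui b] with exponents the
    differences of letter counts: none is negative and, the lengths being different, one is
    positive. *)
Lemma Gam_neg w y : neg (ui true) -> neg (ui false) -> neg ((Gam w - gT w) y).
Proof.
move=> nt nf; rewrite heckeD heckeN GamE gTE; have [->|yw] := eqVneq y w.
  by rewrite wmon_inv subrr.
rewrite subr0 /=; case: ifP => // lt.
rewrite !wmonE mulrACA !exp_ratio ?lcnt_le //.
have [E|] := leqP (lcnt true w) (lcnt true y).
  rewrite mulrC; apply: negM; last exact: np_exp.
  apply: neg_exp => //; rewrite subn_gt0.
  by have := lcnt_len D y; have := lcnt_len D w; lia.
move=> E; apply: negM; last exact: np_exp.
by apply: neg_exp => //; rewrite subn_gt0.
Qed.

(* [tabZ], [tabE], [tabG] and [tabH] below give the action of the generators on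
   the Kazhdan-Lusztig basis in the four relative positions of the weights; this
   is all that is needed to determine cells and characters. *)
Definition tab_desc (c : W -> H) b := forall w, ldes b w -> Cop b (c w) = (u b + ui b) *: c w.

(** ** Both parameters zero *)

Definition tabZ (c : W -> H) := forall b w, Lop b (c w) = c (gen b * w)%g.

Lemma KL_Z : (forall b, xi b = 0) -> (forall w, KL w (gT w)) /\ tabZ gT.
Proof.
move=> x0; have E : tabZ gT.
  by move=> b w; rewrite Lop_T x0 scale0r if_same addr0.
split=> // w; split; last by move=> x; rewrite subrr hecke0.
have [b [i [_ ->]]] := wd_exists D w; elim: i b => [|i IH] b; first by rewrite bar_T barT1.
by rewrite wdS -E bar_Lop // IH /Lbar x0 scale0r subr0.
Qed.

(** ** Parameters of equal nonzero absolute value *)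

Definition tabE (c : W -> H) := (forall b, tab_desc c b) /\
  forall b i, (i < n)%N -> Cop b (c (wd (~~ b) i)) =
    c (wd b i.+1) + if (1 < i)%N then (u b * ui (~~ b)) *: c (wd b i.-1) else 0.

Lemma tab_desc_eigen (c : W -> H) b :
  (forall i, (0 < i <= n)%N -> eigen b (c (wd b i))) -> tab_desc c b.
Proof.
move=> E w; have [[i iN ->]|[i iN ->]] := wd_case D b w; last by rewrite ldes_wdN.
by move=> _; apply/Cop_eigen/E.
Qed.

Lemma KL_E : neg (ui true) -> neg (ui false) ->
  u true * ui false = u false * ui true ->
  (forall w, KL w (Gam w)) /\ tabE Gam.
Proof.
move=> nt nf e; split=> [w|]; last first.
  split=> [b|b i]; last exact: Cop_Gam.
  exact/tab_desc_eigen/eigen_Gam.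
split=> [|x]; last exact: Gam_neg.
have [b [i [iN ->]]] := wd_exists D w.
have [N] := ubnP i; elim: N i b iN => // N IH [|i] b iN lt; first exact: bar_Gam1.
have -> : Gam (wd b i.+1) = Cop b (Gam (wd (~~ b) i)) -
    (if (1 < i)%N then (u b * ui (~~ b)) *: Gam (wd b i.-1) else 0).
  by rewrite Cop_Gam // addrK.
rewrite addrC -scaleN1r bar_semilinear rmorphN1 bar_Cop // IH //; last by lia.
congr (_ *: _ + _); case: ifP => i1; last exact: bar0.
rewrite barZ IH; [|lia|lia].
by congr (_ *: _); rewrite rmorphM conj_u conj_ui; case: b; rewrite /= mulrC ?e // mulrC.
Qed.

(** ** One parameter dominates the other *)

Section Dominant.
Context (be : bool).
Local Notation r := (~~ be).
Local Notation q := (u r * ui be).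
Local Notation q' := (u be * ui r).

Lemma rbeF : (r == be) = false. Proof. by case: (be). Qed.
Lemma berF : (be == r) = false. Proof. by case: (be). Qed.

Lemma qq' : q * q' = 1.
Proof. by transitivity ((u r * ui r) * (u be * ui be)); [ring | rewrite !u_ui mulr1]. Qed.

Definition tabG (c : W -> H) := [/\ forall b, tab_desc c b,
  forall i, (i < n)%N -> Cop r (c (wd be i)) = c (wd r i.+1),
  Cop be (c 1%g) = c (wd be 1)
  & forall i, (i.+1 < n)%N -> Cop be (c (wd r i.+1)) = c (wd be i.+2)
      + (if (0 < i)%N then (q + q') *: c (wd be i) else 0)
      + (if (2 < i)%N then c (wd be i.-2) else 0)].

(** An alternating sum, with powers of [q], of the [Gam] at odd words starting with [be]. Replacing
    [Gam] by [alt] completes the factor [q'] of [Cop_Gam], which is not fixed by [conj], to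
    [q + q'], which is. *)
Fixpoint alt j : H :=
  if j is j'.+1 then Gam (wd be (j'.*2.+3)) - q *: alt j' else Gam (wd be 1).

(** At an odd word starting with [r], the correction is the second term that [Cop r] produces from
    the even word below; its coefficient [q] is negative, as required. *)
Definition domC b i : H :=
  if ~~ odd i then Gam (wd b i) else
  if b == be then alt i./2 else
  if (1 < i)%N then Gam (wd b i) + q *: Gam (wd b i.-2) else Gam (wd b i).

Definition domW w : H := domC (ldes true w) (len w).

Lemma domW_wd b i : (i <= n)%N -> domW (wd b i) = domC b i.
Proof.
move=> iN; rewrite /domW len_wd // ldesE //.
have [->|iN'] := eqVneq i n; first by rewrite /domC odd_dn (wd_n _ _ b).
by case: i iN iN' => [|i] _ _ //; rewrite orbF; case: b.
Qed.

Lemma domC_odd j : domC be j.*2.+1 = alt j.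
Proof. by rewrite /domC /= odd_double eqxx /= uphalf_double. Qed.

Lemma altB j : alt j.+1 = Gam (wd be j.*2.+3) - q *: alt j. Proof. by []. Qed.

Lemma altS j : alt j.+1 + q *: alt j = Gam (wd be j.*2.+3).
Proof. by rewrite altB subrK. Qed.

Lemma Cop_linear b : linear (Cop b).
Proof.
move=> a h k; apply/ffunP => w; rewrite /Cop !(heckeD, heckeZ, LopE).
by case: ifP => _; ring.
Qed.

Lemma CopD b h k : Cop b (h + k) = Cop b h + Cop b k.
Proof. by rewrite -{1}[h]scale1r Cop_linear scale1r. Qed.

Lemma Cop0 b : Cop b 0 = 0.
Proof. by rewrite /Cop linear0 scaler0 addr0. Qed.

Lemma CopZ b (a : R) h : Cop b (a *: h) = a *: Cop b h.
Proof. by rewrite -[a *: h]addr0 Cop_linear Cop0 addr0. Qed.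

(** The second terms of [Cop_Gam] telescope along the alternating sum and only the leading one
    remains. *)
Lemma Cop_alt j : (j.*2.+1 < n)%N -> Cop r (alt j) = Gam (wd r j.*2.+2).
Proof.
elim: j => [|j IH] jN; first by have := @Cop_Gam r 1; rewrite negbK addr0 => ->.
rewrite altB CopD -scaleNr CopZ IH; last by lia.
have := @Cop_Gam r j.*2.+3; rewrite negbK => -> //.
by rewrite scaleNr addrK.
Qed.

Lemma eigen_alt j : (j.*2.+1 <= n)%N -> eigen be (alt j).
Proof.
elim: j => [|j IH] jN; first exact: eigen_Gam.
rewrite altB -scaleNr; apply: eigenD; first by apply: eigen_Gam.
by apply: eigenZ; apply: IH; lia.
Qed.

Lemma eigen_domC b i : (0 < i <= n)%N -> eigen b (domC b i).
Proof.
move=> iN; rewrite /domC; case: ifP => oi; first exact: eigen_Gam.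
have oE : i = (i./2.*2.+1)%N by have := odd_double_half i; rewrite -[odd i]negbK oi.
case: eqP => [->|_]; first by apply: eigen_alt; lia.
case: ifP => i1; last exact: eigen_Gam.
by apply: eigenD; first exact: eigen_Gam; apply/eigenZ/eigen_Gam; lia.
Qed.

Lemma domC_tab1 i : (i < n)%N -> Cop r (domC be i) = domC r i.+1.
Proof.
move=> iN; rewrite /domC [odd i.+1]/= eqxx (_ : (r == be) = false); last by case: be.
rewrite negbK; case: ifPn => [oi|]; rewrite ?negbK.
  have := @Cop_Gam r i iN; rewrite negbK (negPf oi) => ->.
  by case: i iN oi => [|[|i]] iN oi //; rewrite addr0.
move=> oi; rewrite oi.
have oE : i = (i./2.*2.+1)%N by have := odd_double_half i; rewrite oi.
by rewrite Cop_alt -?oE.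
Qed.

Lemma domC_even b j : domC b j.*2 = Gam (wd b j.*2).
Proof. by rewrite /domC odd_double. Qed.

Lemma domC_r j : domC r j.*2.+3 = Gam (wd r j.*2.+3) + q *: Gam (wd r j.*2.+1).
Proof. by rewrite /domC /= odd_double (_ : (r == be) = false) //; case: be. Qed.

Lemma domC_tab2 i : (i.+1 < n)%N -> Cop be (domC r i.+1) = domC be i.+2
      + (if (0 < i)%N then (q + q') *: domC be i else 0)
      + (if (2 < i)%N then domC be i.-2 else 0).
Proof.
move=> iN; have [oi|oi] := boolP (odd i).
  have [j ij] : exists j, i = j.*2.+1 by exists i./2; have := odd_double_half i; rewrite oi.
  rewrite ij in iN *; rewrite -[j.*2.+3]/(j.+1.*2.+1) -[j.*2.+2]/(j.+1.*2) !domC_odd domC_even.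
  rewrite Cop_Gam // -[j.+1.*2.+1]/(j.*2.+3) -altS scalerDl.
  case: j {ij} iN => [|j] iN; first by rewrite addr0 addrA.
  rewrite -[j.+1.*2.+1.-2]/(j.*2.+1) -[j.+2.*2.-1]/(j.*2.+3) domC_odd -[Gam (wd be j.*2.+3)]altS.
  rewrite -[(2 < _)%N]/true -[(1 < _)%N]/true -[(0 < _)%N]/true.
  rewrite [q' *: (_ + _)]scalerDr scalerA [q' * q]mulrC qq' scale1r.
  by rewrite !addrA.
have [j ij] : exists j, i = j.*2 by exists i./2; have := odd_double_half i; rewrite (negPf oi).
rewrite ij in iN *; case: j {ij} iN => [|j] iN.
  rewrite -[0.*2.+2]/(1.*2) domC_even /domC /= (_ : (r == be) = false); last by case: be.
  by rewrite Cop_Gam // !addr0.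
rewrite -[j.+1.*2.+1]/(j.*2.+3) domC_r -[j.+1.*2.+2]/(j.+2.*2) !domC_even.
rewrite CopD CopZ Cop_Gam // Cop_Gam; last by lia.
rewrite -[j.+1.*2.+1]/(j.*2.+3) /= scalerDl scalerDr.
rewrite -!addrA; congr (_ + _); rewrite addrCA; congr (_ + (_ + _)).
by case: j {iN} => [|j]; rewrite ?scaler0 // scalerA qq' scale1r.
Qed.

Lemma tabG_dom : tabG domW.
Proof.
have n4 := dn_ge4 D; split=> [b|i iN||i iN].
- by apply: tab_desc_eigen => i /andP[i0 iN]; rewrite domW_wd //; apply: eigen_domC; rewrite i0.
- by rewrite !domW_wd ?domC_tab1 // ltnW.
- rewrite -[1%g]/(wd r 0) !domW_wd // ?/domC; last by lia.
  by rewrite /= Cop_Gam ?addr0 ?eqxx //; lia.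
- rewrite !domW_wd ?domC_tab2 //; try lia.
Qed.

(** The table computes each [c w] from shorter ones with the coefficients 1 and [q + q'], both fixed
    by [conj]. *)
Lemma tabG_bar (c : W -> H) : bar (c 1%g) = c 1%g -> tabG c -> forall w, bar (c w) = c w.
Proof.
move=> b1 [_ T1 T0 T2] w.
have n4 := dn_ge4 D.
have be_case i : (i <= n)%N -> bar (c (wd be i)) = c (wd be i).
  have [N] := ubnP i; elim: N i => // N IH [|[|i]] lt iN //.
    by rewrite -T0 bar_Cop // b1.
  have E : c (wd be i.+2) = Cop be (Cop r (c (wd be i))) -
      ((if (0 < i)%N then (q + q') *: c (wd be i) else 0)
      + (if (2 < i)%N then c (wd be i.-2) else 0)).
    by rewrite (T1 _ (ltnW iN)) T2 // -[X in _ = X - _]addrA addrK.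
  rewrite E addrC -scaleN1r bar_semilinear rmorphN1 !bar_Cop // IH; [|lia|lia].
  congr (_ *: _ + _); rewrite barD; congr (_ + _).
    case: ifP => i0; last exact: bar0.
    rewrite barZ IH; [|lia|lia]; congr (_ *: _).
    by rewrite rmorphD !rmorphM !conj_u !conj_ui addrC; congr (_ + _); rewrite mulrC.
  by case: ifP => i2; [apply: IH; lia | exact: bar0].
have [[i iN ->]|[i iN ->]] := wd_case D r w.
  by rewrite -T1 // bar_Cop // be_case // ltnW.
by rewrite negbK be_case // ltnW.
Qed.

Lemma alt_neg j y : (j.*2.+1 <= n)%N -> neg (ui true) -> neg (ui false) -> neg q ->
  neg ((alt j - gT (wd be j.*2.+1)) y).
Proof.
move=> jN nt nf nq; elim: j jN y => [|j IH] jN y; first exact: Gam_neg.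
have := Gam_neg (wd be j.*2.+3) y nt nf; rewrite /= !(heckeD, heckeN, heckeZ) => n1.
rewrite addrAC -[X in _ - X]mulrC; apply: negD => //; apply: negN.
have := IH _ y; rewrite !(heckeD, heckeN) => /(_ _) n2.
rewrite -[alt j y](subrK (gT (wd be j.*2.+1) y)) mulrDl; apply: negD.
  by apply: negM; [apply: n2; lia | exact: negW].
by rewrite gTE; case: eqP => _; rewrite ?mul0r ?mul1r.
Qed.

Lemma KL_dom : neg (ui true) -> neg (ui false) -> neg q ->
  (forall w, KL w (domW w)) /\ tabG domW.
Proof.
move=> nt nf nq; split; last exact: tabG_dom.
move=> w; split.
  apply: (tabG_bar (c := domW)); last exact: tabG_dom.
  by rewrite -[1%g]/(wd true 0) domW_wd // /domC /= bar_Gam1.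
move=> y; have [b [i [iN ->]]] := wd_exists D w; rewrite domW_wd // /domC.
case: ifP => oi; first exact: Gam_neg.
have oE : i = (i./2.*2.+1)%N by have := odd_double_half i; rewrite -[odd i]negbK oi.
case: eqP => [->|_]; first by rewrite {2}oE; apply: alt_neg; rewrite -?oE.
case: ifP => i1; last exact: Gam_neg.
rewrite addrAC heckeD; apply: negD; first exact: Gam_neg.
rewrite heckeZ mulrC -[Gam _ y](subrK (gT (wd b i.-2) y)) mulrDl; apply: negD.
  apply: negM; last exact: negW.
  by have := Gam_neg (wd b i.-2) y nt nf; rewrite heckeD heckeN.
by rewrite gTE; case: eqP => _; rewrite ?mul0r ?mul1r.
Qed.

(** ** One parameter zero *)

Definition tabH (c : W -> H) := [/\ tab_desc c be,
  forall w, Lop r (c w) = c (gen r * w)%g,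
  Cop be (c 1%g) = c (wd be 1)
  & forall i, (i.+1 < n)%N -> Cop be (c (wd r i.+1)) = c (wd be i.+2)
      + (if (2 < i)%N then c (wd be i.-2) else 0)].

(** With weight zero at [gen r], the algebra is a crossed product of the group generated by [gen r]
    with an equal-parameter Hecke algebra, that of the dihedral group generated by [gen be] and its
    conjugate under [gen r]. There [lcnt be] is the length, [par r] separates the two cosets, and
    this is the analogue of [Gam] on each coset. *)
Definition semC w : H :=
  [ffun y => if (y == w) || (lcnt be y < lcnt be w)%N && (par r y == par r w)
             then u be ^+ lcnt be y * ui be ^+ lcnt be w else 0].

Lemma semCE w y : semC w y =
  if (y == w) || (lcnt be y < lcnt be w)%N && (par r y == par r w)
  then u be ^+ lcnt be y * ui be ^+ lcnt be w else 0.
Proof. exact: ffunE. Qed.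

Lemma lcnt_be i : (i <= n)%N ->
  [/\ lcnt be (wd be i) = uphalf i, lcnt be (wd r i) = i./2,
      par r (wd be i) = odd i./2 & par r (wd r i) = odd (uphalf i)].
Proof.
move=> iN; by rewrite /par !lcnt_wd // !eqxx rbeF berF.
Qed.

Lemma eigen_semC i : (0 < i <= n)%N -> eigen be (semC (wd be i)).
Proof.
move=> /andP[i0 iN] j jN; have [e1 _ e3 _] := lcnt_be iN.
have [_ f2 _ f4] := lcnt_be (ltnW jN); have [g1 _ g3 _] := lcnt_be jN.
rewrite !semCE !wd_eq ?(ltnW jN) // e1 e3 f2 f4 g1 g3 eqxx andbT.
have -> : (j == i) && [|| r == be, j == 0%N | j == n] = false.
  by rewrite rbeF; lia.
have -> : false || ((j./2 < uphalf i)%N && (odd (uphalf j) == odd i./2)) =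
  (j.+1 == i) || (uphalf j.+1 < uphalf i)%N && (odd j.+1./2 == odd i./2) by lia.
case: ifP => _; last by rewrite mulr0.
by rewrite /= exprS !mulrA [ui be * u be]mulrC u_ui mul1r.
Qed.

Lemma semC_tab2 i : (i.+1 < n)%N -> Cop be (semC (wd r i.+1)) = semC (wd be i.+2)
      + (if (2 < i)%N then semC (wd be i.-2) else 0).
Proof.
move=> iN; apply: CopP => [|j jN].
  apply: eigenD; first exact: eigen_semC.
  by case: ifP => i2; [apply: eigen_semC; lia | exact: eigen0].
have [_ a2 _ a4] := lcnt_be (ltnW jN); have [b1 _ b3 _] := lcnt_be jN.
have [_ c2 _ c4] := lcnt_be (ltnW iN); have [d1 _ d3 _] := lcnt_be iN.
rewrite heckeD !semCE !wd_eq ?(ltnW jN) ?(ltnW iN) // a2 a4 b1 b3 c2 c4 d1 d3 !eqxx !andbT.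
rewrite berF.
have -> : (j.+1 == i.+1) && [|| false, j.+1 == 0%N | j.+1 == n] = false by lia.
congr (_ + _).
  have -> : (j.+1 == i.+2) || (uphalf j.+1 < uphalf i.+2)%N && (odd j.+1./2 == odd i.+2./2) =
    (j == i.+1) || (j./2 < i.+1./2)%N && (odd (uphalf j) == odd (uphalf i.+1)) by lia.
  case: ifP => // _; rewrite (_ : uphalf j.+1 = j./2.+1) // (_ : uphalf i.+2 = i.+1./2.+1) //.
  by rewrite !exprS mulrACA u_ui mul1r.
case: ltnP => i2; last first.
  by rewrite hecke0 orFb; have -> : (uphalf j.+1 < i.+1./2)%N = false; [lia | rewrite mulr0].
have i2N : (i.-2 <= n)%N by lia.
have [p1 _ p3 _] := lcnt_be i2N.
rewrite semCE wd_eq // b1 b3 p1 p3 eqxx andbT orFb.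
case: i iN i2 {c2 c4 d1 d3 i2N p1 p3} => [|[|[|i]]] // iN _.
have -> : uphalf i.+3.-2 = i./2.+1 by [].
have -> : i.+4./2 = i./2.+2 by [].
have -> : i.+3.-2./2 = uphalf i by [].
have -> : uphalf j.+1 = j./2.+1 by [].
have -> : j.+1./2 = uphalf j by [].
have -> : odd (uphalf i.+4) = odd (uphalf i) by rewrite /= negbK.
have -> : (j.+1 == i.+3.-2) || (j./2.+1 < i./2.+1)%N && (odd (uphalf j) == odd (uphalf i)) =
  (j./2.+1 < i./2.+2)%N && (odd (uphalf j) == odd (uphalf i)) by lia.
case: ifP => _; last by rewrite mulr0.
rewrite [ui be ^+ i./2.+2]exprS; set A := u be ^+ _; set B := ui be ^+ _.
by transitivity ((u be * ui be) * (A * B)); [rewrite u_ui mul1r | ring].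
Qed.

Lemma semC_r : u r = 1 -> xi r = 0 -> forall w, Lop r (semC w) = semC (gen r * w)%g.
Proof.
move=> ur x0 w; apply/ffunP => y; rewrite LopE x0 mul0r if_same addr0 !semCE.
have -> : ((gen r * y)%g == w) = (y == (gen r * w)%g).
  by rewrite -(inj_eq (mulgI (gen r))) genK.
have E z : lcnt be (gen r * z)%g = lcnt be z.
  case d : (ldes r z); last by rewrite lcnt_gen // berF.
  have := @lcnt_gen _ D be r (gen r * z)%g; rewrite ldes_gen d genK => /(_ erefl) ->.
  by rewrite berF.
rewrite !E !par_gen eqxx; congr (if _ || (_ && _) then _ else _).
by case: (par r y); case: (par r w).
Qed.

Lemma tabH_sem : u r = 1 -> xi r = 0 -> tabH semC.
Proof.
move=> ur x0; have n4 := dn_ge4 D; split=> [|w||i iN].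
- by apply: tab_desc_eigen => i; apply: eigen_semC.
- exact: semC_r.
- apply: CopP => [|j jN]; first by apply: eigen_semC; lia.
  have [_ a2 _ a4] := lcnt_be (ltnW jN); have [b1 _ b3 _] := lcnt_be jN.
  have lt1n : (1 <= n)%N by lia.
  have [d1 _ d3 _] := lcnt_be lt1n; have [c1 _ c3 _] := lcnt_be (leq0n n).
  rewrite -[1%g]/(wd be 0) !semCE !wd_eq // ?(ltnW jN) // a2 a4 b1 b3 c1 c3 d1 d3.
  rewrite eqxx /= !andbT !orbF mulr0 addr0 eqSS.
  have -> : (j == 0%N) && [|| r == be, j == 0%N | j == n] = (j == 0%N) by case: j {jN a2 a4 b1 b3} => //=; rewrite orbT.
  by case: eqP => // ->; rewrite /= !expr1 u_ui expr0 mulr1.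
- exact: semC_tab2.
Qed.

Lemma semC1 : semC 1%g = gT 1%g.
Proof.
apply/ffunP => y; rewrite semCE gTE -[1%g]/(wd be 0).
have [-> _ _ _] := lcnt_be (leq0n n); rewrite ltn0 orbF; case: eqP => // ->.
by have [-> _ _ _] := lcnt_be (leq0n n); rewrite mulr1.
Qed.

Lemma tabH_bar (c : W -> H) : ui r = 1 -> xi r = 0 ->
  bar (c 1%g) = c 1%g -> tabH c -> forall w, bar (c w) = c w.
Proof.
move=> uir x0 b1 [_ T1 T0 T2] w; have n4 := dn_ge4 D.
have Lr h : bar (Lop r h) = Lop r (bar h) by rewrite bar_Lop // /Lbar x0 scale0r subr0.
have be_case i : (i <= n)%N -> bar (c (wd be i)) = c (wd be i).
  have [N] := ubnP i; elim: N i => // N IH [|[|i]] lt iN //.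
    by rewrite -T0 bar_Cop // b1.
  have E : c (wd be i.+2) = Cop be (Lop r (c (wd be i))) -
      (if (2 < i)%N then c (wd be i.-2) else 0).
    by rewrite T1 (_ : (gen r * wd be i)%g = wd r i.+1) ?T2 ?addrK // wdS negbK.
  rewrite E addrC -scaleN1r bar_semilinear rmorphN1 bar_Cop // Lr IH; [|lia|lia].
  congr (_ *: _ + _); case: ifP => i2; [apply: IH; lia | exact: bar0].
have [[i iN ->]|[i iN ->]] := wd_case D r w.
  by rewrite wdS negbK -T1 Lr be_case // ltnW.
by rewrite negbK be_case // ltnW.
Qed.

Lemma KL_sem : u r = 1 -> ui r = 1 -> neg (ui be) -> (forall w, KL w (semC w)) /\ tabH semC.
Proof.
move=> ur uir nb; have x0 : xi r = 0 by rewrite /xi ur uir subrr.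
have T := tabH_sem ur x0; split=> // w; split.
  by apply: tabH_bar => //; rewrite semC1 bar_T barT1.
move=> y; rewrite heckeD heckeN semCE gTE; have [->|yw] := eqVneq y w.
  by rewrite /= -exprMn u_ui expr1n subrr.
rewrite subr0 /=; case: ifP => // /andP[lt _].
by rewrite exp_ratio ?(ltnW lt) //; apply: neg_exp => //; rewrite subn_gt0.
Qed.

End Dominant.
End Bar.
End KLBases.

(** * Cells *)

Section CellsOfBasis.
Local Open Scope ring_scope.
Context (W : finGroupType) (D : dihedral W) (R : comNzRingType) (u ui : bool -> R).
Local Notation gen := (dgen D).
Local Notation n := (dn D).
Local Notation len := (cox_len (dS D)).
Local Notation ldes := (ldes D).
Local Notation rdes := (rdes D).
Local Notation wd := (wd D).
Local Notation H := {ffun W -> R^o}.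
Local Notation Lop := (Lop D u ui).
Local Notation Cop := (Cop D u ui).
Local Notation mul := (hmul D u ui).
Local Notation gT := (gT R).
Local Notation flip := (@flip W R).
Implicit Types (h l : H) (b : bool) (w x y : W) (k : side) (J : {set W}).

Context (c : W -> H).

Definition gcoord h : {ffun W -> R} :=
  xget [ffun=> 0] [set a : {ffun W -> R} | h = \sum_(w : W) a w *: c w]%classic.

Definition gmul_side k h h' l : H :=
  match k with
  | LeftSide => mul h l
  | RightSide => mul l h
  | TwoSided => mul (mul h l) h'
  end.

Definition gstep k : rel W := fun x y =>
  `[< exists h h' : H, gcoord (gmul_side k h h' (c y)) x != 0 >].
Definition gcle k : rel W := connect (gstep k).
Definition gceq k : rel W := fun x y => gcle k x y && gcle k y x.

Context (c_tri : tri len (fun w x => c w x)).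
Context (c_flip : forall w, flip (c w) = c w^-1%g).

Lemma gcoordE h (a : {ffun W -> R}) : h = \sum_w a w *: c w -> gcoord h = a.
Proof.
move=> ha; rewrite /gcoord; case: xgetP => [b _ /= hb|/(_ a) []] //.
apply/ffunP => x; apply/eqP; rewrite -subr_eq0; apply/eqP; move: x.
apply: (tri_free c_tri) => y.
under eq_bigr do rewrite mulrBl.
rewrite sumrB; have := congr1 (fun h : H => h y) hb; rewrite {1}ha !hecke_sum.
under eq_bigr do rewrite heckeZ.
under [RHS]eq_bigr do rewrite heckeZ.
by move=> ->; rewrite subrr.
Qed.

Lemma gcoord_sum h : h = \sum_w gcoord h w *: c w.
Proof.
have [a aE] := tri_span h c_tri.
suff E : h = \sum_w a w *: c w by rewrite (gcoordE E).
apply/ffunP => y; rewrite aE hecke_sum; apply: eq_bigr => x _.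
by rewrite heckeZ.
Qed.

Lemma gcoordP (a : R) h l x : gcoord (a *: h + l) x = a * gcoord h x + gcoord l x.
Proof.
rewrite (@gcoordE _ [ffun x => a * gcoord h x + gcoord l x]) ?ffunE //.
under eq_bigr do rewrite ffunE scalerDl -scalerA.
by rewrite big_split -scaler_sumr -!gcoord_sum.
Qed.

Lemma gcoordD h l x : gcoord (h + l) x = gcoord h x + gcoord l x.
Proof. by rewrite -{1}[h]scale1r gcoordP mul1r. Qed.

Lemma gcoord0 x : gcoord 0 x = 0.
Proof. by rewrite (@gcoordE 0 [ffun=> 0]) ?ffunE // big1 // => w _; rewrite ffunE scale0r. Qed.

Lemma gcoordZ (a : R) h x : gcoord (a *: h) x = a * gcoord h x.
Proof. by rewrite -[a *: h]addr0 gcoordP gcoord0 addr0. Qed.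

Lemma gcoord_c w x : gcoord (c w) x = (x == w)%:R.
Proof.
rewrite (@gcoordE _ [ffun x => (x == w)%:R]) ?ffunE //.
rewrite (bigD1 w) //= ffunE eqxx scale1r big1 ?addr0 // => y yw.
by rewrite ffunE (negPf yw) scale0r.
Qed.

Lemma gcoord_bigsum (F : W -> H) x : gcoord (\sum_w F w) x = \sum_w gcoord (F w) x.
Proof. by elim/big_rec2: _ => [|i y z _ <-]; rewrite ?gcoord0 ?gcoordD. Qed.

Definition inspan J h : Prop := forall x, x \notin J -> gcoord h x = 0.

Lemma inspan_c J w : w \in J -> inspan J (c w).
Proof.
by move=> wJ x; rewrite gcoord_c; case: eqP => // ->; rewrite wJ.
Qed.

Lemma inspan0 J : inspan J 0. Proof. by move=> x _; rewrite gcoord0. Qed.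

Lemma inspanD J h l : inspan J h -> inspan J l -> inspan J (h + l).
Proof. by move=> hJ lJ x xJ; rewrite gcoordD hJ // lJ // addr0. Qed.

Lemma inspanZ J (a : R) h : inspan J h -> inspan J (a *: h).
Proof. by move=> hJ x xJ; rewrite gcoordZ hJ // mulr0. Qed.

Lemma inspan_sum J (F : W -> H) : (forall w, inspan J (F w)) -> inspan J (\sum_w F w).
Proof. by move=> FJ x xJ; rewrite gcoord_bigsum big1 // => w _; apply: FJ. Qed.

(** Tested on generators only; [closedL_mul] extends it to the whole algebra, so the span is a left
    ideal. *)
Definition closedL J : Prop := forall b x, x \in J -> inspan J (Lop b (c x)).

Lemma closedL_Lop J b h : closedL J -> inspan J h -> inspan J (Lop b h).
Proof.
move=> cJ hJ; rewrite [h]gcoord_sum linear_sum; apply: inspan_sum => w.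
rewrite linearZ /=; case: (boolP (w \in J)) => wJ; first exact/inspanZ/cJ.
by rewrite hJ // scale0r; apply: inspan0.
Qed.

Lemma closedL_mul J h l : closedL J -> inspan J l -> inspan J (mul h l).
Proof.
move=> cJ lJ; rewrite /hmul; apply: inspan_sum => w; apply: inspanZ.
rewrite /Tact; elim: (len w) (ldes true w) => [|i IH] b //=.
exact: closedL_Lop.
Qed.

Lemma closed_connect k J x y : (forall x y, gstep k x y -> y \in J -> x \in J) ->
  gcle k x y -> y \in J -> x \in J.
Proof.
move=> cl /connectP[p]; elim: p x => [|z p IH] x /=; first by move=> _ ->.
by case/andP => xz zp yE yJ; apply: (cl _ z) => //; apply: IH.
Qed.

(** A set closed downwards for the preorder is a union of cells. All separations between cells are
    obtained in this way. *)
Lemma closed_gceq k J x y : (forall x y, gstep k x y -> y \in J -> x \in J) ->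
  gceq k x y -> (x \in J) = (y \in J).
Proof.
move=> cl /andP[xy yx].
by apply/idP/idP; [apply: closed_connect cl yx | apply: closed_connect cl xy].
Qed.

Lemma closedL_step J x y : closedL J -> gstep LeftSide x y -> y \in J -> x \in J.
Proof.
move=> cJ /asboolP[h [h' /= nz]] yJ; apply: contraNT nz => xJ.
by apply/eqP/(closedL_mul h cJ) => //; apply: inspan_c.
Qed.

Lemma flip_coord h x : gcoord (flip h) x = gcoord h x^-1%g.
Proof.
rewrite (@gcoordE _ [ffun x => gcoord h x^-1%g]) ?ffunE //.
rewrite [in LHS](gcoord_sum h) linear_sum (reindex_inj invg_inj) /=.
by apply: eq_bigr => w _; rewrite linearZ /= c_flip invgK ffunE.
Qed.

Lemma gstep_right x y : gstep RightSide x y = gstep LeftSide x^-1%g y^-1%g.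
Proof.
apply/asboolP/asboolP => -[h [h' /=]] nz; exists (flip h), h' => /=.
  by rewrite -c_flip -flip_mul flip_coord invgK.
by rewrite -[c y]flipK -flip_mul c_flip flip_coord.
Qed.

Lemma gcle_right x y : gcle RightSide x y = gcle LeftSide x^-1%g y^-1%g.
Proof.
have half k k' x' y' : (forall x y, gstep k x y = gstep k' x^-1%g y^-1%g) ->
    gcle k x' y' -> gcle k' x'^-1%g y'^-1%g.
  move=> E /connectP[p]; elim: p x' => [|z p IH] x' /=; first by move=> _ ->; apply: connect0.
  case/andP => xz zp yE; apply: (connect_trans (y := z^-1%g)); last exact: IH.
  by apply: connect1; rewrite -E.
apply/idP/idP; first by apply: half => ? ?; apply: gstep_right.
move/(half _ RightSide); rewrite !invgK; apply=> a b.
by rewrite gstep_right !invgK.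
Qed.

Lemma gceq_right x y : gceq RightSide x y = gceq LeftSide x^-1%g y^-1%g.
Proof. by rewrite /gceq !gcle_right. Qed.

Lemma gstep_two_left x y : gstep LeftSide x y -> gstep TwoSided x y.
Proof.
move=> /asboolP[h [h' /=]] nz; apply/asboolP; exists h, (gT 1%g) => /=.
by rewrite hmul1r.
Qed.

Lemma gstep_two_right x y : gstep RightSide x y -> gstep TwoSided x y.
Proof.
move=> /asboolP[h [h' /=]] nz; apply/asboolP; exists (gT 1%g), h => /=.
by rewrite hmul1l.
Qed.

Lemma gceq_two k x y : gceq k x y -> gceq TwoSided x y.
Proof.
have sub a a' : gcle k a a' -> gcle TwoSided a a'.
  apply: connect_sub => {}a {}a' st; apply: connect1; move: st.
  by case: k; [apply: gstep_two_left | apply: gstep_two_right | ].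
by move=> /andP[xy yx]; rewrite /gceq !sub.
Qed.

(** A left ideal stable under [flip] is also a right ideal. *)
Lemma closed_two J x y : closedL J -> (forall w, (w^-1%g \in J) = (w \in J)) ->
  gstep TwoSided x y -> y \in J -> x \in J.
Proof.
move=> cJ JV /asboolP[h [h' /= nz]] yJ; apply: contraNT nz => xJ; apply/eqP.
have S : inspan J (mul h (c y)) by apply: closedL_mul => //; apply: inspan_c.
have S2 : inspan J (mul (flip h') (flip (mul h (c y)))).
  by apply: closedL_mul => // z zJ; rewrite flip_coord S // JV.
by rewrite -[x]invgK -flip_coord flip_mul S2 // JV.
Qed.

Lemma gceq_refl k x : gceq k x x. Proof. by rewrite /gceq /gcle !connect0. Qed.
Lemma gceq_sym k x y : gceq k x y = gceq k y x. Proof. by rewrite /gceq andbC. Qed.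
Lemma gceq_trans k x y z : gceq k x y -> gceq k y z -> gceq k x z.
Proof.
move=> /andP[xy yx] /andP[yz zy]; rewrite /gceq /gcle.
by rewrite (connect_trans xy yz) (connect_trans zy yx).
Qed.

Lemma gcle_mul h x y : gcoord (mul h (c y)) x != 0 -> gcle LeftSide x y.
Proof. by move=> nz; apply/connect1/asboolP; exists h, h. Qed.

Lemma gcle_Lop b x y : gcoord (Lop b (c y)) x != 0 -> gcle LeftSide x y.
Proof. by rewrite -hmul_gen; apply: gcle_mul. Qed.

Lemma gcle_Cop b x y : gcoord (Cop b (c y)) x != 0 -> gcle LeftSide x y.
Proof.
have -> : Cop b (c y) = mul (ui b *: gT 1%g + gT (gen b)) (c y).
  by rewrite hmul_linear_l hmul1l hmul_gen addrC.
exact: gcle_mul.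
Qed.

Lemma inspan_Cop J b x : x \in J -> inspan J (Cop b (c x)) -> inspan J (Lop b (c x)).
Proof.
move=> xJ CJ; have -> : Lop b (c x) = - ui b *: c x + Cop b (c x).
  by rewrite /Cop addrC scaleNr addrK.
by apply: inspanD => //; apply/inspanZ/inspan_c.
Qed.

(** ** The predicted cells *)

Definition w0 : W := wd true n.

(** Right descents are constant on left cells and left descents on right cells. The constant value
    for two-sided cells makes the condition void there, so one formula covers all sides. *)
Definition tail k b w : bool :=
  match k with LeftSide => rdes b w | RightSide => ldes b w | TwoSided => false end.

Definition relE k : rel W := fun x y =>
  [&& (x == 1%g) == (y == 1%g), (x == w0) == (y == w0) & tail k true x == tail k true y].

Section Dominant.
Context (be : bool).
Local Notation r := (~~ be).
Local Notation w0r := (wd be n.-1).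

(** [w0r] is [gen r * w0]. With [1], [w0] and [gen r] it gives the four one-element cells, which
    afford the linear characters. *)
Definition relG k : rel W := fun x y =>
  [&& (x == 1%g) == (y == 1%g), (x == w0) == (y == w0), (x == gen r) == (y == gen r),
      (x == w0r) == (y == w0r) & tail k be x == tail k be y].

(** Multiplication by a generator of weight zero permutes the basis, which joins [1] to [gen r] and
    [w0] to [w0r]. *)
Definition relH k : rel W := fun x y =>
  [&& (x \in [set 1%g; gen r]) == (y \in [set 1%g; gen r]),
      (x \in [set w0; w0r]) == (y \in [set w0; w0r]) & tail k be x == tail k be y].

Lemma eq_1 b i : (i <= n)%N -> (wd b i == 1%g) = (i == 0%N).
Proof.
move=> iN; rewrite -[1%g]/(wd b 0) wd_eq // eqxx andbT //.
Qed.

Lemma eq_w0 b i : (i <= n)%N -> (wd b i == w0) = (i == n).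
Proof.
by move=> iN; rewrite wd_eq //; case: (eqVneq i n) => //= _; rewrite !orbT.
Qed.

Lemma eq_r b i : (i <= n)%N -> (wd b i == gen r) = (i == 1%N) && (b == r).
Proof.
have n4 := dn_ge4 D; move=> iN; rewrite -[gen r]mulg1 -[(_ * 1)%g]/(wd r 1) wd_eq //; last lia.
have [->|//] := eqVneq i 1%N; have -> : (1%N == n) = false by lia.
by rewrite /= orbF.
Qed.

Lemma eq_w0r b i : (i <= n)%N -> (wd b i == w0r) = (i == n.-1) && (b == be).
Proof.
have n4 := dn_ge4 D; move=> iN; rewrite wd_eq //; last lia.
have [->|//] := eqVneq i n.-1.
by have -> : (n.-1 == 0%N) || (n.-1 == n) = false; [lia | rewrite orbF].
Qed.

Lemma rbe : (r == be) = false. Proof. by case: (be). Qed.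
Lemma ber : (be == r) = false. Proof. by case: (be). Qed.

Lemma rdes_be i : (i < n)%N -> rdes be (wd be i) = odd i.
Proof.
move=> iN; rewrite rdesE ?(ltnW iN) // (ltn_eqF iN) orbF.
by case: i iN => // i _; rewrite /= negbK; case: (be); case: (odd i).
Qed.

Lemma rdes_r i : (i < n)%N -> rdes be (wd r i.+1) = (odd i || (i.+1 == n)).
Proof.
by move=> iN; rewrite rdesE //=; case: (be); case: (odd i).
Qed.

Lemma rdes_w0 b : rdes b w0.
Proof. by have n4 := dn_ge4 D; rewrite rdesE // eqxx orbT andbT; lia. Qed.

Lemma w0V : w0^-1%g = w0.
Proof. by rewrite wdV; apply: wd_n. Qed.

Lemma w0rV : w0r^-1%g = w0r.
Proof.
have n4 := dn_ge4 D; have := odd_dn D; rewrite wdV -[n in odd n]prednK; last lia.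
by rewrite [odd _.+1]/= => /negbFE ->; rewrite addbF.
Qed.

Lemma eq_inv x z : z^-1%g = z -> (x^-1%g == z) = (x == z).
Proof. by move=> zV; rewrite -{1}zV (inj_eq invg_inj). Qed.

Lemma relH_right x y : relH RightSide x y = relH LeftSide x^-1%g y^-1%g.
Proof.
rewrite /relH !inE !(eq_inv _ (invg1 W)) !(eq_inv _ w0V) !(eq_inv _ (dgenV D r)).
by rewrite !(eq_inv _ w0rV) /= /rdes !invgK.
Qed.

Lemma closedG J : tabG D u ui be c ->
  (forall i, (i < n)%N -> wd be i \in J -> wd r i.+1 \in J) ->
  (1%g \in J -> wd be 1 \in J) ->
  (forall i, (i.+1 < n)%N -> wd r i.+1 \in J -> [/\ wd be i.+2 \in J,
     (0 < i)%N -> wd be i \in J & (2 < i)%N -> wd be i.-2 \in J]) ->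
  closedL J.
Proof.
move=> [T0 T1 T2 T3] J1 J2 J3 b x xJ; apply: inspan_Cop => //.
have [[i iN xE]|[i iN xE]] := wd_case D b x; rewrite xE in xJ *.
  by rewrite T0 ?ldes_wd //; apply/inspanZ/inspan_c.
have [bE|bE] : b = be \/ b = r by case: (b); case: (be); auto.
  rewrite bE in xJ *; case: i iN xJ {xE} => [|i] iN xJ.
    by rewrite T2; apply/inspan_c/J2.
  have [K1 K2 K3] := J3 _ iN xJ; rewrite T3 //; apply: inspanD; first apply: inspanD.
  - exact: inspan_c.
  - by case: ifP => i0; [apply/inspanZ/inspan_c/K2 | apply: inspan0].
  - by case: ifP => i0; [apply/inspan_c/K3 | apply: inspan0].
by rewrite bE negbK in xJ *; rewrite T1 //; apply/inspan_c/J1.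
Qed.

Lemma closedH J : tabH D u ui be c ->
  (forall x, x \in J -> (gen r * x)%g \in J) ->
  (1%g \in J -> wd be 1 \in J) ->
  (forall i, (i.+1 < n)%N -> wd r i.+1 \in J -> wd be i.+2 \in J /\
     ((2 < i)%N -> wd be i.-2 \in J)) ->
  closedL J.
Proof.
move=> [T0 T1 T2 T3] J1 J2 J3 b x xJ.
have [bE|->] : b = be \/ b = r by case: (b); case: (be); auto.
  subst b; apply: inspan_Cop => //.
  have [[i iN xE]|[i iN xE]] := wd_case D be x; rewrite xE in xJ *.
    by rewrite T0 ?ldes_wd //; apply/inspanZ/inspan_c.
  case: i iN xJ {xE} => [|i] iN xJ; first by rewrite T2; apply/inspan_c/J2.
  have [K1 K3] := J3 _ iN xJ; rewrite T3 //; apply: inspanD; first exact: inspan_c.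
  by case: ifP => i0; [apply/inspan_c/K3 | apply: inspan0].
by rewrite T1; apply/inspan_c/J1.
Qed.

Lemma closedE J : tabE D u ui c ->
  (forall b i, (i < n)%N -> wd (~~ b) i \in J ->
     wd b i.+1 \in J /\ ((1 < i)%N -> wd b i.-1 \in J)) ->
  closedL J.
Proof.
move=> [T0 T1] J1 b x xJ; apply: inspan_Cop => //.
have [[i iN xE]|[i iN xE]] := wd_case D b x; rewrite xE in xJ *.
  by rewrite T0 ?ldes_wd //; apply/inspanZ/inspan_c.
have [K1 K2] := J1 _ _ iN xJ; rewrite T1 //; apply: inspanD; first exact: inspan_c.
by case: ifP => i0; [apply/inspanZ/inspan_c/K2 | apply: inspan0].
Qed.

Lemma memJ1 b i : (i <= n)%N -> (wd b i \in ~: [set 1%g]) = (i != 0%N).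
Proof. by move=> iN; rewrite !inE eq_1. Qed.

Lemma memJw0 b i : (i <= n)%N -> (wd b i \in [set w0]) = (i == n).
Proof. by move=> iN; rewrite !inE eq_w0. Qed.

Lemma memJr b i : (i <= n)%N ->
  (wd b i \in ~: [set 1%g; gen r]) = (i != 0%N) && ~~ ((i == 1%N) && (b == r)).
Proof. by move=> iN; rewrite !inE eq_1 // eq_r // negb_or. Qed.

Lemma memJw0r b i : (i <= n)%N ->
  (wd b i \in [set w0; w0r]) = (i == n) || (i == n.-1) && (b == be).
Proof. by move=> iN; rewrite !inE eq_w0 // eq_w0r. Qed.

Lemma memJt b i : (i <= n)%N -> (wd b i \in [set w | rdes be w]) =
  (0 < i)%N && ((be == b (+) ~~ odd i) || (i == n)).
Proof. by move=> iN; rewrite inE rdesE. Qed.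

Lemma mem1 J : (1%g \in J) = (wd be 0 \in J). Proof. by []. Qed.

(** By the table, the indices occurring in the image of an element of one of these sets stay in that
    set. All but the last are stable under inversion and therefore bound right and two-sided cells
    as well. *)
Lemma closedG_sets : tabG D u ui be c -> [/\ closedL (~: [set 1%g]), closedL [set w0],
  closedL (~: [set 1%g; gen r]), closedL [set w0; w0r] & closedL [set w | rdes be w]].
Proof.
move=> T; have n4 := dn_ge4 D; have h1 : (1 <= n)%N by lia.
split; apply: closedG => // [i iN||i iN]; rewrite ?mem1;
  try (have h2 : (i <= n)%N by lia); try (have h3 : (i.+1 <= n)%N by lia);
  try (have h4 : (i.-2 <= n)%N by lia).
- by rewrite !memJ1 //; lia.
- by rewrite !memJ1 //; lia.
- by rewrite !memJ1 //; split; lia.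
- by rewrite !memJw0 //; lia.
- by rewrite !memJw0 //; lia.
- by rewrite !memJw0 //; lia.
- by rewrite !memJr // ?rbe ?ber ?eqxx; lia.
- by rewrite !memJr // ?rbe ?ber ?eqxx; lia.
- by rewrite !memJr // ?rbe ?ber ?eqxx; split; lia.
- by rewrite !memJw0r // ?rbe ?ber ?eqxx; lia.
- by rewrite !memJw0r // ?rbe ?ber ?eqxx; lia.
- by rewrite !memJw0r // ?rbe ?ber ?eqxx; split; lia.
- by rewrite !memJt // /= negbK; case: (be); case: (odd i); lia.
- by rewrite !memJt //; lia.
- rewrite !memJt // /= => H; have {H} oi : odd i by move: H; case: (be); case: (odd i); lia.
  split; first by rewrite oi; case: (be).
    by move=> ->; rewrite oi; case: (be).
  case: i oi {iN h2 h3 h4} => [|[|[|i]]] //= oi _; rewrite !negbK in oi; rewrite oi.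
  by case: (be).
Qed.

Lemma closedH_sets : tabH D u ui be c -> [/\ closedL (~: [set 1%g; gen r]),
  closedL [set w0; w0r] & closedL [set w | rdes be w]].
Proof.
move=> T; have n4 := dn_ge4 D; have h1 : (1 <= n)%N by lia.
split; apply: closedH => // [x||i iN]; rewrite ?mem1.
- have [[i iN ->]|[i iN ->]] := wd_case D r x; [rewrite gen_wd | rewrite -wdS];
    by rewrite !negbK !memJr ?(ltnW iN) // ?rbe ?ber ?eqxx; lia.
- by rewrite !memJr // ?rbe ?ber ?eqxx; lia.
- have h2 : (i <= n)%N by lia.
  have h4 : (i.-2 <= n)%N by lia.
  by rewrite !memJr ?(ltnW iN) // ?rbe ?ber ?eqxx; split; lia.
- have [[i iN ->]|[i iN ->]] := wd_case D r x; [rewrite gen_wd | rewrite -wdS];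
    by rewrite !negbK !memJw0r ?(ltnW iN) // ?rbe ?ber ?eqxx; lia.
- by rewrite !memJw0r // ?rbe ?ber ?eqxx; lia.
- have h2 : (i <= n)%N by lia.
  have h4 : (i.-2 <= n)%N by lia.
  by rewrite !memJw0r ?(ltnW iN) // ?rbe ?ber ?eqxx; split; lia.
- have on := odd_dn D.
  have [[i iN ->]|[i iN ->]] := wd_case D r x; [rewrite gen_wd | rewrite -wdS];
    rewrite !negbK !memJt ?(ltnW iN) //=; last by case: (be); case: (odd i); lia.
  case: (eqVneq i.+1 n) => [e|_]; last by case: (be); case E : (odd i); lia.
  move=> _; have oi : odd i by move: on; rewrite -e /= => /negbFE.
  have i0 : (0 < i)%N by lia.
  by rewrite i0 oi; case: (be).
- by rewrite !memJt //; lia.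
- have h2 : (i <= n)%N by lia.
  have h4 : (i.-2 <= n)%N by lia.
  rewrite !memJt ?(ltnW iN) // /= => H.
  have {H} oi : odd i by move: H; case: (be); case: (odd i); lia.
  split; first by rewrite oi; case: (be).
  case: i oi {iN h2 h4} => [|[|[|i]]] //= oi _; rewrite !negbK in oi; rewrite oi.
  by case: (be).
Qed.

Lemma inv1 J : (forall x, (x^-1%g \in J) = (x \in J)) ->
  closedL J -> forall k x y, gceq k x y -> (x \in J) = (y \in J).
Proof.
move=> JV cJ; have L x y : gceq LeftSide x y -> (x \in J) = (y \in J).
  by apply: closed_gceq => {}x {}y; apply: closedL_step.
case=> x y; first exact: L; first by rewrite gceq_right => /L; rewrite !JV.
by apply: closed_gceq => {}x {}y; apply: closed_two.
Qed.

Lemma inv_tail k x y : closedL [set w | rdes be w] -> gceq k x y -> tail k be x = tail k be y.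
Proof.
move=> cJ.
have L a a' : gceq LeftSide a a' -> rdes be a = rdes be a'.
  move=> e; have := @closed_gceq LeftSide [set w | rdes be w] a a' _ e.
  by rewrite !inE; apply=> {e}a {}a'; apply: closedL_step.
by case: k => //=; [apply: L | rewrite gceq_right => /L; rewrite /rdes !invgK].
Qed.

Lemma gceq_relG k x y : tabG D u ui be c -> gceq k x y -> relG k x y.
Proof.
move=> /closedG_sets[c1 c2 c3 c4 c5] e.
have e1 := inv1 _ c1 e; have e2 := inv1 _ c2 e; have e3 := inv1 _ c3 e.
have e4 := inv1 _ c4 e; have e5 := inv_tail c5 e.
have I1 z : (z^-1%g == 1%g) = (z == 1%g) := eq_inv z (invg1 W).
have I2 z := eq_inv z w0V; have I3 z := eq_inv z (dgenV D r).
have I4 z := eq_inv z w0rV.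
move: e1 e2 e3 e4; rewrite !inE => E1 E2 E3 E4.
have {}E1 : (x == 1%g) = (y == 1%g) by apply: negb_inj; apply: E1 => z; rewrite !inE I1.
have {}E2 : (x == w0) = (y == w0) by apply: E2 => z; rewrite !inE I2.
have {}E3 : ~~ ((x == 1%g) || (x == gen r)) = ~~ ((y == 1%g) || (y == gen r)).
  by apply: E3 => z; rewrite !inE I1 I3.
have {}E4 : (x == w0) || (x == w0r) = (y == w0) || (y == w0r).
  by apply: E4 => z; rewrite !inE I2 I4.
rewrite /relG E1 E2 e5 !eqxx /= andbT; move: E3 E4; rewrite E1 E2.
have n4 := dn_ge4 D; have h1 : (n.-1 <= n)%N by lia.
(* The closed sets only detect [1] or [gen r] together and [w0] or [w0r] together; since the members
   of each pair are distinct, the single elements can be recovered. *)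
have r1 z : z == 1%g -> (z == gen r) = false.
  by move/eqP => ->; rewrite -[1%g]/(wd be 0) eq_r.
have w1 z : z == w0 -> (z == w0r) = false.
  by move/eqP => ->; rewrite eq_sym eq_w0 //; lia.
case y1 : (y == 1%g); case y2 : (y == w0); rewrite /= ?(r1 _ y1) ?(w1 _ y2).
- by rewrite (r1 x) ?(w1 x) ?E1 ?E2.
- by rewrite (r1 x) ?E1 // => _ ->; rewrite !eqxx.
- by rewrite (w1 x) ?E2 // => /negb_inj ->; rewrite !eqxx.
- by move=> /negb_inj -> ->; rewrite !eqxx.
Qed.

Lemma gceq_relH k x y : tabH D u ui be c -> gceq k x y -> relH k x y.
Proof.
move=> /closedH_sets[c3 c4 c5] e.
have E5 := inv_tail c5 e.
have I1 z : (z^-1%g == 1%g) = (z == 1%g) := eq_inv z (invg1 W).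
have I2 z := eq_inv z w0V; have I3 z := eq_inv z (dgenV D r).
have I4 z := eq_inv z w0rV.
have E3 : (x \in ~: [set 1%g; gen r]) = (y \in ~: [set 1%g; gen r]).
  by apply: inv1 c3 _ _ _ e => z; rewrite !inE I1 I3.
have E4 : (x \in [set w0; w0r]) = (y \in [set w0; w0r]).
  by apply: inv1 c4 _ _ _ e => z; rewrite !inE I2 I4.
rewrite !finset.in_setC in E3; rewrite /relH E4 E5 !eqxx !andbT.
by rewrite (negb_inj E3).
Qed.

End Dominant.

Lemma closedE_sets : tabE D u ui c ->
  [/\ closedL (~: [set 1%g]), closedL [set w0] & closedL [set w | rdes true w]].
Proof.
move=> T; have n4 := dn_ge4 D.
split; apply: closedE => // b i iN; have h2 : (i.-1 <= n)%N by lia.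
- by rewrite !memJ1 ?(ltnW iN) //; lia.
- by rewrite !memJw0 ?(ltnW iN) //; lia.
- rewrite !memJt ?(ltnW iN) // => H; split.
    by move: H; rewrite /=; case: b; case: (odd i); lia.
  by case: i iN H h2 => [|[|i]] // iN H h2 _; move: H; rewrite /= ; case: b; case: (odd i); lia.
Qed.

Lemma gceq_relE k x y : tabE D u ui c -> gceq k x y -> relE k x y.
Proof.
move=> /closedE_sets[c1 c2 c5] e.
have I1 z : (z^-1%g == 1%g) = (z == 1%g) := eq_inv z (invg1 W).
have I2 z := eq_inv z w0V.
have E1 : (x \in ~: [set 1%g]) = (y \in ~: [set 1%g]).
  by apply: inv1 c1 _ _ _ e => z; rewrite !inE I1.
have E2 : (x \in [set w0]) = (y \in [set w0]).
  by apply: inv1 c2 _ _ _ e => z; rewrite !inE I2.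
have E5 := inv_tail c5 e.
rewrite !inE in E1 E2; rewrite /relE (negb_inj E1) E2 E5 !eqxx //.
Qed.

End CellsOfBasis.

(** * Equivalences inside the predicted cells *)

Section CellsConnected.
Local Open Scope ring_scope.
Context (W : finGroupType) (D : dihedral W) (R : comNzRingType) (u ui : bool -> R).
Local Notation gen := (dgen D).
Local Notation n := (dn D).
Local Notation len := (cox_len (dS D)).
Local Notation rdes := (rdes D).
Local Notation wd := (wd D).
Local Notation H := {ffun W -> R^o}.
Local Notation flip := (@flip W R).
Local Notation w0 := (w0 D).
Context (u_ui : forall b, u b * ui b = 1).
Context (c : W -> H).
Context (c_tri : tri len (fun w x => c w x)).
Context (c_flip : forall w, flip (c w) = c w^-1%g).
Local Notation gcoord := (gcoord c).
Local Notation gcle := (gcle D u ui c).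
Local Notation gceq := (gceq D u ui c).
Implicit Types (h l : H) (b : bool) (w x y : W) (k : side) (J : {set W}).

Lemma gcoord_cE w x : gcoord (c w) x = (x == w)%:R.
Proof. exact: (gcoord_c c_tri). Qed.

Let gcD h l x : gcoord (h + l) x = gcoord h x + gcoord l x := gcoordD c_tri h l x.
Let gcZ (a : R) h x : gcoord (a *: h) x = a * gcoord h x := gcoordZ c_tri a h x.
Let gc0 x : gcoord 0 x = 0 := gcoord0 c_tri x.

Lemma gcle_trans k x y z : gcle k x y -> gcle k y z -> gcle k x z.
Proof. exact: connect_trans. Qed.

Lemma unit_neq0 (a a' : R) : a * a' = 1 -> a != 0.
Proof. by apply: contra_eq_neq => ->; rewrite mul0r eq_sym oner_eq0. Qed.

Lemma wd_neq b b' i j : (i <= n)%N -> (j <= n)%N -> i != j -> (wd b i == wd b' j) = false.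
Proof. by move=> iN jN ij; rewrite wd_eq // (negPf ij). Qed.

Section Dominant.
Context (be : bool).
Local Notation r := (~~ be).
Local Notation w0r := (wd be n.-1).

(** Among the elements that are not special, a left cell is determined by the right descent at
    [gen be]; these two words realise both values. *)
Definition rep x : W := wd be (if rdes be x then 1 else 2).

Definition special x : bool := [|| x == 1%g, x == w0, x == gen r | x == w0r].

Lemma wd_rest x : ~~ special x -> exists i, (0 < i < n.-1)%N /\
  (x = wd be i \/ x = wd r i.+1).
Proof.
rewrite !negb_or => /and4P[x1 x0 xr xw]; have n4 := dn_ge4 D.
have h1 : (1 <= n)%N by lia.
have [[i iN xE]|[i iN xE]] := wd_case D be x; rewrite xE in x1 x0 xr xw *.
  exists i.+1; split; last by left.
  by move: x0 xw; rewrite eq_w0 // eq_w0r // eqxx; lia.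
move: x1 xr; rewrite eq_1 ?eq_r // ?(ltnW iN) // eqxx.
case: i iN {xE x0 xw} => [|[|i]] // iN _ _; exists i.+1; split; last by right.
lia.
Qed.

Section Chain.
Context (P1 : forall i, (0 < i < n.-1)%N -> gceq LeftSide (wd be i) (wd r i.+1)).
Context (P2 : forall i, (0 < i)%N -> (i.+2 < n.-1)%N -> gceq LeftSide (wd be i) (wd be i.+2)).

(** [P1] turns a word starting with [r] into a shorter one starting with [be], and [P2] shortens the
    latter by two letters. *)
Lemma to_rep x : ~~ special x -> gceq LeftSide x (rep x).
Proof.
have n4 := dn_ge4 D.
have chain i : (0 < i < n.-1)%N -> gceq LeftSide (wd be i) (wd be (if odd i then 1 else 2)).
  have [N] := ubnP i; elim: N i => // N IH [|[|[|i]]] // lt iN; try exact: gceq_refl.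
  rewrite gceq_sym; apply: (gceq_trans (y := wd be i.+1)); last by apply: P2; lia.
  by rewrite gceq_sym /= negbK; apply: (IH i.+1); lia.
case/wd_rest => i [iN [->|->]]; rewrite /rep.
  by rewrite rdes_be; [apply: chain | lia].
rewrite rdes_r; last lia.
have -> : (i.+1 == n) = false by lia.
by rewrite orbF; apply: gceq_trans (chain _ iN); rewrite gceq_sym P1.
Qed.

(** The two representatives have the same first letter and are right equivalent; this joins two left
    cells into one two-sided cell. *)
Lemma rep12 : gceq TwoSided (wd be 1) (wd be 2).
Proof.
have n4 := dn_ge4 D; apply: (@gceq_two _ _ _ _ _ _ RightSide).
rewrite gceq_right // !wdV.
have -> : be (+) ~~ odd 1 = be by case: (be).
have -> : be (+) ~~ odd 2 = r by case: (be).
by apply: P1; lia.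
Qed.

Lemma lower_rest k x y : ~~ special x -> ~~ special y ->
  tail D k be x = tail D k be y -> gceq k x y.
Proof.
have L a a' : ~~ special a -> ~~ special a' -> rdes be a = rdes be a' -> gceq LeftSide a a'.
  move=> sa sa' E; apply: (gceq_trans (to_rep sa)).
  by rewrite gceq_sym /rep E; apply: to_rep.
have sV a : special a^-1%g = special a.
  by rewrite /special !(eq_inv _ (invg1 W)) !(eq_inv _ (w0V D)) !(eq_inv _ (dgenV D r)) !(eq_inv _ (w0rV D be)).
case: k => /= sx sy E; first exact: L.
  by rewrite gceq_right //; apply: L; rewrite ?sV // /rdes !invgK.
have RX z : ~~ special z -> gceq TwoSided z (wd be 1).
  move=> sz; apply: (gceq_trans (y := rep z)); first exact/gceq_two/to_rep.
  by rewrite /rep; case: ifP => _; [exact: gceq_refl | rewrite gceq_sym rep12].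
by apply: gceq_trans (RX _ sx) _; rewrite gceq_sym RX.
Qed.

End Chain.

Lemma special_eq x y : special x ->
  [&& (x == 1%g) == (y == 1%g), (x == w0) == (y == w0), (x == gen r) == (y == gen r) &
      (x == w0r) == (y == w0r)] -> x = y.
Proof.
case/or4P => /eqP xE /and4P[/eqP e1 /eqP e2 /eqP e3 /eqP e4]; rewrite xE;
  apply/esym/eqP; [rewrite -e1|rewrite -e2|rewrite -e3|rewrite -e4]; by rewrite xE eqxx.
Qed.

Lemma special_congr x y :
  [&& (x == 1%g) == (y == 1%g), (x == w0) == (y == w0), (x == gen r) == (y == gen r) &
      (x == w0r) == (y == w0r)] -> special x = special y.
Proof. by case/and4P => /eqP e1 /eqP e2 /eqP e3 /eqP e4; rewrite /special e1 e2 e3 e4. Qed.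

(** Each nonzero coefficient of the table is a step of the preorder. The hypothesis on the sum of
    the ratios supplies the step from [wd r i.+1] back to [wd be i]. *)
Lemma gceqG k : tabG D u ui be c -> u r * ui be + u be * ui r != 0 ->
  gceq k =2 relG D be k.
Proof.
move=> T zeta x y; apply/idP/idP; first exact: (gceq_relG c_tri c_flip).
have n4 := dn_ge4 D; have [T0 T1 T2 T3] := T.
have down i : (i.+1 < n)%N -> (0 < i)%N -> gcle LeftSide (wd be i) (wd r i.+1).
  move=> iN i0; apply: (@gcle_Cop _ _ _ _ _ _ be); rewrite T3 // i0 !gcD gcZ.
  rewrite !gcoord_cE eqxx mulr1 wd_neq //; try lia.
  case: ifP => _; rewrite ?gcoord_cE ?gc0 // ?wd_neq ?addr0 ?add0r //; lia.
have up i : (i < n)%N -> gcle LeftSide (wd r i.+1) (wd be i).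
  by move=> iN; apply: (@gcle_Cop _ _ _ _ _ _ r); rewrite T1 // gcoord_cE eqxx oner_eq0.
have up2 i : (i.+1 < n)%N -> gcle LeftSide (wd be i.+2) (wd r i.+1).
  move=> iN; apply: (@gcle_Cop _ _ _ _ _ _ be); rewrite T3 // !gcD.
  rewrite gcoord_cE eqxx.
  have -> : gcoord (if (0 < i)%N then (u r * ui be + u be * ui r) *: c (wd be i) else 0) (wd be i.+2) = 0.
    by case: ifP => _; rewrite ?gc0 // gcZ gcoord_cE wd_neq ?mulr0 //; lia.
  have -> : gcoord (if (2 < i)%N then c (wd be i.-2) else 0) (wd be i.+2) = 0.
    by case: ifP => _; rewrite ?gc0 // gcoord_cE wd_neq //; lia.
  by rewrite !addr0 oner_eq0.
have down2 i : (2 < i)%N -> (i.+1 < n)%N -> gcle LeftSide (wd be i.-2) (wd r i.+1).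
  move=> i2 iN; apply: (@gcle_Cop _ _ _ _ _ _ be); rewrite T3 // i2 !gcD.
  have -> : gcoord (if (0 < i)%N then (u r * ui be + u be * ui r) *: c (wd be i) else 0) (wd be i.-2) = 0.
    by case: ifP => _; rewrite ?gc0 // gcZ gcoord_cE wd_neq ?mulr0 //; lia.
  rewrite !gcoord_cE eqxx wd_neq ?add0r ?oner_eq0 //; lia.
have P1 i : (0 < i < n.-1)%N -> gceq LeftSide (wd be i) (wd r i.+1).
  by move=> iN; rewrite /gceq up ?down //; lia.
have P2 i : (0 < i)%N -> (i.+2 < n.-1)%N -> gceq LeftSide (wd be i) (wd be i.+2).
  move=> i0 iN; rewrite /gceq (gcle_trans (down2 i.+2 _ _) (up _ _)) ?(gcle_trans (up2 _ _) (up _ _)) //; lia.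
case/and5P => e1 e2 e3 e4 /eqP e5.
have E : [&& (x == 1%g) == (y == 1%g), (x == w0) == (y == w0), (x == gen r) == (y == gen r) &
      (x == w0r) == (y == w0r)] by rewrite e1 e2 e3 e4.
have [sx|sx] := boolP (special x); first by rewrite (special_eq sx E) gceq_refl.
by apply: lower_rest => //; rewrite -(special_congr E).
Qed.

Lemma gceqH k : tabH D u ui be c -> gceq k =2 relH D be k.
Proof.
move=> T x y; apply/idP/idP; first exact: (gceq_relH c_tri c_flip).
have n4 := dn_ge4 D; have [T0 T1 T2 T3] := T.
(* [gen r] acts by permuting the basis, so it preserves every left cell. *)
have lr z : gcle LeftSide (gen r * z)%g z.
  by apply: (@gcle_Lop _ _ _ _ _ _ r); rewrite T1 gcoord_cE eqxx oner_eq0.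
have lr2 z : gceq LeftSide (gen r * z)%g z.
  by rewrite /gceq lr -{1}[z](genK D r) lr.
have ER i : wd r i.+1 = (gen r * wd be i)%g by rewrite wdS negbK.
have P1 i : (0 < i < n.-1)%N -> gceq LeftSide (wd be i) (wd r i.+1).
  by move=> _; rewrite gceq_sym ER.
have up2 i : (i.+1 < n)%N -> gcle LeftSide (wd be i.+2) (wd r i.+1).
  move=> iN; apply: (@gcle_Cop _ _ _ _ _ _ be); rewrite T3 // gcD.
  rewrite gcoord_cE eqxx.
  have -> : gcoord (if (2 < i)%N then c (wd be i.-2) else 0) (wd be i.+2) = 0.
    by case: ifP => _; rewrite ?gc0 // gcoord_cE wd_neq //; lia.
  by rewrite !addr0 oner_eq0.
have down2 i : (2 < i)%N -> (i.+1 < n)%N -> gcle LeftSide (wd be i.-2) (wd r i.+1).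
  move=> i2 iN; apply: (@gcle_Cop _ _ _ _ _ _ be); rewrite T3 // i2 gcD.
  rewrite !gcoord_cE eqxx wd_neq ?add0r ?oner_eq0 //; lia.
have P2 i : (0 < i)%N -> (i.+2 < n.-1)%N -> gceq LeftSide (wd be i) (wd be i.+2).
  move=> i0 iN; have up j : gcle LeftSide (wd r j.+1) (wd be j) by rewrite ER.
  rewrite /gceq (gcle_trans (down2 i.+2 _ _) (up _)) ?(gcle_trans (up2 _ _) (up _)) //; lia.
have w0E : w0 = (gen r * w0r)%g.
  have -> : w0 = wd r n by apply: wd_n.
  by rewrite -[n in LHS]prednK ?ER //; lia.
have gr1 : gen r = (gen r * 1)%g by rewrite mulg1.
have sp2 k' z z' : (z \in [set 1%g; gen r]) -> (z' \in [set 1%g; gen r]) -> gceq k' z z'.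
  have S a a' : (a \in [set 1%g; gen r]) -> (a' \in [set 1%g; gen r]) -> gceq LeftSide a a'.
    rewrite !inE => /orP[] /eqP -> /orP[] /eqP ->; rewrite ?gceq_refl //.
      by rewrite gceq_sym gr1.
    by rewrite gr1.
  have SV a : (a^-1%g \in [set 1%g; gen r]) = (a \in [set 1%g; gen r]).
    by rewrite !inE !(eq_inv _ (invg1 W)) !(eq_inv _ (dgenV D r)).
  move=> zs zs'; case: k' => /=; first exact: S.
    by rewrite gceq_right // S ?SV.
  by apply: (@gceq_two _ _ _ _ _ _ LeftSide); apply: S.
have sw2 k' z z' : (z \in [set w0; w0r]) -> (z' \in [set w0; w0r]) -> gceq k' z z'.
  have S a a' : (a \in [set w0; w0r]) -> (a' \in [set w0; w0r]) -> gceq LeftSide a a'.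
    rewrite !inE => /orP[] /eqP -> /orP[] /eqP ->; rewrite ?gceq_refl //.
      by rewrite w0E.
    by rewrite w0E gceq_sym.
  have SV a : (a^-1%g \in [set w0; w0r]) = (a \in [set w0; w0r]).
    by rewrite !inE !(eq_inv _ (w0V D)) !(eq_inv _ (w0rV D be)).
  move=> zs zs'; case: k' => /=; first exact: S.
    by rewrite gceq_right // S ?SV.
  by apply: (@gceq_two _ _ _ _ _ _ LeftSide); apply: S.
case/and3P => /eqP e1 /eqP e2 /eqP e5.
have [s1|s1] := boolP (x \in [set 1%g; gen r]); first by apply: sp2 => //; rewrite -e1.
have [s2|s2] := boolP (x \in [set w0; w0r]); first by apply: sw2 => //; rewrite -e2.
have sE z : special z = (z \in [set 1%g; gen r]) || (z \in [set w0; w0r]).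
  by rewrite /special !inE; do 4 case: (_ == _).
by apply: lower_rest => //; rewrite sE -?e1 -?e2 negb_or s1 s2.
Qed.

End Dominant.

Lemma gceqE k : tabE D u ui c -> gceq k =2 relE D k.
Proof.
move=> T x y; apply/idP/idP; first exact: (gceq_relE c_tri c_flip).
have n4 := dn_ge4 D; have [T0 T1] := T.
have up b i : (i < n)%N -> gcle LeftSide (wd b i.+1) (wd (~~ b) i).
  move=> iN; apply: (@gcle_Cop _ _ _ _ _ _ b); rewrite T1 // gcD gcoord_cE eqxx.
  have -> : gcoord (if (1 < i)%N then (u b * ui (~~ b)) *: c (wd b i.-1) else 0) (wd b i.+1) = 0.
    by case: ifP => _; rewrite ?gc0 // gcZ gcoord_cE wd_neq ?mulr0 //; lia.
  by rewrite addr0 oner_eq0.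
have down b i : (1 < i)%N -> (i < n)%N -> gcle LeftSide (wd b i.-1) (wd (~~ b) i).
  move=> i1 iN; apply: (@gcle_Cop _ _ _ _ _ _ b); rewrite T1 // i1 gcD gcZ.
  rewrite !gcoord_cE eqxx mulr1 wd_neq ?add0r; try lia.
  apply: (@unit_neq0 _ (u (~~ b) * ui b)).
  by transitivity ((u b * ui b) * (u (~~ b) * ui (~~ b))); [ring | rewrite !u_ui mulr1].
have adj b i : (0 < i < n.-1)%N -> gceq LeftSide (wd b i) (wd (~~ b) i.+1).
  move=> iN; have h : (i < n)%N by lia.
  have := up (~~ b) i h; rewrite negbK /gceq => ->; rewrite andbT.
  by apply: (down b i.+1); lia.
have P2' b i : (0 < i)%N -> (i.+1 < n.-1)%N -> gceq LeftSide (wd b i) (wd b i.+2).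
  move=> i0 iN; apply: (gceq_trans (y := wd (~~ b) i.+1)); first by apply: adj; lia.
  by have := adj (~~ b) i.+1; rewrite negbK; apply; lia.
have P2 i : (0 < i)%N -> (i.+2 < n.-1)%N -> gceq LeftSide (wd true i) (wd true i.+2).
  by move=> i0 iN; apply: P2' => //; lia.
have P1 i : (0 < i < n.-1)%N -> gceq LeftSide (wd true i) (wd (~~ true) i.+1) by apply: adj.
(* [gen false] and [wd true n.-1] are special for the dominated position but not for equal weights,
   so each is linked to its representative separately. *)
have all_rep z : z != 1%g -> z != w0 -> gceq LeftSide z (rep true z).
  move=> z1 z0; have [sz|/(to_rep P1 P2)//] := boolP (special true z).
  case/or4P: sz; rewrite ?(negPf z1) ?(negPf z0) // => /eqP ->; rewrite /rep.
    rewrite -[dgen D _]mulg1 -[(_ * 1)%g]/(wd (~~ true) 1) rdes_r; last lia.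
    have -> : odd 0 || (1%N == n) = false by rewrite /=; lia.
    by apply: (adj false); lia.
  rewrite rdes_be; last lia.
  have on : odd n.-1 by have := odd_dn D; rewrite -[n in odd n]prednK /=; [move/negbFE | lia].
  rewrite on; have nE : n.-1 = (n.-1.-2).+2 by lia.
  rewrite nE gceq_sym; have n3 : (0 < n.-1.-2)%N by lia.
  apply: (gceq_trans (y := wd true n.-1.-2)); last by apply: P2'; lia.
  have on2 : odd n.-1.-2 by move: on; rewrite {1}nE /= negbK.
  case: (eqVneq n.-1.-2 1%N) => [->|ne]; first exact: gceq_refl.
  have ns : ~~ special true (wd true n.-1.-2).
    rewrite /special eq_1 ?eq_w0 ?eq_r ?eq_w0r //; try lia.
  have := to_rep P1 P2 ns; rewrite gceq_sym /rep rdes_be ?on2 //; lia.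
have L z z' : z != 1%g -> z != w0 -> z' != 1%g -> z' != w0 -> rdes true z = rdes true z' ->
    gceq LeftSide z z'.
  move=> a1 a2 b1 b2 E; apply: (gceq_trans (all_rep _ a1 a2)).
  by rewrite gceq_sym /rep E; apply: all_rep.
case/and3P => /eqP e1 /eqP e2 /eqP e5.
have [x1|x1] := eqVneq x 1%g.
  have /eqP -> : y == 1%g by rewrite -e1 x1.
  by rewrite x1 gceq_refl.
have [x2|x2] := eqVneq x w0.
  have /eqP -> : y == w0 by rewrite -e2 x2.
  by rewrite x2 gceq_refl.
have y1 : y != 1%g by rewrite -e1.
have y2 : y != w0 by rewrite -e2.
case: k e5 => /= e5; first exact: L.
  have I z : (z^-1%g == 1%g) = (z == 1%g) := eq_inv z (invg1 W).
  have I0 z := eq_inv z (w0V D).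
  by rewrite gceq_right //; apply: L; rewrite ?I ?I0 // /rdes !invgK.
have RX z : z != 1%g -> z != w0 -> gceq TwoSided z (wd true 1).
  move=> z1 z2; apply: (gceq_trans (y := rep true z)); first exact/gceq_two/all_rep.
  by rewrite /rep; case: ifP => _; [exact: gceq_refl | rewrite gceq_sym (rep12 P1)].
by apply: gceq_trans (RX _ x1 x2) _; rewrite gceq_sym RX.
Qed.

Lemma gceqZ k x y : tabZ D u ui c -> gceq k x y.
Proof.
move=> T.
have lr b z : gcle LeftSide (gen b * z)%g z.
  by apply: (@gcle_Lop _ _ _ _ _ _ b); rewrite T gcoord_cE eqxx oner_eq0.
have L1 z : gceq LeftSide z 1%g.
  have [b [i [_ ->]]] := wd_exists D z; elim: i b => [|i IH] b; first exact: gceq_refl.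
  apply: (gceq_trans (y := wd (~~ b) i)) => //.
  by rewrite /gceq wdS lr -{1}[wd _ i](genK D b) lr.
have L z z' : gceq LeftSide z z' by apply: (gceq_trans (L1 z)); rewrite gceq_sym.
by case: k; [exact: L | rewrite gceq_right | apply: (@gceq_two _ _ _ _ _ _ LeftSide)].
Qed.

End CellsConnected.

(** * Characters of left cells *)

Section Trace.
Local Open Scope ring_scope.
Context (T : finType) (d : T -> nat) (F : comNzRingType).
Context (a a' : T -> T -> F) (a_tri : tri d a) (a'_tri : tri d a').
(* [M] and [M'] are the matrices of one operator in the bases [a] and [a'], and
   [P], [Q] those of the change of basis; [J] spans the same subspace in both. *)
Context (J : {set T}) (f : T -> T) (M M' : T -> T -> F).
Context (aM : forall x y, \sum_z M z x * a z y = a x (f y)).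
Context (a'M : forall x y, \sum_z M' z x * a' z y = a' x (f y)).
Context (MJ : forall x z, x \in J -> z \notin J -> M z x = 0).
Context (P Q : T -> T -> F).
Context (aP : forall x y, a' x y = \sum_z P z x * a z y).
Context (a'Q : forall x y, a x y = \sum_z Q z x * a' z y).
Context (PJ : forall x z, x \in J -> z \notin J -> P z x = 0).
Context (QJ : forall x z, x \in J -> z \notin J -> Q z x = 0).

Lemma PQ z v : \sum_x P z x * Q x v = (z == v)%:R.
Proof.
apply/eqP; rewrite -subr_eq0; apply/eqP; move: z; apply: (tri_free a_tri) => y.
under eq_bigr do rewrite mulrBl.
rewrite sumrB [X in _ - X](bigD1 v) //= eqxx mul1r [X in _ - (_ + X)]big1 ?addr0; last first.
  by move=> z /negPf ->; rewrite mul0r.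
apply/eqP; rewrite subr_eq0; apply/eqP; rewrite [RHS]a'Q.
under eq_bigr do rewrite mulr_suml.
rewrite exchange_big /=; apply: eq_bigr => x _; rewrite aP mulr_sumr.
by apply: eq_bigr => z _; rewrite mulrAC mulrC mulrA.
Qed.

Lemma M'E w x : M' w x = \sum_z \sum_v Q w v * M v z * P z x.
Proof.
apply/eqP; rewrite -subr_eq0; apply/eqP; move: w; apply: (tri_free a'_tri) => y.
under eq_bigr do rewrite mulrBl.
rewrite sumrB a'M aP; apply/eqP; rewrite subr_eq0; apply/eqP.
under eq_bigr => z _ do rewrite -aM mulr_sumr.
under [RHS]eq_bigr do rewrite mulr_suml.
rewrite [RHS]exchange_big /=; apply: eq_bigr => z _.
under [RHS]eq_bigr do rewrite mulr_suml.
rewrite [RHS]exchange_big /=; apply: eq_bigr => v _.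
rewrite a'Q !mulr_sumr; apply: eq_bigr => w _; ring.
Qed.

(** The matrices are conjugate, [M' = Q M P]. The hypotheses on [J] confine the sums to that block,
    where [P] and [Q] cancel under the trace. *)
Lemma trace_basis : \sum_(x in J) M x x = \sum_(x in J) M' x x.
Proof.
under [RHS]eq_bigr do rewrite M'E.
have -> : \sum_(x in J) \sum_z \sum_v Q x v * M v z * P z x =
          \sum_(x in J) \sum_(z in J) \sum_(v in J) Q x v * M v z * P z x.
  apply: eq_bigr => x xJ; rewrite (bigID (mem J)) /= [X in _ + X]big1 ?addr0.
    apply: eq_bigr => z zJ; rewrite (bigID (mem J)) /= [X in _ + X]big1 ?addr0 //.
    by move=> v vJ; rewrite (MJ zJ) // mulr0 mul0r.
  by move=> z zJ; apply: big1 => v _; rewrite (PJ xJ) // mulr0.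
rewrite [RHS]exchange_big /=; under [RHS]eq_bigr do rewrite exchange_big /=.
apply: eq_bigr => z zJ.
have E v : v \in J -> \sum_(x in J) Q x v * M v z * P z x = M v z * (z == v)%:R.
  move=> vJ; rewrite -PQ mulr_sumr [RHS](bigID (mem J)) /= [X in _ + X]big1 ?addr0.
    by apply: eq_bigr => x _; ring.
  by move=> x xJ; rewrite (QJ vJ) // !mulr0.
rewrite [RHS](eq_bigr (fun v => M v z * (z == v)%:R)) // (bigD1 z) //= eqxx mulr1.
by rewrite big1 ?addr0 // => v /andP[_ vz]; rewrite eq_sym (negPf vz) mulr0.
Qed.

End Trace.

Section Characters.
Local Open Scope ring_scope.
Context (W : finGroupType) (D : dihedral W) (R : comNzRingType) (u ui : bool -> R).
Local Notation gen := (dgen D).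
Local Notation n := (dn D).
Local Notation len := (cox_len (dS D)).
Local Notation rdes := (rdes D).
Local Notation wd := (wd D).
Local Notation H := {ffun W -> R^o}.
Local Notation Lop := (Lop D u ui).
Local Notation Rop := (Rop D u ui).
Local Notation Cop := (Cop D u ui).
Local Notation mul := (hmul D u ui).
Local Notation gT := (gT R).
Local Notation flip := (@flip W R).
Context (u_ui : forall b, u b * ui b = 1).
Context (c : W -> H).
Context (c_tri : tri len (fun w x => c w x)).
Context (c_flip : forall w, flip (c w) = c w^-1%g).
Local Notation gcoord := (gcoord c).
Local Notation inspan := (inspan c).
Local Notation closedL := (closedL D u ui c).
Implicit Types (h l : H) (b : bool) (w x y : W) (J K : {set W}).
Context (aug : {rmorphism R -> rat}).
Context (aug_ui : forall b, aug (ui b) = aug (u b)).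

(** For a left cell this is the trace of [T_w] on the cell module. Allowing any subset makes it
    additive, so that cell characters can be obtained as differences. *)
Definition Sx K w : rat := \sum_(x in K) aug (gcoord (mul (gT w) (c x)) x).

Lemma SxU K K' w : [disjoint K & K'] -> Sx (K :|: K') w = Sx K w + Sx K' w.
Proof. by move=> dis; rewrite /Sx -bigU //; apply: eq_bigl => x; rewrite !inE. Qed.

Lemma SxD K K' w : K' \subset K -> Sx (K :\: K') w = Sx K w - Sx K' w.
Proof.
move=> sub; have E : K = (K :\: K') :|: K'.
  by apply/setP => x; rewrite !inE; case: (boolP (x \in K')) => [/(fintype.subsetP sub) -> //|_]; rewrite orbF.
have -> : Sx K w = Sx ((K :\: K') :|: K') w by rewrite -E.
rewrite SxU ?addrK // disjoint_sym finset.disjoints_subset.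
by apply/fintype.subsetP => x; rewrite !inE => ->.
Qed.

Lemma mul_wdS b i h : (i < n)%N ->
  mul (gT (wd b i.+1)) h = Lop b (mul (gT (wd (~~ b) i)) h).
Proof. by move=> iN; rewrite wdS -mul_Lop Lop_T ldes_wdN // addr0. Qed.

Section Monomial.
Context (K J : {set W}) (lam : bool -> R) (pi : bool -> W -> W).
Context (cJ : closedL J) (dKJ : [disjoint K & J]).
Context (piK : forall b x, x \in K -> pi b x \in K).
Context (mono : forall b x, x \in K -> inspan J (Lop b (c x) - lam b *: c (pi b x))).

Fixpoint piW b i x : W := if i is i'.+1 then pi b (piW (~~ b) i' x) else x.

Lemma piW_K b i x : x \in K -> piW b i x \in K.
Proof. by elim: i b => [|i IH] b //= xK; apply/piK/IH. Qed.

(** Modulo the ideal spanned by [J], each generator sends a basis element of [K] to a multiple of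
    another, and so does every word. One- and two-element cells are of this kind. *)
Lemma monomial b i x : (i <= n)%N -> x \in K ->
  inspan J (mul (gT (wd b i)) (c x) - mon lam b i *: c (piW b i x)).
Proof.
elim: i b => [|i IH] b iN xK.
  by rewrite hmul1l scale1r subrr; apply: inspan0.
rewrite mul_wdS //= .
set A := mul _ _; pose B := c (piW (~~ b) i x).
have -> : Lop b A - (lam b * mon lam (~~ b) i) *: c (pi b (piW (~~ b) i x)) =
    Lop b (A - mon lam (~~ b) i *: B) +
    mon lam (~~ b) i *: (Lop b B - lam b *: c (pi b (piW (~~ b) i x))).
  rewrite [Lop b (A - _)]linearB /= [Lop b (_ *: B)]linearZ /= scalerBr scalerA.
  by rewrite [lam b * _]mulrC addrA subrK.
apply: inspanD => //; first by apply: closedL_Lop => //; apply: IH => //; exact: ltnW.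
by apply: inspanZ => //; apply/mono/piW_K.
Qed.

Lemma Sx_monomial b i : (i <= n)%N -> Sx K (wd b i) =
  \sum_(x in K) mon (fun b => aug (lam b)) b i * (x == piW b i x)%:R.
Proof.
move=> iN; apply: eq_bigr => x xK.
have xJ : x \notin J by rewrite (disjointFr dKJ xK).
have := monomial b iN xK xJ.
rewrite -scaleNr (gcoordD c_tri) (gcoordZ c_tri) (gcoord_c c_tri) mulNr.
move=> /eqP; rewrite subr_eq0 => /eqP ->.
rewrite rmorphM; congr (_ * _); last by case: (_ == _); rewrite ?rmorph1 ?rmorph0.
by elim: (i) (b) => [|j IH] b' /=; rewrite ?rmorph1 // rmorphM IH.
Qed.

End Monomial.

Lemma Sx_single x J (lam : bool -> R) b i : closedL J -> x \notin J ->
  (forall b, inspan J (Lop b (c x) - lam b *: c x)) -> (i <= n)%N ->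
  Sx [set x] (wd b i) = mon (fun b => aug (lam b)) b i.
Proof.
move=> cJ xJ E iN; rewrite (@Sx_monomial _ J lam (fun _ => id)) //; last 2 first.
- by rewrite disjoints1.
- by move=> b' y /set1P ->.
rewrite big_set1; have -> : piW (fun=> id) b i x = x by elim: (i) (b) => //= j IH b'; rewrite IH.
by rewrite eqxx mulr1.
Qed.

Lemma Sx_pair be x J (lam : bool -> R) b i (s := dgen D (~~ be)) :
  closedL J -> x \notin J -> (s * x)%g \notin J ->
  (forall y, y \in [set x; s * x]%g -> inspan J (Lop be (c y) - lam be *: c y)) ->
  (forall y, y \in [set x; s * x]%g -> inspan J (Lop (~~ be) (c y) - lam (~~ be) *: c (s * y)%g)) ->
  (i <= n)%N ->
  Sx [set x; s * x]%g (wd b i) =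
  mon (fun b => aug (lam b)) b i * (if par D (~~ be) (wd b i) then 0 else 2).
Proof.
move=> cJ xJ sxJ E1 E2 iN.
pose pi b' (y : W) := if b' == be then y else (s * y)%g.
have pE b' j y : piW pi b' j y = if par D (~~ be) (wd b' j) then (s * y)%g else y.
  elim: j b' => [|j IH] b'; first by rewrite par1.
  rewrite /= par_gen IH /pi; case: (eqVneq b' be) => [->|nb].
    by rewrite [~~ be == be](_ : _ = false) //; case: (be).
  have -> : b' = ~~ be by move: nb; case: (b'); case: (be).
  by rewrite eqxx; case: (par _ _ _) => //=; rewrite genK.
have nx : x != (s * x)%g.
  by rewrite -{1}[x]mul1g (inj_eq (mulIg x)) eq_sym gen_neq1.
rewrite (@Sx_monomial _ J lam pi) //.
- rewrite big_setU1 ?inE //= big_set1 !pE -mulrDr; congr (_ * _).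
  case: ifP => _; last by rewrite !eqxx.
  by rewrite genK (negPf nx) eq_sym (negPf nx) addr0.
- by rewrite disjoint_subset; apply/fintype.subsetP => y; rewrite !inE => /orP[] /eqP ->.
- move=> b' y; rewrite /pi !inE => /orP[] /eqP ->; case: ifP; rewrite ?eqxx ?orbT //.
  by rewrite genK eqxx.
- move=> b' y yK; rewrite /pi; case: (eqVneq b' be) => [->|nb]; first exact: E1.
  have -> : b' = ~~ be by move: nb; case: (b'); case: (be).
  exact: E2.
Qed.

(** ** The left ideals generated by [C_s] *)

Lemma tab_desc_eigen_right b : tab_desc D u ui c b -> forall x, rdes b x ->
  Rop b (c x) = u b *: c x.
Proof.
move=> T x dx; rewrite -[c x]flipK c_flip -flip_Lop.
have := T x^-1%g dx; rewrite /Cop scalerDl => /addIr ->.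
by rewrite linearZ.
Qed.

(** A right eigenvector of [gen b] involves only basis elements with that right descent: for the
    longest other [x], the remaining part has no coordinate at [x * gen b], and the equation then
    kills the one at [x]. The ring is arbitrary because this serves the generic algebra and both
    changes of basis after specialisation. *)
Lemma span_rdes (F : comNzRingType) (a : W -> W -> F) b (v vi : F) (f k : W -> F) :
  v * vi = 1 -> tri len a ->
  (forall x y, rdes b x -> rdes b y = false -> a x (y * gen b)%g = v * a x y) ->
  (forall y, rdes b y = false -> f (y * gen b)%g = v * f y) ->
  (forall y, f y = \sum_x k x * a x y) -> forall z, ~~ rdes b z -> k z = 0.
Proof.
move=> vv ta ea ef fk; pose k' x := if rdes b x then 0 else k x.
pose f' y := \sum_x k' x * a x y.
have ef' y : rdes b y = false -> f' (y * gen b)%g = v * f' y.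
  move=> dy; have fE y' : f' y' = f y' - \sum_(x | rdes b x) k x * a x y'.
    rewrite fk (bigID (rdes b)) /= addrAC subrr add0r /f' (bigID (rdes b)) /= big1 ?add0r.
      by apply: eq_bigr => x /negPf dx; rewrite /k' dx.
    by move=> x dx; rewrite /k' dx mul0r.
  rewrite !fE ef // mulrBr mulr_sumr; congr (_ - _).
  by apply: eq_bigr => x dx; rewrite ea // mulrCA.
suff E x : k' x = 0 by move=> z /negPf dz; have := E z; rewrite /k' dz.
move: x; apply: (down_ind (d := len)) => x IH.
rewrite {1}/k'; case: ifP => // dx.
have E1 : f' x = k x by rewrite /f' (tri_sum ta) // /k' dx.
have E2 : f' (x * gen b)%g = 0.
  rewrite /f' (tri_sum ta) /k'; first by rewrite rdes_genr dx.
  by move=> y ly; apply: IH; move: ly; rewrite len_genr dx; lia.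
have := ef' x dx; rewrite E1 E2 => /(congr1 (fun z => vi * z)).
by rewrite mulr0 mulrA [vi * v]mulrC vv mul1r.
Qed.

Lemma closedL_rdes b : tab_desc D u ui c b -> closedL [set w | rdes b w].
Proof.
move=> T b' x; rewrite inE => dx z; rewrite inE => dz.
have E : Rop b (Lop b' (c x)) = u b *: Lop b' (c x).
  by rewrite -Lop_Rop tab_desc_eigen_right // linearZ.
have half h y : Rop b h = u b *: h -> rdes b y = false -> h (y * gen b)%g = u b * h y.
  by move=> /(congr1 (fun h : H => h y)); rewrite heckeZ RopE => <- ->; rewrite addr0.
apply: (@span_rdes _ (fun w y => c w y) b (u b) (ui b) (fun y => Lop b' (c x) y)) => //.
- by move=> x' y dx' dy; apply: half => //; apply: tab_desc_eigen_right.
- by move=> y dy; apply: half.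
- move=> y; rewrite {1}[Lop b' (c x)](gcoord_sum c_tri) hecke_sum.
  by apply: eq_bigr => w _; rewrite heckeZ.
Qed.

Lemma aug_Lop b h y : aug (Lop b h y) = aug (h (gen b * y)%g).
Proof.
rewrite LopE rmorphD; case: ifP => _; rewrite ?rmorph0 ?addr0 //.
by rewrite rmorphM /xi rmorphB aug_ui subrr mul0r addr0.
Qed.

(** At [e^gamma = 1] the parameter [xi] vanishes and [T_w] acts as translation by [w]. *)
Lemma aug_mul w h y : aug (mul (gT w) h y) = aug (h (w^-1 * y)%g).
Proof.
have [b [i [iN ->]]] := wd_exists D w; elim: i b iN y => [|i IH] b iN y.
  by rewrite hmul1l invg1 mul1g.
rewrite mul_wdS // aug_Lop IH; last exact: ltnW.
by rewrite wdS invMg dgenV -mulgA.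
Qed.

Definition ca x y : rat := aug (c x y).
Definition cM w z x : rat := aug (gcoord (mul (gT w) (c x)) z).

Lemma ca_tri : tri len ca.
Proof.
move=> x; have [c1 c2] := c_tri x; split; first by rewrite /ca c1 rmorph1.
by move=> y nz; apply: c2; apply: contraNneq nz => cy; rewrite /ca cy rmorph0.
Qed.

Lemma ca_cM w x y : \sum_z cM w z x * ca z y = ca x (w^-1 * y)%g.
Proof.
rewrite /ca -aug_mul [in RHS](gcoord_sum c_tri (mul _ _)) hecke_sum rmorph_sum.
by apply: eq_bigr => z _; rewrite heckeZ rmorphM.
Qed.

Definition da x y : rat := (y == x)%:R.

Lemma da_tri : tri len da.
Proof.
move=> x; rewrite /da eqxx; split=> // y.
by have [->|_] := eqVneq y x; [left | rewrite mulr0n eqxx].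
Qed.

(** After specialisation the basis is unitriangular in the group algebra, so the total trace can be
    computed on group elements. *)
Lemma Sx_setT w : Sx [set: W] w = \sum_(x : W) ((w * x)%g == x)%:R.
Proof.
have PE : forall x : W, exists k : {ffun W -> rat}, forall y, da x y = \sum_z k z * ca z y.
  by move=> x; apply: tri_span ca_tri.
have QE : forall x : W, exists k : {ffun W -> rat}, forall y, ca x y = \sum_z k z * da z y.
  by move=> x; apply: tri_span da_tri.
have [P PP] := choice PE; have [Q QQ] := choice QE.
rewrite [LHS](@trace_basis W len rat ca da ca_tri da_tri [set: W] (fun y => w^-1 * y)%g
  (fun z x => cM w z x) (fun z x => (z == w * x)%g%:R) _ _ _
  (fun z x => P x z) (fun z x => Q x z)) //.
- by apply: eq_big => [x|x _]; rewrite ?inE // eq_sym.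
- exact: ca_cM.
- move=> x y; rewrite (bigD1 (w * x)%g) //= eqxx mul1r big1 ?addr0.
    by rewrite /da -(inj_eq (mulgI w) (w^-1 * y)%g) mulKVg.
  by move=> z /negPf ->; rewrite mul0r.
- by move=> x z _; rewrite inE.
- by move=> x z _; rewrite inE.
- by move=> x z _; rewrite inE.
Qed.

(* [ind_char b s] is the character induced from the linear character of the
   subgroup generated by [gen b] that takes the value [s] at [gen b]. *)
Definition ind_char b (s : rat) w : rat := \sum_(x | rdes b x)
  (if rdes b (w * x)%g then ((w * x)%g == x)%:R else s * ((w * x * gen b)%g == x)%:R).

Lemma Sx_rdes b w : tab_desc D u ui c b ->
  Sx [set x | rdes b x] w = ind_char b (aug (u b)) w.
Proof.
move=> T; set s := aug (u b).
have ss : s * s = 1 by rewrite /s -{2}aug_ui -rmorphM u_ui rmorph1.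
(* When [x] has the right descent, [ja x] is [x + s x gen b], a basis vector of the induced module;
   the other group elements complete a triangular basis. *)
pose ja x y : rat := (y == x)%:R + (if rdes b x then s * (y == (x * gen b)%g)%:R else 0).
(* The matrix of [w] in the basis [ja]. When [w x] lacks the descent, [s * s = 1] makes the image of
   such a vector [s] times the one at [w x gen b]. *)
pose jM z x : rat :=
  if rdes b x then
    if rdes b (w * x)%g then (z == (w * x)%g)%:R else s * (z == (w * x * gen b)%g)%:R
  else (z == (w * x)%g)%:R -
    (if rdes b (w * x)%g then s * (z == (w * x * gen b)%g)%:R else 0).
have lg x : rdes b x -> (len (x * gen b)%g < len x)%N.
  by move=> dx; rewrite -(lenV D (x * _)) -(lenV D x) invMg dgenV.
have nxg x : (x == (x * gen b)%g) = false.
  by rewrite -{1}[x]mulg1 (inj_eq (mulgI x)) eq_sym (negPf (gen_neq1 D b)).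
have ja_tri : tri len ja.
  move=> x; rewrite /ja eqxx nxg mulr0 if_same addr0; split=> // y.
  have [->|yx] := eqVneq y x; first by left.
  rewrite add0r; case: ifP => dx; last by rewrite eqxx.
  have [->|_] := eqVneq y (x * gen b)%g; last by rewrite mulr0 eqxx.
  by move=> _; right; apply: lg.
have ja_eig x y : rdes b x -> rdes b y = false -> ja x (y * gen b)%g = s * ja x y.
  move=> dx dy; have e1 : ((y * gen b)%g == x) = (y == (x * gen b)%g).
    by rewrite -(inj_eq (mulIg (gen b))) genKr.
  by rewrite /ja dx (inj_eq (mulIg (gen b))) e1 mulrDr mulrA ss mul1r addrC.
have PE : forall x : W, exists k : {ffun W -> rat}, forall y, ja x y = \sum_z k z * ca z y.
  by move=> x; apply: tri_span ca_tri.
have QE : forall x : W, exists k : {ffun W -> rat}, forall y, ca x y = \sum_z k z * ja z y.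
  by move=> x; apply: tri_span ja_tri.
have [P PP] := choice PE; have [Q QQ] := choice QE.
have ca_eig x y : rdes b x -> rdes b y = false -> ca x (y * gen b)%g = s * ca x y.
  move=> dx dy; have := congr1 (fun h : H => h y) (tab_desc_eigen_right T dx).
  by rewrite heckeZ RopE dy addr0 /ca => ->; rewrite rmorphM.
rewrite [LHS](@trace_basis W len rat ca ja ca_tri ja_tri [set x | rdes b x] (fun y => w^-1 * y)%g
  (fun z x => cM w z x) jM _ _ _ (fun z x => P x z) (fun z x => Q x z)) //.
- apply: eq_big => [x|x]; first by rewrite inE.
  by rewrite inE /jM => ->; rewrite ![x == _]eq_sym.
- exact: ca_cM.
- move=> x y.
  have yE v : ((w^-1 * y)%g == v) = (y == (w * v)%g) by rewrite -(inj_eq (mulgI w) (w^-1 * y)%g) mulKVg.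
  have pick v (g : W -> rat) : \sum_z (z == v)%:R * g z = g v.
    by rewrite (bigD1 v) //= eqxx mul1r big1 ?addr0 // => z /negPf ->; rewrite mul0r.
  rewrite [RHS]/ja !yE mulgA /jM; case dx : (rdes b x); case dwx : (rdes b (w * x)%g).
  + by rewrite pick /ja dwx.
  + under eq_bigr do rewrite -mulrA.
    rewrite -mulr_sumr pick /ja rdes_genr dwx /= genKr mulrDr mulrA ss mul1r addrC //.
  + under eq_bigr do rewrite mulrBl -mulrA.
    rewrite sumrB -mulr_sumr !pick /ja dwx rdes_genr dwx /= !addr0.
    by rewrite addrK.
  + by under eq_bigr do rewrite subr0; rewrite pick /ja dwx addr0.
- move=> x z xJ zJ; have S : inspan [set w | rdes b w] (mul (gT w) (c x)).
    by apply: closedL_mul => //; [exact: closedL_rdes | exact: inspan_c].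
  by rewrite /cM S ?rmorph0.
- move=> x z; rewrite !inE => dx dz.
  exact: (span_rdes ss ca_tri ca_eig (ja_eig x ^~ dx) (PP x)).
- move=> x z; rewrite !inE => dx dz.
  exact: (span_rdes ss ja_tri ja_eig (ca_eig x ^~ dx) (QQ x)).
Qed.

End Characters.

(** * Characters of the one- and two-element left cells *)

Section SpecialCharacters.
Local Open Scope ring_scope.
Context (W : finGroupType) (D : dihedral W) (R : comNzRingType) (u ui : bool -> R).
Local Notation gen := (dgen D).
Local Notation n := (dn D).
Local Notation len := (cox_len (dS D)).
Local Notation ldes := (ldes D).
Local Notation wd := (wd D).
Local Notation H := {ffun W -> R^o}.
Local Notation Lop := (Lop D u ui).
Local Notation Cop := (Cop D u ui).
Local Notation w0 := (w0 D).
Context (c : W -> H).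
Context (c_tri : tri len (fun w x => c w x)).
Local Notation inspan := (inspan c).
Local Notation closedL := (closedL D u ui c).
Context (aug : {rmorphism R -> rat}) (sg : bool -> rat).
Context (aug_u : forall b, aug (u b) = sg b) (aug_ui : forall b, aug (ui b) = sg b).
Local Notation Sx := (Sx D u ui c aug).
Implicit Types (b : bool) (w x y : W) (J K : {set W}).

Lemma closedL0 : closedL finset.set0.
Proof. by move=> b x; rewrite inE. Qed.

Lemma eq_mon (v v' : bool -> rat) : v =1 v' -> forall b i, mon v b i = mon v' b i.
Proof. by move=> E b i; elim: i b => //= i IH b; rewrite E IH. Qed.

Lemma inspan_desc J b x : tab_desc D u ui c b -> ldes b x ->
  inspan J (Lop b (c x) - u b *: c x).
Proof.
move=> T dx; have := T x dx; rewrite /Cop scalerDl => /addIr ->.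
by rewrite subrr; apply: inspan0.
Qed.

Lemma inspan_asc J b x : inspan J (Cop b (c x)) -> inspan J (Lop b (c x) - (- ui b) *: c x).
Proof. by rewrite scaleNr opprK. Qed.

Definition signs (F : Type) (be : bool) (v v' : F) b : F := if b == be then v else v'.

(** [Cop b] sends [c 1] into the ideal spanned by the other basis elements, so [T_b] acts modulo it
    by [- ui b]. *)
Lemma Sx_one b i : closedL (~: [set 1%g]) ->
  (forall b, Cop b (c 1%g) = c (wd b 1)) -> (i <= n)%N ->
  Sx [set 1%g] (wd b i) = mon (fun b => - sg b) b i.
Proof.
move=> cJ E iN; have n4 := dn_ge4 D.
rewrite (@Sx_single _ _ _ _ _ _ c_tri _ _ (~: [set 1%g]) (fun b => - ui b)) //.
- by apply: eq_mon => b'; rewrite rmorphN aug_ui.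
- by rewrite !inE eqxx.
- move=> b'; apply: inspan_asc; rewrite E; apply: inspan_c => //.
  by rewrite memJ1 //; lia.
Qed.

Lemma Sx_w0 b i : (forall b, tab_desc D u ui c b) -> (i <= n)%N ->
  Sx [set w0] (wd b i) = mon sg b i.
Proof.
move=> T iN.
rewrite (@Sx_single _ _ _ _ _ _ c_tri _ _ finset.set0 u) //.
- exact: eq_mon.
- exact: closedL0.
- by rewrite inE.
- move=> b'; apply: inspan_desc => //; have n4 := dn_ge4 D.
  by rewrite ldesE // eqxx orbT andbT; lia.
Qed.

Section Dominant.
Context (be : bool).
Local Notation r := (~~ be).
Local Notation w0r := (wd be n.-1).

Lemma gen_rE : gen r = wd r 1.
Proof. by rewrite /= mulg1. Qed.

Lemma w0_rw0r : w0 = (gen r * w0r)%g.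
Proof.
have n4 := dn_ge4 D; have -> : w0 = wd r n by apply: wd_n.
by rewrite -[n in LHS]prednK ?wdS ?negbK //; lia.
Qed.

Lemma Sx_gen_r b i : tabG D u ui be c -> (i <= n)%N ->
  Sx [set gen r] (wd b i) = mon (signs be (- sg be) (sg r)) b i.
Proof.
move=> T iN; have n4 := dn_ge4 D; have [T0 T1 T2 T3] := T.
have [_ _ cJ _ _] := closedG_sets c_tri T.
rewrite (@Sx_single _ _ _ _ _ _ c_tri _ _ (~: [set 1%g; gen r]) (signs be (- ui be) (u r))) //.
- by apply: eq_mon => b'; rewrite /signs; case: ifP; rewrite ?rmorphN ?aug_ui ?aug_u.
- by rewrite !inE eqxx orbT.
- move=> b'; rewrite /signs; case: eqP => [->|nb].
    rewrite gen_rE; apply: inspan_asc; rewrite T3; last lia.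
    rewrite !addr0; apply: inspan_c => //.
    by rewrite -gen_rE memJr ?rbe ?ber //; lia.
  have -> : b' = r by move: nb; case: (b'); case: (be).
  by apply: inspan_desc; rewrite ?ldes_self.
Qed.

Lemma Sx_w0r b i : tabG D u ui be c -> (i <= n)%N ->
  Sx [set w0r] (wd b i) = mon (signs be (sg be) (- sg r)) b i.
Proof.
move=> T iN; have n4 := dn_ge4 D; have [T0 T1 T2 T3] := T.
have [_ cJ _ _ _] := closedG_sets c_tri T.
rewrite (@Sx_single _ _ _ _ _ _ c_tri _ _ [set w0] (signs be (u be) (- ui r))) //.
- by apply: eq_mon => b'; rewrite /signs; case: ifP; rewrite ?rmorphN ?aug_ui ?aug_u.
- by rewrite memJw0; lia.
- move=> b'; rewrite /signs; case: eqP => [->|nb].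
    apply: inspan_desc => //; rewrite ldesE ?eqxx; lia.
  have -> : b' = r by move: nb; case: (b'); case: (be).
  apply: inspan_asc; rewrite T1; last lia.
  by rewrite prednK; [apply: inspan_c => //; rewrite memJw0 ?eqxx | lia].
Qed.

Lemma Sx_pair1 b i : tabH D u ui be c -> u r = 1 -> (i <= n)%N ->
  Sx [set 1%g; gen r] (wd b i) =
  mon (signs be (- sg be) 1) b i * (if par D r (wd b i) then 0 else 2).
Proof.
move=> T ur iN; have n4 := dn_ge4 D; have [T0 T1 T2 T3] := T.
have [cJ _ _] := closedH_sets c_tri T.
have E := @Sx_pair _ D _ u ui c c_tri aug be 1%g (~: [set 1%g; gen r]) (signs be (- ui be) 1) b i cJ.
rewrite mulg1 in E; rewrite E //.
- congr (_ * _); apply: eq_mon => b'.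
  by rewrite /signs; case: ifP; rewrite ?rmorph1 // rmorphN aug_ui.
- by rewrite !inE eqxx.
- by rewrite !inE eqxx orbT.
- move=> y; rewrite !inE /signs eqxx => /orP[] /eqP ->; apply: inspan_asc.
    by rewrite T2; apply: inspan_c => //; rewrite memJr ?ber //; lia.
  rewrite gen_rE T3; last lia.
  by rewrite addr0; apply: inspan_c => //; rewrite -gen_rE memJr ?ber //; lia.
- move=> y _; rewrite /signs rbe scale1r T1 subrr; exact: inspan0.
Qed.

Lemma Sx_pairw0 b i : tabH D u ui be c -> u r = 1 -> (i <= n)%N ->
  Sx [set w0; w0r] (wd b i) =
  mon (signs be (sg be) 1) b i * (if par D r (wd b i) then 0 else 2).
Proof.
move=> T ur iN; have n4 := dn_ge4 D; have [T0 T1 T2 T3] := T.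
have E := @Sx_pair _ D _ u ui c c_tri aug be w0r finset.set0 (signs be (u be) 1) b i closedL0.
rewrite -w0_rw0r in E; rewrite finset.setUC E ?inE //.
- congr (_ * _); apply: eq_mon => b'.
  by rewrite /signs; case: ifP; rewrite ?rmorph1 // aug_u.
- move=> y; rewrite !inE /signs eqxx => /orP[] /eqP ->; apply: inspan_desc => //.
    by rewrite ldesE ?eqxx; lia.
  by rewrite ldesE ?eqxx ?orbT; lia.
- move=> y _; rewrite /signs rbe scale1r T1 subrr; exact: inspan0.
Qed.

(* At [e^gamma = 1] the vanishing parameter splits the two-dimensional
   character into its specialisations to the signs [1] and [-1]. *)
Lemma mon_pair v b i :
  mon (signs be v 1) b i * (if par D r (wd b i) then 0 else 2) =
  mon (signs be v 1) b i + mon (signs be v (-1)) b i :> rat.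
Proof.
have E : mon (signs be v (-1)) b i = mon (signs be v 1) b i * (-1) ^+ par D r (wd b i).
  elim: i b => [|i IH] b; first by rewrite par1 expr0 mulr1.
  rewrite [LHS]/= IH [mon _ _ _.+1]/= wdS par_gen /signs.
  have [->|nb] := eqVneq b be; first by rewrite rbe /= mulrA.
  have -> : r == b by move: nb; case: (b); case: (be).
  by case: (par _ _ _) => /=; rewrite ?expr0 ?expr1; ring.
by rewrite E; case: (par _ _ _); rewrite ?expr0 ?expr1; ring.
Qed.

End Dominant.
End SpecialCharacters.

(** * The Hecke algebra of a weight function *)

Section Weight.
Local Open Scope ring_scope.
Context (W : finGroupType) (D : dihedral W) (G : orderedZmod).
Context (phi : Sbar (dS D) -> G).
Local Notation len := (cox_len (dS D)).
Local Notation R := (groupRing G).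
Implicit Types (b : bool) (w x y : W) (k : side).

Definition wt b : G := phi (osb D b).
Definition wneg b : bool := ~~ oz_le 0 (wt b).
Definition wabs b : G := if wneg b then - wt b else wt b.
(** Of [e^phi] and [- e^(-phi)], the one whose exponent is not negative, so that [hui] never has
    positive degree. *)
Definition hu b : R := (if wneg b then -1 else 1) * gr_exp (wabs b).
Definition hui b : R := (if wneg b then -1 else 1) * gr_exp (- wabs b).

Local Notation mul := (hmul D hu hui).
Local Notation bar := (bar D hu hui (@gr_conj G)).
Local Notation KL := (KL D hu hui (@gr_conj G) (@gr_negative G)).

Lemma wabs_ge0 b : oz_le 0 (wabs b).
Proof.
rewrite /wabs /wneg; case: ifP => [|/negbFE //]; rewrite -oz_ltNge => /oz_ltW.
by rewrite -{1}[wt b]opprK -[X in oz_le _ X]oppr0 oz_leN.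
Qed.

Lemma wabs_eq0 b : (wabs b == 0) = (wt b == 0).
Proof. by rewrite /wabs; case: ifP; rewrite ?oppr_eq0. Qed.

Lemma wsg2 b : (if wneg b then -1 else 1) * (if wneg b then -1 else 1) = 1 :> R.
Proof. by case: ifP => _; rewrite ?mulr1 // mulrNN mulr1. Qed.

Lemma hu_hui b : hu b * hui b = 1.
Proof. by rewrite /hu /hui mulrACA -gr_expD subrr wsg2 mulr1. Qed.

Lemma hxi_exp b : hu b - hui b = gr_exp (wt b) - gr_exp (- wt b).
Proof.
rewrite /hu /hui /wabs; case: (wneg b); last by rewrite !mul1r.
by rewrite opprK !mulN1r opprK addrC.
Qed.

Lemma conj_hu b : gr_conj (hu b) = hui b.
Proof. by rewrite /hu /hui rmorphM /= gr_conj_exp; case: ifP; rewrite ?rmorphN rmorph1. Qed.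

Lemma conj_hui b : gr_conj (hui b) = hu b.
Proof. by rewrite /hu /hui rmorphM /= gr_conj_exp opprK; case: ifP; rewrite ?rmorphN rmorph1. Qed.

Definition wsg b : rat := if wneg b then -1 else 1.

Lemma aug_hu b : gr_aug (hu b) = wsg b.
Proof.
by rewrite /hu rmorphM /= gr_aug_exp mulr1 /wsg; case: ifP; rewrite ?rmorphN rmorph1.
Qed.

Lemma aug_hui b : gr_aug (hui b) = wsg b.
Proof.
by rewrite /hui rmorphM /= gr_aug_exp mulr1 /wsg; case: ifP; rewrite ?rmorphN rmorph1.
Qed.

Lemma hecke_mulE : hecke_mul phi = mul.
Proof.
have pq b : gr_exp (wt b) * gr_exp (- wt b) = 1 :> R by rewrite -gr_expD subrr.
have S : forall m : hecke W G -> hecke W G -> hecke W G,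
    hecke_mul_spec phi m <-> gspec D (fun b => gr_exp (wt b)) (fun b => gr_exp (- wt b)) m.
  move=> m; split=> -[m1 m2 m3 m4 m5]; split=> //.
    by move=> b; apply: m5; rewrite mem_osb.
  by move=> o x; have [b ->] := osbP o; rewrite mem_osb => /eqP ->; apply: m5.
have U m : hecke_mul_spec phi m -> m = mul by move/S/(spec_unique hxi_exp pq).
rewrite /hecke_mul; case: xgetP => [m _ /U //|/(_ mul) []].
by apply/S; exact: (hmul_spec D hxi_exp pq).
Qed.

Lemma hecke_invE w : hecke_inv phi (hT G w^-1%g) = barT D hu hui w.
Proof.
rewrite /hecke_inv hecke_mulE; case: xgetP => [k _ kI|/(_ (barT D hu hui w)) []].
  exact: (isinv_unique kI (barT_inv D hu hui w)).
exact: barT_inv.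
Qed.

Lemma hecke_barE h : hecke_bar phi h = bar h.
Proof. by apply: eq_bigr => w _; rewrite hecke_invE. Qed.

Lemma gr_negativeB (a a' : R) : gr_negative a -> gr_negative a' -> gr_negative (a - a').
Proof. by move=> na na'; apply: gr_negativeD => //; apply: gr_negativeN. Qed.

Lemma KL_specE w h : KL_spec phi w h <-> KL w h.
Proof. by rewrite /KL_spec hecke_barE. Qed.

Lemma KL_eq w h h' : KL w h -> KL w h' -> h = h'.
Proof. exact: (KL_unique gr_negativeB (@gr_negative_conj G)). Qed.

Section Basis.
Context (c : W -> {ffun W -> R^o}).
Context (cKL : forall w, KL w (c w)).

Lemma hC_E w : hC phi w = c w.
Proof.
rewrite /hC; case: xgetP => [h _ /KL_specE hKL|/(_ (c w)) []].
  exact: KL_eq hKL (cKL w).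
exact/KL_specE.
Qed.

Lemma c_tri : tri len (fun w x => c w x).
Proof. exact: (KL_tri (@gr_negative_conj G) cKL). Qed.

Lemma c_flip w : flip (c w) = c w^-1%g.
Proof. exact: KL_eq (KL_flip (cKL w)) (cKL _). Qed.

Lemma hC_coordE h : hC_coord phi h = gcoord c h.
Proof.
have E (a : {ffun W -> R}) : \sum_(w : W) a w *: hC phi w = \sum_(w : W) a w *: c w.
  by apply: eq_bigr => w _; rewrite hC_E.
rewrite /hC_coord; case: xgetP => [a _ /=|/(_ (gcoord c h)) []].
  by rewrite E => /(gcoordE c_tri).
by rewrite /= E; exact: (gcoord_sum c_tri).
Qed.

Lemma cell_eqE k : cell_eq phi k =2 gceq D hu hui c k.
Proof.
have S x y : cell_step phi k x y = gstep D hu hui c k x y.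
  apply/asboolP/asboolP => -[h [h' nz]]; exists h, h'; move: nz;
  by rewrite hC_coordE hC_E /mul_side hecke_mulE.
have L x y : cell_le phi k x y = gcle D hu hui c k x y by apply: eq_connect.
by move=> x y; rewrite /cell_eq !L.
Qed.

Lemma cell_charE (C : {set W}) w : cell_char phi C w = Sx D hu hui c (@gr_aug G) C w.
Proof.
rewrite /cell_char /mxtrace /Sx [RHS]big_enum_val /=; apply: eq_bigr => i _.
by rewrite mxE hC_coordE hC_E hecke_mulE.
Qed.

End Basis.
End Weight.

(** * Bases, cells and characters in each relative position of the weights *)

Section Cases.
Local Open Scope ring_scope.
Context (W : finGroupType) (D : dihedral W).
Local Notation gen := (dgen D).
Local Notation n := (dn D).
Local Notation wd := (wd D).
Local Notation rdes := (rdes D).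
Local Notation w0 := (w0 D).
Implicit Types (b be : bool) (w x y : W) (k : side).

(* The relative position of the absolute values of the two weights: both zero,
   equal and nonzero, or dominated by that of [gen be], the other weight being
   nonzero ([KG]) or zero ([KH]). *)
Inductive kcase := KZ | KE | KG of bool | KH of bool.

Definition case_rel ck k : rel W :=
  match ck with
  | KZ => fun _ _ => true
  | KE => relE D k
  | KG be => relG D be k
  | KH be => relH D be k
  end.

(** A constraint on the dominating generator of a chamber having a point of case [ck] in its
    closure: it is forced unless the two absolute weights agree. *)
Definition case_refines ck be := if ck is (KG b | KH b) then b == be else true.

Section OneWeight.
Context (G : orderedZmod) (phi : Sbar (dS D) -> G).
Local Notation R := (groupRing G).
Local Notation hu := (hu phi).
Local Notation hui := (hui phi).
Local Notation KL := (KL D hu hui (@gr_conj G) (@gr_negative G)).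
Local Notation wt := (wt phi).
Local Notation wabs := (wabs phi).
Local Notation wsg := (wsg phi).

Definition is_case ck : Prop :=
  match ck with
  | KZ => forall b, wt b = 0
  | KE => wabs true = wabs false /\ forall b, wt b != 0
  | KG be => oz_lt (wabs (~~ be)) (wabs be) /\ wt (~~ be) != 0
  | KH be => wt (~~ be) = 0 /\ wt be != 0
  end.

Lemma case_exists : exists ck, is_case ck.
Proof.
have [t0|t0] := eqVneq (wt true) 0; have [f0|f0] := eqVneq (wt false) 0.
- by exists KZ; case.
- by exists (KH false).
- by exists (KH true).
have [lt1|lt1] := boolP (oz_lt (wabs true) (wabs false)); first by exists (KG false).
have [lt2|lt2] := boolP (oz_lt (wabs false) (wabs true)); first by exists (KG true).
exists KE; split; last by case.
by move: lt1 lt2; rewrite !oz_ltNge !negbK => l1 l2; apply: oz_le_anti; rewrite l1 l2.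
Qed.

Definition tab ck (c : W -> {ffun W -> R^o}) : Prop :=
  match ck with
  | KZ => tabZ D hu hui c
  | KE => tabE D hu hui c
  | KG be => tabG D hu hui be c
  | KH be => tabH D hu hui be c
  end.

Lemma hui_nonpos b : gr_nonpos (hui b).
Proof.
have E : gr_nonpos (gr_exp (- wabs b)).
  by apply: gr_nonpos_exp; rewrite -[X in oz_le _ X]oppr0 oz_leN wabs_ge0.
by rewrite /hui; case: ifP => _; rewrite ?mulN1r ?mul1r //; apply: gr_nonposN.
Qed.

Lemma hui_negative b : wt b != 0 -> gr_negative (hui b).
Proof.
move=> nz; have E : gr_negative (gr_exp (- wabs b)).
  apply: gr_negative_exp; rewrite -[X in oz_lt _ X]oppr0 oz_ltN /oz_lt wabs_ge0 andbT.
  by rewrite eq_sym wabs_eq0.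
by rewrite /hui; case: ifP => _; rewrite ?mulN1r ?mul1r //; apply: gr_negativeN.
Qed.

Lemma ratio_negative b b' : oz_lt (wabs b) (wabs b') -> gr_negative (hu b * hui b').
Proof.
move=> lt; have E : gr_negative (gr_exp (wabs b) * gr_exp (- wabs b')).
  by rewrite -gr_expD; apply: gr_negative_exp; rewrite oz_ltB.
rewrite /hu /hui mulrACA; do 2 case: ifP => _;
  rewrite ?mulrNN ?mulrN ?mulNr ?mulN1r ?mul1r ?mulr1 ?opprK //; exact: gr_negativeN.
Qed.

Lemma wt0 b : wt b = 0 -> hu b = 1 /\ hui b = 1.
Proof.
move=> w0; rewrite /hu /hui /wabs /wneg w0 oz_le_refl /=.
by rewrite oppr0 mul1r.
Qed.

Lemma mulr_swap (a b c d : R) : a * c * (b * d) = b * c * (a * d).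
Proof. ring. Qed.

Lemma case_basis ck : is_case ck -> exists c, (forall w, KL w (c w)) /\ tab ck c.
Proof.
have n0 := @gr_negative0 G; have nM := @gr_negativeM G; have nW := @gr_negativeW G.
have n1 := @gr_nonpos1 G; have pM := @gr_nonposM G; have nD := @gr_negativeD G.
have nN := @gr_negativeN G.
have cu := conj_hu phi; have cui := conj_hui phi; have uu := hu_hui phi.
case: ck => [||be|be] /=.
- move=> z; exists (gT R); apply: (KL_Z D cu cui n0).
  by move=> b; rewrite /xi; have [-> ->] := wt0 (z b); rewrite subrr.
- move=> [e nz]; exists (Gam D hu hui).
  apply: (@KL_E _ D _ _ _ uu _ cu cui _ (@gr_nonpos G) n0 nM nW n1 pM hui_nonpos);
    [exact: hui_negative | exact: hui_negative |].
  rewrite /hu /hui e; exact: mulr_swap.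
- move=> [lt nz]; exists (domW D hu hui be).
  have nz' b : wt b != 0.
    have [->|nb] := eqVneq b (~~ be); first by [].
    have -> : b = be by move: nb; case: (b); case: (be).
    apply: contraTneq lt => z; rewrite oz_ltNge negbK.
    by rewrite {1}/wabs /wneg z oz_le_refl wabs_ge0.
  apply: (@KL_dom _ D _ _ _ uu _ cu cui _ (@gr_nonpos G) n0 nD nN nM nW n1 pM hui_nonpos);
    [exact: hui_negative | exact: hui_negative | exact: ratio_negative].
- move=> [z nz]; exists (semC D hu hui be); have [z1 z2] := wt0 z.
  apply: (@KL_sem _ D _ _ _ uu _ cu cui _ (@gr_nonpos G) n0 nM nW n1 pM) => //.
  exact: hui_negative.
Qed.

(** The two ratios are mutually inverse. If their sum vanished, both would be negative, and so would
    their product 1. *)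
Lemma ratio_sum_neq0 be : oz_lt (wabs (~~ be)) (wabs be) ->
  hu (~~ be) * hui be + hu be * hui (~~ be) != 0.
Proof.
move=> lt; apply/eqP => /eqP; rewrite addr_eq0 => /eqP e.
have q1 := ratio_negative lt.
have q2 : gr_negative (hu be * hui (~~ be)).
  by rewrite -[_ * _]opprK -e; apply: gr_negativeN.
have n1 : gr_negative (1 : R).
  have -> : 1 = (hu (~~ be) * hui be) * (hu be * hui (~~ be)).
    by transitivity ((hu be * hui be) * (hu (~~ be) * hui (~~ be)));
      [rewrite !hu_hui mulr1 | ring].
  by apply: gr_negativeM => //; apply: gr_negativeW.
have /eqP := gr_negative_conj n1 (rmorph1 _).
by rewrite oner_eq0.
Qed.

Lemma cell_eq_case ck k : is_case ck -> cell_eq phi k =2 case_rel ck k.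
Proof.
move=> cs x y; have [c [cKL T]] := case_basis cs.
rewrite (cell_eqE cKL); have ct := c_tri cKL; have cf := c_flip cKL.
case: ck cs T => [_|_|be [lt _]|be _] T /=.
- exact: (gceqZ ct cf).
- by rewrite (gceqE (hu_hui phi) ct cf _ T).
- by rewrite (gceqG ct cf _ T (ratio_sum_neq0 lt)).
- by rewrite (gceqH ct cf _ T).
Qed.

Lemma char_diff ck (K K' : {set W}) w : is_case ck -> K' \subset K ->
  cell_char phi (K :\: K') w = cell_char phi K w - cell_char phi K' w.
Proof.
by move=> /case_basis[c [cKL _]] sub; rewrite !(cell_charE cKL) SxD.
Qed.

Lemma char_all ck w : is_case ck ->
  cell_char phi [set: W] w = \sum_(x : W) ((w * x)%g == x)%:R.
Proof.
move=> /case_basis[c [cKL _]]; rewrite (cell_charE cKL).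
apply: (Sx_setT (c_tri cKL)) => b.
by rewrite /= aug_hu aug_hui.
Qed.

Definition nondeg ck b := match ck with KZ => false | KH be => b == be | _ => true end.

Lemma char_rdes ck b w : is_case ck -> nondeg ck b ->
  cell_char phi [set x | rdes b x] w = ind_char D b (wsg b) w.
Proof.
move=> cs nd; have [c [cKL T]] := case_basis cs; rewrite (cell_charE cKL) -aug_hu.
apply: (Sx_rdes (hu_hui phi) (c_tri cKL) (c_flip cKL)) => [b'|].
  by rewrite /= aug_hu aug_hui.
case: ck nd cs T => [|_ _ []|be _ _ []|be /eqP -> _ []] //.
Qed.

Lemma char_1 ck b i : is_case ck -> (if ck is KE then true else if ck is KG _ then true else false) ->
  (i <= n)%N -> cell_char phi [set 1%g] (wd b i) = mon (fun b => - wsg b) b i.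
Proof.
move=> cs nd iN; have [c [cKL T]] := case_basis cs; rewrite (cell_charE cKL).
have ct := c_tri cKL; have n4 := dn_ge4 D.
case: ck nd cs T => [||be|be] // _ cs T.
  have [cJ _ _] := closedE_sets ct T; have [T0 T1] := T.
  apply: (Sx_one (sg := wsg) ct (aug_hui phi)) => // b'.
  by rewrite -[1%g]/(wd (~~ b') 0) T1 ?addr0 //; lia.
have [cJ _ _ _ _] := closedG_sets ct T; have [T0 T1 T2 T3] := T.
apply: (Sx_one (sg := wsg) ct (aug_hui phi)) => // b'.
have [->//|nb] := eqVneq b' be.
have -> : b' = ~~ be by move: nb; case: (b'); case: (be).
by rewrite -[1%g]/(wd be 0) T1 //; lia.
Qed.

Lemma char_w0 ck b i : is_case ck -> (if ck is KE then true else if ck is KG _ then true else false) ->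
  (i <= n)%N -> cell_char phi [set w0] (wd b i) = mon wsg b i.
Proof.
move=> cs nd iN; have [c [cKL T]] := case_basis cs; rewrite (cell_charE cKL).
apply: (Sx_w0 (sg := wsg) (c_tri cKL) (aug_hu phi)) => //.
by case: ck nd cs T => [|_ _ []|be _ _ []|] //.
Qed.

Lemma char_r be b i : is_case (KG be) -> (i <= n)%N ->
  cell_char phi [set gen (~~ be)] (wd b i) = mon (signs be (- wsg be) (wsg (~~ be))) b i.
Proof.
move=> cs iN; have [c [cKL T]] := case_basis cs; rewrite (cell_charE cKL).
exact: (Sx_gen_r (sg := wsg) (c_tri cKL) (aug_hu phi) (aug_hui phi)).
Qed.

Lemma char_w0r be b i : is_case (KG be) -> (i <= n)%N ->
  cell_char phi [set wd be n.-1] (wd b i) = mon (signs be (wsg be) (- wsg (~~ be))) b i.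
Proof.
move=> cs iN; have [c [cKL T]] := case_basis cs; rewrite (cell_charE cKL).
exact: (Sx_w0r (sg := wsg) (c_tri cKL) (aug_hu phi) (aug_hui phi)).
Qed.

Lemma char_pair1 be b i : is_case (KH be) -> (i <= n)%N ->
  cell_char phi [set 1%g; gen (~~ be)] (wd b i) =
  mon (signs be (- wsg be) 1) b i + mon (signs be (- wsg be) (-1)) b i.
Proof.
move=> cs iN; have [c [cKL T]] := case_basis cs; rewrite (cell_charE cKL) -(mon_pair D).
apply: (Sx_pair1 (sg := wsg) (c_tri cKL) (aug_hui phi)) => //.
by case: cs => /wt0[].
Qed.

Lemma char_pairw0 be b i : is_case (KH be) -> (i <= n)%N ->
  cell_char phi [set w0; wd be n.-1] (wd b i) =
  mon (signs be (wsg be) 1) b i + mon (signs be (wsg be) (-1)) b i.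
Proof.
move=> cs iN; have [c [cKL T]] := case_basis cs; rewrite (cell_charE cKL) -(mon_pair D).
apply: (Sx_pairw0 (sg := wsg) (c_tri cKL) (aug_hu phi)) => //.
by case: cs => /wt0[].
Qed.

Lemma char_disj ck (K K' : {set W}) w : is_case ck -> [disjoint K & K'] ->
  cell_char phi (K :|: K') w = cell_char phi K w + cell_char phi K' w.
Proof.
by move=> /case_basis[c [cKL _]] dis; rewrite !(cell_charE cKL) SxU.
Qed.

End OneWeight.

Lemma wsgE (G : orderedZmod) (phi : Sbar (dS D) -> G) b : wsg phi b = 1 \/ wsg phi b = -1.
Proof. by rewrite /wsg; case: ifP; [right|left]. Qed.

End Cases.

(** * Comparison of left cell characters with those of an adjacent chamber *)

Section Comparison.
Local Open Scope ring_scope.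
Context (W : finGroupType) (D : dihedral W).
Local Notation gen := (dgen D).
Local Notation n := (dn D).
Local Notation wd := (wd D).
Local Notation rdes := (rdes D).
Local Notation w0 := (w0 D).
Implicit Types (b be : bool) (w x y : W) (k : side).

Definition lcell ck x : {set W} := [set y | case_rel D ck LeftSide x y].

Section Shape.
Context (be : bool).
Local Notation r := (~~ be).
Local Notation w0r := (wd be n.-1).
Local Notation J := [set y | rdes be y].

Lemma rdes1 b : rdes b 1%g = false.
Proof. by rewrite -[1%g]/(wd b 0) rdesE. Qed.

Lemma rdes_gr : rdes be (gen r) = false.
Proof. by rewrite /rdes dgenV (gen_rE D be) ldes_wdN //; have := dn_ge4 D; lia. Qed.

Lemma rdes_w0r : rdes be w0r.
Proof.
have n4 := dn_ge4 D; rewrite rdesE; last lia.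
have := odd_dn D; rewrite -[n in odd n]prednK /=; last lia.
by move=> /negbFE ->; rewrite addbF eqxx andbT; lia.
Qed.

Lemma sub_low : [set 1%g; gen r] \subset [set: W] :\: J.
Proof. by apply/fintype.subsetP => y; rewrite !inE andbT => /orP[] /eqP ->; rewrite ?rdes1 ?rdes_gr. Qed.

Lemma sub_high : [set w0; w0r] \subset J.
Proof. by apply/fintype.subsetP => y; rewrite !inE => /orP[] /eqP ->; rewrite ?rdes_w0 ?rdes_w0r. Qed.

Lemma setJ_low y : rdes be y -> (y == 1%g) = false /\ (y == gen r) = false.
Proof. by move=> dy; split; apply/eqP => E; move: dy; rewrite E ?rdes1 ?rdes_gr. Qed.

Lemma setJ_high y : ~~ rdes be y -> (y == w0) = false /\ (y == w0r) = false.
Proof. by move=> dy; split; apply/eqP => E; move: dy; rewrite E ?rdes_w0 ?rdes_w0r. Qed.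

Lemma lcell_KH x : [\/ lcell (KH be) x = [set 1%g; gen r], lcell (KH be) x = [set w0; w0r],
  lcell (KH be) x = J :\: [set w0; w0r] |
  lcell (KH be) x = ([set: W] :\: J) :\: [set 1%g; gen r]].
Proof.
have [x1|x1] := boolP (x \in [set 1%g; gen r]).
  apply: Or41; apply/setP => y; rewrite [LHS]inE /= /relH /= x1.
  have dx : rdes be x = false by move: x1; rewrite !inE => /orP[] /eqP ->; rewrite ?rdes1 ?rdes_gr.
  case: (boolP (y \in [set 1%g; gen r])) => //= y1.
  have dy : rdes be y = false by move: y1; rewrite !inE => /orP[] /eqP ->; rewrite ?rdes1 ?rdes_gr.
  by rewrite !inE; have [-> ->] := setJ_high (negbT dx); have [-> ->] := setJ_high (negbT dy); rewrite dx dy.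
have [x2|x2] := boolP (x \in [set w0; w0r]).
  apply: Or42; apply/setP => y; rewrite [LHS]inE /= /relH /= x2.
  have dx : rdes be x by move: x2; rewrite !inE => /orP[] /eqP ->; rewrite ?rdes_w0 ?rdes_w0r.
  case: (boolP (y \in [set w0; w0r])) => //= y2; last by rewrite andbF.
  have dy : rdes be y by move: y2; rewrite !inE => /orP[] /eqP ->; rewrite ?rdes_w0 ?rdes_w0r.
  by rewrite !inE; have [-> ->] := setJ_low dx; have [-> ->] := setJ_low dy; rewrite dx dy.
case dx : (rdes be x); [apply: Or43 | apply: Or44]; apply/setP => y;
  rewrite [LHS]inE /= /relH /= (negPf x1) (negPf x2) dx !(eq_sym false) !eqbF_neg;
  rewrite [RHS]inE; case dy : (rdes be y); rewrite ?andbF /= ?dy ?andbT /=.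
- by rewrite !inE dy andbT; have [-> ->] := setJ_low dy; rewrite /=.
- by rewrite [y \in J]inE dy andbF.
- by rewrite !inE dy !andbF.
- by rewrite !inE dy; have [-> ->] := setJ_high (negbT dy); rewrite /= ?andbT ?negb_or.
Qed.

Lemma lcell_KG x : [\/ lcell (KG be) x = [set x] /\ x \in [set 1%g; gen r] :|: [set w0; w0r],
  lcell (KG be) x = J :\: [set w0; w0r] |
  lcell (KG be) x = ([set: W] :\: J) :\: [set 1%g; gen r]].
Proof.
have [xs|xs] := boolP (special D be x).
  apply: Or31; split; last by move: xs; rewrite /special !inE; do 4 case: (_ == _).
  apply/setP => y; rewrite !inE /= /relG /=; apply/idP/eqP => [/and5P[e1 e2 e3 e4 _]|->].
    by apply/esym/(special_eq xs); rewrite e1 e2 e3.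
  by rewrite !eqxx.
move: xs; rewrite !negb_or => /and4P[x1 x2 x3 x4].
case dx : (rdes be x); [apply: Or32 | apply: Or33]; apply/setP => y;
  rewrite !inE /= /relG /= (negPf x1) (negPf x2) (negPf x3) (negPf x4) dx /=;
  rewrite !(eq_sym false) !eqbF_neg ?negb_or; case dy : (rdes be y); rewrite ?andbF //.
- by have [-> ->] := setJ_low dy; rewrite /= ?andbT ?negb_or.
- by have [-> ->] := setJ_high (negbT dy); rewrite /= ?andbT ?negb_or.
Qed.

End Shape.

Lemma lcell_KE x : [\/ lcell KE x = [set 1%g], lcell KE x = [set w0],
  lcell KE x = [set y | rdes true y] :\: [set w0] |
  lcell KE x = ([set: W] :\: [set y | rdes true y]) :\: [set 1%g]].
Proof.
have h1 y : rdes true y -> (y == 1%g) = false.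
  by move=> dy; apply/eqP => E; move: dy; rewrite E rdes1.
have h2 y : rdes true y = false -> (y == w0) = false.
  by move=> dy; apply/eqP => E; move: dy; rewrite E rdes_w0.
have [x1|x1] := eqVneq x 1%g.
  apply: Or41; apply/setP => y; rewrite !inE /= /relE /= x1 eqxx rdes1.
  by case: (eqVneq y 1%g) => [->|_] //; rewrite rdes1 !eqxx.
have [x2|x2] := eqVneq x w0.
  apply: Or42; apply/setP => y; rewrite !inE /= /relE /= x2 eqxx rdes_w0.
  by case: (eqVneq y w0) => [->|_]; rewrite ?andbF // rdes_w0 !eqxx.
case dx : (rdes true x); [apply: Or43 | apply: Or44]; apply/setP => y;
  rewrite !inE /= /relE /= (negPf x1) (negPf x2) dx /= !(eq_sym false) !eqbF_neg;
  case dy : (rdes true y); rewrite ?andbF //.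
- by rewrite (h1 _ dy) /= !andbT.
- by rewrite (h2 _ dy) /= !andbT.
Qed.

Context (G G' : orderedZmod) (phi : Sbar (dS D) -> G) (phi' : Sbar (dS D) -> G').
Context (ck : kcase) (be : bool).
Context (cs : is_case phi ck) (cs' : is_case phi' (KG be)).
Context (compat : case_refines ck be).
Context (signs_eq : forall b, wt phi b != 0 -> wsg phi b = wsg phi' b).
Local Notation chi := (cell_char phi).
Local Notation chi' := (cell_char phi').

Lemma chi_setT w : chi [set: W] w = chi' [set: W] w.
Proof. by rewrite (char_all _ cs) (char_all _ cs'). Qed.

Lemma wt_neq0 b : nondeg ck b -> wt phi b != 0.
Proof.
case: (ck) cs => [||b'|b'] //=; first by case=> _ + _; apply.
  case=> lt nz _; have [->|nb] := eqVneq b (~~ b'); first by [].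
  have -> : b = b' by move: nb; case: (b); case: (b').
  apply: contraTneq lt => z; rewrite oz_ltNge negbK.
  by rewrite {1}/wabs /wneg z oz_le_refl wabs_ge0.
by case=> _ nz /eqP ->.
Qed.

Lemma chi_rdes b w : nondeg ck b -> chi [set y | rdes b y] w = chi' [set y | rdes b y] w.
Proof.
move=> nd; rewrite (char_rdes _ cs nd) (char_rdes _ cs') //.
by rewrite signs_eq // wt_neq0.
Qed.

Lemma chi'_low w : chi' [set 1%g; gen (~~ be)] w = chi' [set 1%g] w + chi' [set gen (~~ be)] w.
Proof.
rewrite (char_disj _ cs') // disjoints1 inE eq_sym; exact: gen_neq1.
Qed.

Lemma chi'_high w : chi' [set w0; wd be n.-1] w = chi' [set w0] w + chi' [set wd be n.-1] w.
Proof.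
rewrite (char_disj _ cs') // disjoints1 inE eq_sym eq_w0; have := dn_ge4 D; lia.
Qed.

Lemma lcell_KZ x : lcell KZ x = [set: W].
Proof. by apply/setP => y; rewrite !inE. Qed.

(** Each shape of left cell is assembled from sets whose characters agree on both sides: the regular
    character, induced characters that depend on one sign only, and sums of linear characters. *)
Lemma char_compare x w : chi (lcell ck x) w = chi' (lcell ck x) w.
Proof.
have [b0 [i [iN ->]]] := wd_exists D w; have R b := @chi_rdes b (wd b0 i).
have A := chi_setT (wd b0 i); have wn := wt_neq0; have cs0 := cs.
have sJ b : [set y | rdes b y] \subset [set: W] by apply/fintype.subsetP => y; rewrite inE.
have B1 : (if ck is KE then true else if ck is KG _ then true else false) ->
    chi [set 1%g] (wd b0 i) = chi' [set 1%g] (wd b0 i).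
  move=> e; rewrite (char_1 _ cs) // (char_1 _ cs') //; apply: eq_mon => b.
  by rewrite signs_eq //; apply: wn; move: e; case: (ck).
have Bw : (if ck is KE then true else if ck is KG _ then true else false) ->
    chi [set w0] (wd b0 i) = chi' [set w0] (wd b0 i).
  move=> e; rewrite (char_w0 _ cs) // (char_w0 _ cs') //; apply: eq_mon => b.
  by rewrite signs_eq //; apply: wn; move: e; case: (ck).
case E : (ck) => [||b|b].
- by rewrite lcell_KZ.
- rewrite E in B1 Bw R cs0.
  have s1 : [set w0] \subset [set y | rdes true y].
    by apply/fintype.subsetP => y; rewrite !inE => /eqP ->; rewrite rdes_w0.
  have s2 : [set 1%g] \subset [set: W] :\: [set y | rdes true y].
    by apply/fintype.subsetP => y; rewrite !inE => /eqP ->; rewrite rdes1.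
  case: (lcell_KE x) => ->; rewrite ?B1 ?Bw //.
    by rewrite !(char_diff _ cs) ?(char_diff _ cs') // R // Bw.
  by rewrite !(char_diff _ cs) ?(char_diff _ cs') // A R // B1.
- have bE : b = be by move: compat; rewrite E => /eqP.
  rewrite {}bE in E *; rewrite E in B1 Bw R wn cs0.
  have Sg b1 : wsg phi b1 = wsg phi' b1 by apply: signs_eq; apply: wn.
  have Cr : chi [set gen (~~ be)] (wd b0 i) = chi' [set gen (~~ be)] (wd b0 i).
    by rewrite (char_r _ cs0) // (char_r _ cs') // !Sg.
  have Cw : chi [set wd be n.-1] (wd b0 i) = chi' [set wd be n.-1] (wd b0 i).
    by rewrite (char_w0r _ cs0) // (char_w0r _ cs') // !Sg.
  have Cl : chi [set 1%g; gen (~~ be)] (wd b0 i) = chi' [set 1%g; gen (~~ be)] (wd b0 i).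
    rewrite chi'_low (char_disj _ cs) ?B1 ?Cr //.
    by rewrite disjoints1 inE eq_sym; exact: gen_neq1.
  have Ch : chi [set w0; wd be n.-1] (wd b0 i) = chi' [set w0; wd be n.-1] (wd b0 i).
    rewrite chi'_high (char_disj _ cs) ?Bw ?Cw //.
    by rewrite disjoints1 inE eq_sym eq_w0; have := dn_ge4 D; lia.
  case: (lcell_KG be x) => [[-> xs]|->|->].
  + by move: xs; rewrite !inE -orbA => /or4P[] /eqP ->; rewrite ?B1 ?Bw.
  + by rewrite !(char_diff _ cs) ?(char_diff _ cs') ?sub_high // R // Ch.
  + by rewrite !(char_diff _ cs) ?(char_diff _ cs') ?sub_low // A R // Cl.
- have bE : b = be by move: compat; rewrite E => /eqP.
  rewrite {}bE in E *; rewrite E in R wn cs0.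
  have Sg : wsg phi be = wsg phi' be by apply: signs_eq; apply: wn => /=.
  (* The pair carries both linear characters with the prescribed sign at [gen be]. In the chamber
     they are distributed over two cells, in an order that depends on the sign acquired by the other
     weight. *)
  have Cl : chi [set 1%g; gen (~~ be)] (wd b0 i) = chi' [set 1%g; gen (~~ be)] (wd b0 i).
    rewrite chi'_low (char_pair1 _ cs0) // (char_1 _ cs') // (char_r _ cs') // Sg.
    rewrite (eq_mon (v := fun b => - wsg phi' b) (v' := signs be (- wsg phi' be) (- wsg phi' (~~ be)))).
      by case: (wsgE phi' (~~ be)) => ->; rewrite ?opprK // addrC.
    move=> b1; rewrite /signs; case: eqP => [->//|nb].
    by have -> : b1 = ~~ be by move: nb; case: (b1); case: (be).
  have Ch : chi [set w0; wd be n.-1] (wd b0 i) = chi' [set w0; wd be n.-1] (wd b0 i).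
    rewrite chi'_high (char_pairw0 _ cs0) // (char_w0 _ cs') // (char_w0r _ cs') // Sg.
    rewrite (eq_mon (v := wsg phi') (v' := signs be (wsg phi' be) (wsg phi' (~~ be)))).
      by case: (wsgE phi' (~~ be)) => ->; rewrite ?opprK // addrC.
    move=> b1; rewrite /signs; case: eqP => [->//|nb].
    by have -> : b1 = ~~ be by move: nb; case: (b1); case: (be).
  case: (lcell_KH be x) => ->; rewrite ?Cl ?Ch //.
    by rewrite !(char_diff _ cs) ?(char_diff _ cs') ?sub_high // R ?Ch //=.
  by rewrite !(char_diff _ cs) ?(char_diff _ cs') ?sub_low // A R ?Cl //=.
Qed.

End Comparison.

(** * Positive subsets and facets *)

Section PositiveTheory.
Local Open Scope classical_set_scope.
Local Open Scope ring_scope.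
Context (L : zmodType).
Implicit Types (X Y Z : Pos L) (l : L).

Lemma positive_intro (X : set L) : (forall l, X l \/ X (- l)) ->
  (forall x y, X x -> X y -> X (x + y)) -> positive X.
Proof.
move=> Xt Xa; have X0 : X 0 by have [|] := Xt 0; rewrite ?oppr0.
have sE l : symm_part X l <-> X l /\ X (- l).
  split=> [[Xl [y Xy yl]]|[Xl Xnl]]; first by rewrite -{2}yl opprK.
  by split=> //; exists (- l); rewrite ?opprK.
split.
- apply/seteqP; split=> // l _; have [|Xl] := Xt l; first by left.
  by right; exists (- l); rewrite ?opprK.
- by move=> _ [x Xx [y Xy <-]]; apply: Xa.
split; first by apply/mem_set/sE; rewrite oppr0.
move=> x y /set_mem/sE[x1 x2] /set_mem/sE[y1 y2]; apply/mem_set/sE.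
by rewrite opprB addrC; split; [apply: Xa | rewrite addrC; apply: Xa].
Qed.

Definition lex_set X Z : set L := [set l | pos_set X l /\ (pos_set X (- l) -> pos_set Z l)].

Lemma lex_positive X Z : positive (lex_set X Z).
Proof.
apply: positive_intro => [l|x y [Xx Zx] [Xy Zy]].
  have [Xl|Xl] := pselect (pos_set X l); have [Xn|Xn] := pselect (pos_set X (- l)).
  - by have [Zl|Zl] := pos_total Z l; [left|right]; split=> //; rewrite opprK.
  - by left.
  - by right; split=> //; rewrite opprK.
  - by have [] := pos_total X l.
split; first exact: pos_addr.
rewrite opprD => Xn; apply: pos_addr.
  by apply: Zx; have := pos_addr Xn Xy; rewrite subrK.
by apply: Zy; have := pos_addr Xn Xx; rewrite addrAC addNr add0r.
Qed.

(* [lex X Z] refines the order defined by [X] by that defined by [Z]. *)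
Definition lex X Z : Pos L := MkPos (lex_positive X Z).

Lemma half_positive (f : L -> int) : {morph f : x y / x - y} ->
  positive [set l : L | 0 <= f l].
Proof.
move=> fB; have f0 : f 0 = 0 by rewrite -(subrr 0) fB subrr.
have fN x : f (- x) = - f x by rewrite -sub0r fB f0 sub0r.
apply: positive_intro => [l|x y] /=.
  by rewrite fN oppr_ge0; apply/orP; exact: le_total.
by move=> x0 y0; rewrite -{1}[y]opprK fB fN opprK addr_ge0.
Qed.

Definition halfpos (f : L -> int) (fB : {morph f : x y / x - y}) : Pos L :=
  MkPos (half_positive fB).

Lemma halfUE l X : halfU l X <-> ~ pos_set X l.
Proof.
rewrite /halfU /basicU /=; split=> [/seteqP[H _] Xl|Xl]; first by have [] := H l.
by apply/seteqP; split=> // y [Xy /= yl]; apply: Xl; rewrite -yl.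
Qed.

Lemma hyperplaneE l X : hyperplane l X <-> pos_set X l /\ pos_set X (- l).
Proof. exact: symm_partE. Qed.

Lemma pos_mulrn X l i : pos_set X l -> pos_set X (l *+ i.+1).
Proof. by move=> Xl; elim: i => // i IH; rewrite mulrS; apply: pos_addr. Qed.

(** If [x] were not in [X], totality would put [- x] in it, and adding copies of [- x] to the given
    multiple would give back [x]. *)
Lemma pos_mulrz_symm X l (z : int) : z != 0 -> hyperplane (l *~ z) X <-> hyperplane l X.
Proof.
move=> z0; rewrite !hyperplaneE.
have H i x : pos_set X (x *+ i.+1) -> pos_set X (- (x *+ i.+1)) -> pos_set X x.
  move=> X1 X2; have [//|Xn] := pos_total X x.
  case: i X1 X2 => [//|i] X1 X2.
  have := pos_addr X1 (pos_mulrn i Xn).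
  by rewrite mulNrn mulrSr addrAC subrr add0r.
have K i x : (pos_set X (x *+ i.+1) /\ pos_set X (- (x *+ i.+1))) <-> (pos_set X x /\ pos_set X (- x)).
  split=> [[X1 X2]|[X1 X2]].
    split; first exact: (H i).
    by apply: (H i); rewrite mulNrn ?opprK.
  by rewrite -mulNrn; split; apply: pos_mulrn.
case: z z0 => [[|i]|i] // _; first exact: K.
by rewrite NegzE mulrNz opprK -(K i l) and_comm.
Qed.

Lemma arr_equivP (A : set (set (Pos L))) X Y :
  arr_equiv A X Y <-> forall l, l != 0 -> A (hyperplane l) ->
    (pos_set X l <-> pos_set Y l) /\ (pos_set X (- l) <-> pos_set Y (- l)).
Proof.
split=> H l l0 Al.
  have [/iff_not2 h1 _ /iff_not2 h2] := H l l0 Al; move: h1 h2.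
  by rewrite !halfUE !notK.
have [h1 h2] := H l l0 Al; split; rewrite ?halfUE ?hyperplaneE; tauto.
Qed.

Lemma arr_equiv_refl (A : set (set (Pos L))) X : arr_equiv A X X.
Proof. by move=> l _ _; split. Qed.

Lemma arr_equiv_sym (A : set (set (Pos L))) X Y : arr_equiv A X Y -> arr_equiv A Y X.
Proof. by move/arr_equivP => H; apply/arr_equivP => l l0 Al; have [-> ->] := H l l0 Al. Qed.

Lemma arr_equiv_trans (A : set (set (Pos L))) X Y Z :
  arr_equiv A X Y -> arr_equiv A Y Z -> arr_equiv A X Z.
Proof.
move=> /arr_equivP H /arr_equivP K; apply/arr_equivP => l l0 Al.
by have [-> ->] := H l l0 Al; apply: K.
Qed.

(** Not containing [l] is an open condition on [X]. *)
Lemma closure_avoid (F : set (Pos L)) X l : closure F X -> ~ pos_set X l ->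
  exists2 Y, F Y & ~ pos_set Y l.
Proof.
move=> cl Xl; have oU : open (halfU l : set (Pos L)).
  exists [set [set l]]; first by move=> _ ->; exact: finite_set1.
  by rewrite bigcup_set1.
have [|Y [FY /halfUE Yl]] := cl (halfU l); last by exists Y.
by apply: open_nbhs_nbhs; split => //; apply/halfUE.
Qed.

(** [lex X Z] is a subset of [X], so every basic open set that contains [X] also contains it. *)
Lemma lex_closure (F : set (Pos L)) X Z : F (lex X Z) -> closure F X.
Proof.
move=> FY B; rewrite nbhsE => -[U [[E' fE UE] UX] UB]; exists (lex X Z); split=> //; apply: UB.
rewrite -UE in UX *; case: UX => E E'E XE; exists E => //.
rewrite /basicU /= in XE *; apply/seteqP; split=> // l [[Xl _] El].
by rewrite -XE; split.
Qed.

End PositiveTheory.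

(** * The four hyperplanes and the signs that they detect *)

Section Signs.
Local Open Scope classical_set_scope.
Local Open Scope ring_scope.
Context (W : finGroupType) (D : dihedral W).
Local Notation gen := (dgen D).
Local Notation L := (ZSbar (dS D)).
Local Notation osb := (osb D).
Implicit Types (X Y Z : Pos L) (l : L) (b be : bool).

Definition es b : L := egen (dS D) (gen b).

Lemma esE b o : es b o = (gen b \in val o)%:R.
Proof. exact: ffunE. Qed.

Lemma es_ebar b : ebar (osb b) = es b.
Proof.
apply/ffunP => o; rewrite esE ffunE; have [c ->] := osbP o.
by rewrite mem_osb (inj_eq (@osb_inj _ D)) (inj_eq (@dgen_inj _ D)) eq_sym.
Qed.

Lemma es_osb b c : es b (osb c) = (b == c)%:R.
Proof. by rewrite esE mem_osb (inj_eq (@dgen_inj _ D)). Qed.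

Definition is_vec l : Prop :=
  [\/ exists b, l = es b, l = es true - es false | l = es true + es false].

Definition arr4 : set (set (Pos L)) :=
  [set hyperplane (es true); hyperplane (es false);
       hyperplane (es true - es false); hyperplane (es true + es false)].

Lemma arr4P A : arr4 A <-> exists2 l, is_vec l & A = hyperplane l.
Proof.
split.
  by case=> [[[]|]|] ->; [exists (es true) | exists (es false) |
    exists (es true - es false) | exists (es true + es false)] => //;
    [apply: Or31; exists true | apply: Or31; exists false | apply: Or32 | apply: Or33].
case=> l [[[] ->]|->|->] ->; [left;left;left|left;left;right|left;right|right]; by [].
Qed.

Lemma arr4_vec l : is_vec l -> arr4 (hyperplane l).
Proof. by move=> v; apply/arr4P; exists l. Qed.

Lemma ffun_val_neq0 l o : l o != 0 -> l != 0.
Proof. by apply: contraNneq => ->; rewrite ffunE. Qed.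

Lemma vec_neq0 l : is_vec l -> l != 0.
Proof.
case=> [[b ->]|->|->].
- by apply: (@ffun_val_neq0 _ (osb b)); rewrite es_osb eqxx.
- by apply: (@ffun_val_neq0 _ (osb true)); rewrite !ffunE -!/(es _ _) !mem_osb !(inj_eq (@dgen_inj _ D)).
- by apply: (@ffun_val_neq0 _ (osb true)); rewrite !ffunE !mem_osb !(inj_eq (@dgen_inj _ D)).
Qed.

Definition agree X Y := forall l, is_vec l ->
  (pos_set X l <-> pos_set Y l) /\ (pos_set X (- l) <-> pos_set Y (- l)).

Lemma arr4_agree X Y : arr_equiv arr4 X Y -> agree X Y.
Proof. by move=> /arr_equivP H l v; apply: H; [exact: vec_neq0 | exact: arr4_vec]. Qed.

Local Notation wt X := (wt (phiX X)).
Local Notation wneg X := (wneg (phiX X)).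
Local Notation wabs X := (wabs (phiX X)).
Local Notation wsg X := (wsg (phiX X)).

Lemma wtE X b : wt X b = toGamma X (es b).
Proof. by rewrite /(wt _) /phiX es_ebar. Qed.

Lemma wt_eq0 X b : wt X b = 0 <-> pos_set X (es b) /\ pos_set X (- es b).
Proof.
rewrite wtE; have := toGamma_eq0 X (es b) => E; rewrite -symm_partE.
by split=> [/eqP|H]; [rewrite E => /set_mem | apply/eqP; rewrite E; apply/mem_set].
Qed.

Lemma toGamma0 X : toGamma X 0 = 0.
Proof. by rewrite -(subrr 0) toGammaB subrr. Qed.

Lemma toGammaN X l : toGamma X (- l) = - toGamma X l.
Proof. by rewrite -sub0r toGammaB toGamma0 sub0r. Qed.

Lemma wnegE X b : wneg X b = ~~ `[< pos_set X (es b) >].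
Proof.
rewrite /(wneg _) wtE -(toGamma0 X); congr (~~ _).
by apply/idP/asboolP => [/Gamma_leE|H]; [rewrite subr0 | apply/Gamma_leE; rewrite subr0].
Qed.

(** Lifts [wabs] to the lattice, where different points can be compared although their ordered
    groups differ. *)
Definition vab X b : L := if wneg X b then - es b else es b.

Lemma wabsE X b : wabs X b = toGamma X (vab X b).
Proof. by rewrite /(wabs _) /vab; case: ifP => _; rewrite ?toGammaN wtE. Qed.

Lemma vab_pos X b : pos_set X (vab X b).
Proof.
rewrite /vab wnegE; case: asboolP => //= H.
by have [//|//] := pos_total X (es b).
Qed.

Lemma vab_neg X b : wt X b != 0 -> ~ pos_set X (- vab X b).
Proof.
move=> /eqP nz H; apply: nz; apply/wt_eq0; have := vab_pos X b.
by move: H; rewrite /vab; case: (wneg X b); rewrite ?opprK.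
Qed.

Lemma wabs_lt X b b' : oz_lt (wabs X b) (wabs X b') <-> ~ pos_set X (vab X b - vab X b').
Proof.
rewrite !wabsE oz_ltNge; split=> [/negP H Xd|H]; first by apply/H/Gamma_leE.
by apply/negP => /Gamma_leE.
Qed.

Lemma wabs_eq X b b' : wabs X b = wabs X b' <->
  pos_set X (vab X b - vab X b') /\ pos_set X (vab X b' - vab X b).
Proof.
rewrite !wabsE; split=> [e|[H1 H2]].
  by split; apply/Gamma_leE; rewrite e; apply: Gamma_le_refl.
by apply: Gamma_le_anti; apply/andP; split; apply/Gamma_leE.
Qed.

(** Comparing the absolute weights thus amounts to a sign on the hyperplane of [s - t] or
    [s + t]. *)
Lemma vab_diff X b : exists2 l, is_vec l &
  vab X b - vab X (~~ b) = l \/ vab X b - vab X (~~ b) = - l.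
Proof.
rewrite /vab; case: b => /=; case: (wneg X _); case: (wneg X _); rewrite ?opprK.
- exists (es true - es false); [exact: Or32 | right; by rewrite opprB addrC].
- exists (es true + es false); [exact: Or33 | right; by rewrite opprD].
- exists (es true + es false); [exact: Or33 | by left].
- exists (es true - es false); [exact: Or32 | by left].
- exists (es true - es false); [exact: Or32 | left; by rewrite addrC].
- exists (es true + es false); [exact: Or33 | right; by rewrite opprD addrC].
- exists (es true + es false); [exact: Or33 | left; by rewrite addrC].
- exists (es true - es false); [exact: Or32 | right; by rewrite opprB].
Qed.

Lemma vec_es b : is_vec (es b). Proof. by apply: Or31; exists b. Qed.

Lemma agree_vab X Y b : agree X Y -> vab X b = vab Y b.
Proof. by move=> /(_ _ (vec_es b))[H _]; rewrite /vab !wnegE (propext H). Qed.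

Lemma agree_diff X Y b : agree X Y ->
  pos_set X (vab X b - vab X (~~ b)) <-> pos_set Y (vab Y b - vab Y (~~ b)).
Proof.
move=> A; rewrite -!(agree_vab _ A); have [l v [|] ->] := vab_diff X b.
  exact: (A _ v).1.
exact: (A _ v).2.
Qed.

Lemma agree_case X Y ck : agree X Y -> is_case (phiX X) ck -> is_case (phiX Y) ck.
Proof.
move=> A.
have W0 b : wt X b = 0 <-> wt Y b = 0.
  by rewrite !wt_eq0; have [-> ->] := A _ (vec_es b).
have W1 b : wt X b != 0 -> wt Y b != 0 by move=> /eqP H; apply/eqP => /W0.
have lt b : oz_lt (wabs X (~~ b)) (wabs X b) -> oz_lt (wabs Y (~~ b)) (wabs Y b).
  rewrite !wabs_lt; have := agree_diff (~~ b) A; rewrite negbK; tauto.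
case: ck => [||be|be] /=.
- by move=> H b; apply/W0.
- move=> [/wabs_eq[H1 H2] H]; split; last by move=> b; apply: W1.
  by apply/wabs_eq; split; [apply/(agree_diff true A) | apply/(agree_diff false A)].
- by move=> [/lt H /W1].
- by move=> [/W0 H /W1].
Qed.

Definition generic Y := forall l, is_vec l -> ~ (pos_set Y l /\ pos_set Y (- l)).
(** Strict inequalities at [X] persist at [Y]; this is how closure points of a chamber are seen on
    the four hyperplanes. *)
Definition refines X Y := forall l, is_vec l ->
  (~ pos_set X l -> ~ pos_set Y l) /\ (~ pos_set X (- l) -> ~ pos_set Y (- l)).

Lemma refines_diff X Y Z b : refines X Y ->
  ~ pos_set X (vab Z b - vab Z (~~ b)) -> ~ pos_set Y (vab Z b - vab Z (~~ b)).
Proof.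
move=> A; have [l v [|] ->] := vab_diff Z b; first exact: (A _ v).1.
exact: (A _ v).2.
Qed.

Lemma generic_wt Y b : generic Y -> wt Y b != 0.
Proof. by move=> g; apply/eqP => /wt_eq0; apply: g; apply: vec_es. Qed.

Lemma generic_KG Y : generic Y -> exists be, is_case (phiX Y) (KG be).
Proof.
move=> g; have [[||be|be] /= cs] := case_exists (phiX Y); last 1 first.
- by have := generic_wt (~~ be) g; rewrite cs.1 eqxx.
- by have := generic_wt true g; rewrite cs eqxx.
- have [/wabs_eq[H1 H2] _] := cs; have [l v E] := vab_diff Y true.
  case: (g _ v); move: H1 H2; rewrite -[_ false]/(vab Y (~~ true)) -[vab Y (~~ true) - _]opprB.
  by case: E => ->; rewrite ?opprK.
- by exists be.
Qed.

Lemma refines_sign X Y b : refines X Y -> wt X b != 0 -> wneg X b = wneg Y b.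
Proof.
move=> rf /eqP nz; have [r1 r2] := rf _ (vec_es b); rewrite !wnegE.
case: (asboolP (pos_set X (es b))) => [Xp|Xn] /=; last first.
  by case: asboolP => // /r1; case.
have Xn : ~ pos_set X (- es b) by move=> Xn; apply: nz; apply/wt_eq0.
by case: asboolP => // Yp; have [|/(r2 Xn)] := pos_total Y (es b).
Qed.

(** Strict domination at [X] is a strict inequality, so it persists. In the same way a nonzero
    weight dominates a vanishing one after refinement, whatever sign the latter acquires. *)
Lemma refines_compat X Y ck be : is_case (phiX X) ck -> refines X Y ->
  is_case (phiX Y) (KG be) -> case_refines ck be.
Proof.
move=> cs rf [/wabs_lt lt nz].
have key b : wt X b != 0 -> ~ pos_set X (vab Y (~~ b) - vab X b) -> b == be.
  move=> nzb H; have vE : vab Y b = vab X b by rewrite /vab (refines_sign rf nzb).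
  have [//|nb] := eqVneq b be; have bE : b = ~~ be by move: nb; case: (b); case: (be).
  subst b; exfalso; move: H; rewrite -vE negbK => H; have {}H := refines_diff rf H.
  have [] := pos_total Y (vab Y be - vab Y (~~ be)) => //.
  by rewrite opprB.
case: ck cs => [||b|b] //= [c1 c2].
  have nzb : wt X b != 0.
    apply: contraTneq c1 => z; rewrite oz_ltNge negbK.
    by rewrite {1}/(wabs _) /(wneg _) z oz_le_refl wabs_ge0.
  apply: key => //; have -> : vab Y (~~ b) = vab X (~~ b) by rewrite /vab (refines_sign rf c2).
  exact/wabs_lt.
apply: key => // H; have /wt_eq0[z1 z2] := c1.
have Xn : pos_set X (- vab Y (~~ b)) by rewrite /vab; case: ifP; rewrite ?opprK.
by apply: (vab_neg c2); have := pos_addr H Xn; rewrite addrAC subrr add0r.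
Qed.

Lemma chamber_refines Dm X Y : chamber arr4 Dm -> closure Dm X -> Dm Y ->
  refines X Y /\ generic Y.
Proof.
move=> [[X1 DE] ch] cl DY; split=> l v.
  have eqv Y' : Dm Y' -> agree Y Y'.
    move=> DY'; apply: arr4_agree; move: DY DY'; rewrite DE /= => e e'.
    exact: arr_equiv_trans (arr_equiv_sym e) e'.
  by split=> nX; have [Y' /eqv /(_ _ v) [e1 e2] nY] := closure_avoid cl nX; tauto.
move=> H; have := ch _ (arr4_vec v) => /seteqP[/(_ Y) K _]; apply: K; split=> //.
exact/hyperplaneE.
Qed.

Lemma refines_wsg X Y b : refines X Y -> wt X b != 0 -> wsg X b = wsg Y b.
Proof. by move=> rf nz; rewrite /(wsg _) (refines_sign rf nz). Qed.

End Signs.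

(** * How the cells of adjacent chambers merge *)

Section Combinatorics.
Local Arguments wd : simpl never.
Local Open Scope group_scope.
Context (W : finGroupType) (D : dihedral W).
Local Notation gen := (dgen D).
Local Notation n := (dn D).
Local Notation wd := (wd D).
Local Notation rdes := (rdes D).
Local Notation ldes := (ldes D).
Local Notation w0 := (w0 D).
Local Notation tail := (tail D).
Implicit Types (b be : bool) (w x y : W) (k : side) (C : {set W}).

Lemma case_rel_equiv ck k : equivalence_rel (case_rel D ck k).
Proof.
case: ck => [||be|be] x y z //=; rewrite /relE /relG /relH !eqxx; split=> //.
- by case/and3P => /eqP -> /eqP -> /eqP ->.
- by case/and5P => /eqP -> /eqP -> /eqP -> /eqP -> /eqP ->.
- by case/and3P => /eqP -> /eqP -> /eqP ->.
Qed.

Lemma case_rel_refl ck k x : case_rel D ck k x x.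
Proof. by case: (case_rel_equiv ck k x x x). Qed.

Lemma case_rel_sym ck k x y : case_rel D ck k x y -> case_rel D ck k y x.
Proof. by move=> H; have [_ /(_ H) <-] := case_rel_equiv ck k x y x; apply: case_rel_refl. Qed.

Lemma case_rel_trans ck k x y z :
  case_rel D ck k x y -> case_rel D ck k y z -> case_rel D ck k x z.
Proof. by move=> H; have [_ /(_ H) ->] := case_rel_equiv ck k x y z. Qed.

Lemma rdesN x : x != 1 -> x != w0 -> rdes false x = ~~ rdes true x.
Proof.
have [b [i [iN ->]]] := wd_exists D x; rewrite eq_1 // eq_w0 // => i0 /negPf iN'.
by rewrite !rdesE // iN' !orbF; case: i i0 {iN iN'} => // i _; case: b; case: (odd i).
Qed.

Lemma tailN k x : x != 1 -> x != w0 ->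
  tail k false x = (if k is TwoSided then false else ~~ tail k true x).
Proof.
move=> x1 x0; case: k => //=; first exact: rdesN.
by rewrite -[x]invgK; apply: rdesN; rewrite ?(eq_inv _ (invg1 W)) ?(eq_inv _ (w0V D)).
Qed.

(** [relE] refers to [gen true] even if [be] is [false]. Outside [1] and [w0] exactly one generator
    is a descent on a given side, so either one carries the same information. *)
Lemma coarsen ck be k x y : case_refines ck be ->
  relG D be k x y -> case_rel D ck k x y.
Proof.
case: ck => [||b|b] //=; last first.
- move=> /eqP -> /and5P[/eqP e1 /eqP e2 /eqP e3 /eqP e4 e5].
  by rewrite /relH !inE e1 e2 e3 e4 e5 !eqxx.
- by move/eqP ->.
move=> _ /and5P[/eqP e1 /eqP e2 _ _ /eqP e5].
rewrite /relE e1 e2 !eqxx /=.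
case: be e5 => e5; first by rewrite e5.
have [x1|x1] := eqVneq x 1.
  have /eqP yE : y == 1 by rewrite -e1 x1 eqxx.
  by rewrite x1 yE eqxx.
have [x2|x2] := eqVneq x w0.
  have /eqP yE : y == w0 by rewrite -e2 x2 eqxx.
  by rewrite x2 yE eqxx.
have y1 : y != 1 by rewrite -e1.
have y2 : y != w0 by rewrite -e2.
by move: e5; rewrite !tailN //; case: (k) => //; [move/negb_inj ->|move/negb_inj ->].
Qed.

(* The cells of the two adjacent chambers merge, because a word of length two is
   special in neither of them. *)
Lemma relE_chain k C : (forall be x y, x \in C -> relG D be k x y -> y \in C) ->
  forall x y, x \in C -> relE D k x y -> y \in C.
Proof.
have n1 : (1%N == n.-1 = false) * (n.-1 == 1%N = false) * (0 < n).
  by have := dn_ge4 D; case: (n) => [|[|[|i]]].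
move=> cl x y xC /and3P[/eqP e1 /eqP e2 /eqP e5]; have n4 := dn_ge4 D.
have [x1|x1] := eqVneq x 1.
  have /eqP -> : y == 1 by rewrite -e1 x1.
  by rewrite -x1.
have [x2|x2] := eqVneq x w0.
  have /eqP -> : y == w0 by rewrite -e2 x2.
  by rewrite -x2.
have y1 : y != 1 by rewrite -e1.
have y2 : y != w0 by rewrite -e2.
have h2 : 2 <= n by lia.
have h3 : n.-1 <= n by lia.
have [b zt] : exists b, tail k true (wd b 2) = tail k true x.
  case: k {e5 cl} => /=; [exists (~~ rdes true x) | exists (ldes true x) | by exists true].
    rewrite rdesE // (_ : (2%N == n) = false); last lia.
    by case: (rdes true x).
  rewrite ldesE // (_ : (2%N == n) = false); last lia.
  by case: (ldes true x).
set z := wd b 2 in zt.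
have z1 : z == 1 = false by rewrite eq_1.
have z2 : z == w0 = false by rewrite eq_w0 //; lia.
have z3 be : z == gen (~~ be) = false by rewrite eq_r.
have z4 be : z == wd be n.-1 = false.
  rewrite eq_w0r //; apply/negP => /andP[/eqP e _]; have := odd_dn D.
  by rewrite -[n]prednK ?[odd _]/=; [rewrite -e | lia].
have key v : v != 1 -> v != w0 -> tail k true v = tail k true x ->
    exists be, relG D be k v z.
  move=> v1 v2 vt.
  have tf : tail k false v = tail k false z by rewrite !tailN ?vt ?zt ?z1 ?z2.
  have [/orP sp|] := boolP ((v == gen false) || (v == wd true n.-1)); last first.
    rewrite negb_or => /andP[v3 v4]; exists true.
    by rewrite /relG (negPf v1) (negPf v2) (negPf v3) (negPf v4) z1 z2 z4 zt -vt (z3 true) !eqxx.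
  exists false; rewrite /relG (negPf v1) (negPf v2) z1 z2 (z3 false) z4 tf !eqxx /= andbT.
  case: sp => /eqP ->.
    have -> : (gen false == gen (~~ false)) = false by rewrite (inj_eq (@dgen_inj _ D)).
    have gE : gen false = wd false 1 by rewrite -[LHS]mulg1.
    by rewrite gE (@eq_w0r _ D false false 1) ?n1.
  have -> : (wd true n.-1 == gen (~~ false)) = false.
    by rewrite (@eq_r _ D false true n.-1) // n1.
  by rewrite (@eq_w0r _ D false true n.-1) // andbF.
have [be1 r1] := key x x1 x2 erefl; have [be2 r2] := key y y1 y2 (esym e5).
apply: (cl be2 z); last exact: (@case_rel_sym (KG be2)).
exact: (cl be1 x).
Qed.

Section OneZero.
Context (be : bool).
Local Notation r := (~~ be).
Local Notation w0r := (wd be n.-1).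

Lemma w0rE : w0r = gen r * w0.
Proof. by rewrite (w0_rw0r D be) genK. Qed.

Lemma w0_comm : w0 * gen r = gen r * w0.
Proof. by rewrite -w0rE -{1}[w0](w0V D) -(dgenV D r) -invMg -w0rE; apply: w0rV. Qed.

Definition transl k (g h x : W) : W :=
  match k with LeftSide => g * x | RightSide => x * g | TwoSided => g * x * h end.

(** The right descent at [gen be] could change only if [gen r] were conjugate to [gen be]. *)
Lemma relH_gen_left x : relH D be LeftSide x (gen r * x).
Proof.
have sw (v v' z : W) : gen r * v = v' -> (gen r * z \in [set v; v']) = (z \in [set v; v']).
  move=> E; rewrite !inE -E (inj_eq (mulgI _)) orbC; congr (_ || _).
  by rewrite -(inj_eq (mulgI (gen r))) genK.
rewrite /relH (sw _ _ x (mulg1 _)) (sw w0 w0r x (esym w0rE)) !eqxx /=.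
have [->//|e] := rdes_gen D be r x; have := gen_conj_eq e.
by case: (be).
Qed.

Lemma relH_gen_right x : relH D be RightSide x (x * gen r).
Proof. by rewrite relH_right invMg dgenV relH_gen_left. Qed.

Lemma relH_two k x y : relH D be k x y -> relH D be TwoSided x y.
Proof. by case/and3P => e1 e2 _; rewrite /relH e1 e2 eqxx. Qed.

Lemma relH_transl k g h x : g \in [set 1; gen r] -> h \in [set 1; gen r] ->
  relH D be k x (transl k g h x).
Proof.
have rf k' z : relH D be k' z z by rewrite /relH !eqxx.
have L z v : z \in [set 1; gen r] -> relH D be LeftSide v (z * v).
  by rewrite !inE => /orP[] /eqP ->; [rewrite mul1g rf | apply: relH_gen_left].
have R z v : z \in [set 1; gen r] -> relH D be RightSide v (v * z).
  by rewrite !inE => /orP[] /eqP ->; [rewrite mulg1 rf | apply: relH_gen_right].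
move=> gr hr; case: k => /=; [exact: L | exact: R |].
apply: (@case_rel_trans (KH be) TwoSided _ (g * x)).
  exact: relH_two (L _ _ gr).
exact: relH_two (R _ _ hr).
Qed.

(** Outside the two exceptional pairs [relH] implies [relG]. Inside a pair, translation by [gen r]
    on either side exchanges the members, because [gen r] commutes with [w0]. *)
Lemma relH_chain k C : (forall x y, x \in C -> relG D be k x y -> y \in C) ->
  (forall x, x \in C -> transl k (gen r) 1 x \in C) ->
  forall x y, x \in C -> relH D be k x y -> y \in C.
Proof.
move=> cl tr x y xC /and3P[/eqP e1 /eqP e2 /eqP e5].
have n4 := dn_ge4 D.
have T v v' : gen r * v = v' -> v * gen r = v' -> x \in [set v; v'] -> y \in [set v; v'] -> y \in C.
  move=> E1 E2; have E1' : gen r * v' = v by rewrite -E1 genK.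
  have E2' : v' * gen r = v by rewrite -E2 genKr.
  have tx := tr _ xC; rewrite !inE => /orP[] /eqP xE /orP[] /eqP -> //; rewrite xE // in xC tx;
    by case: (k) tx; rewrite /= ?mulg1 ?E1 ?E2 ?E1' ?E2'.
have [x1|x1] := boolP (x \in [set 1; gen r]).
  by apply: (T 1 (gen r)); rewrite ?mulg1 ?mul1g // -e1.
have [x2|x2] := boolP (x \in [set w0; w0r]).
  by apply: (T w0 w0r); rewrite ?w0_comm -?w0rE // -e2.
have y1 := x1; have y2 := x2; rewrite e1 in y1; rewrite e2 in y2.
apply: (cl x) => //; move: x1 x2 y1 y2; rewrite !inE !negb_or.
move=> /andP[a1 a2] /andP[a3 a4] /andP[b1 b2] /andP[b3 b4].
by rewrite /relG !(negPf a1, negPf a2, negPf a3, negPf a4, negPf b1, negPf b2, negPf b3, negPf b4) e5 !eqxx.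
Qed.

End OneZero.

(* The parabolic subgroup attached to a facet with case [ck]. *)
Definition case_grp ck : {set W} :=
  match ck with KZ => [set: W] | KH be => [set 1; gen (~~ be)] | _ => [set 1] end.

Lemma case_rel_transl ck k g h x : g \in case_grp ck -> h \in case_grp ck ->
  case_rel D ck k x (transl k g h x).
Proof.
case: ck => [||be|be] //=; last exact: relH_transl.
  by rewrite !inE => /eqP -> /eqP ->; case: k; rewrite /= ?mulg1 ?mul1g; apply: (case_rel_refl KE).
by rewrite !inE => /eqP -> /eqP ->; case: k; rewrite /= ?mulg1 ?mul1g; apply: (case_rel_refl (KG be)).
Qed.

Lemma ep_mem (e : rel W) C : C \in equivalence_partition e [set: W] <->
  exists x, C = [set y | e x y].
Proof.
split=> [/imsetP[x _ ->]|[x ->]]; first by exists x; apply/setP => y; rewrite !inE.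
by apply/imsetP; exists x => //; apply/setP => y; rewrite !inE.
Qed.

Lemma cover_closed (e : rel W) C : equivalence_rel e ->
  (exists2 Q : {set {set W}}, Q \subset equivalence_partition e [set: W] & C = finset.cover Q)
  <-> (forall x y, x \in C -> e x y -> y \in C).
Proof.
move=> eqv; split=> [[Q QS ->] x y /bigcupP[B BQ xB] xy|cl].
  apply/bigcupP; exists B => //; have /ep_mem[z BE] := fintype.subsetP QS _ BQ.
  by move: xB; rewrite BE !inE => zx; have [_ /(_ zx) ->] := eqv z x y.
exists [set [set y | e x y] | x in C].
  by apply/fintype.subsetP => _ /imsetP[x _ ->]; apply/ep_mem; exists x.
apply/setP => y; apply/idP/bigcupP => [yC|[_ /imsetP[x xC ->]]].
  by exists [set z | e y z]; [apply/imsetP; exists y | rewrite inE; case: (eqv y y y)].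
by rewrite inE; apply: cl.
Qed.

End Combinatorics.

(** * Facets, chambers and cells *)

Lemma eq_equivalence_partition (T : finType) (e e' : rel T) (A : {set T}) :
  e =2 e' -> equivalence_partition e A = equivalence_partition e' A.
Proof. by move=> E; apply: eq_imset => x; apply/setP => y; rewrite !inE E. Qed.

(** Reduces (b) to two facts: every class satisfies (b1) and (b2), and every set satisfying both is
    closed under the relation. *)
Lemma minset_class (T : finType) (e : rel T) (P : pred {set T}) (C : {set T}) :
  equivalence_rel e -> (forall x, P [set y | e x y]) ->
  (forall B, P B -> B != finset.set0 /\ forall x y, x \in B -> e x y -> y \in B) ->
  (exists x, C = [set y | e x y]) <-> minset P C.
Proof.
move=> eqv Pe Pc; split=> [[x ->]|/minsetP[PC Cmin]].
  apply/minsetP; split=> // B PB BC; apply/eqP; rewrite finset.eqEsubset BC.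
  have [/finset.set0Pn[z zB] cl] := Pc _ PB; apply/fintype.subsetP => y.
  rewrite inE => xy; apply: (cl z) => //.
  have := fintype.subsetP BC z zB; rewrite inE => xz.
  by have [_ /(_ xz) <-] := eqv x z y.
have [/finset.set0Pn[x xC] cl] := Pc _ PC; exists x.
apply/esym/Cmin; first exact: Pe.
by apply/fintype.subsetP => y; rewrite inE; apply: cl.
Qed.

Section Facets.
Local Arguments wd : simpl never.
Local Open Scope ring_scope.
Context (W : finGroupType) (D : dihedral W).
Local Notation gen := (dgen D).
Local Notation L := (ZSbar (dS D)).
Local Notation osb := (osb D).
Local Notation arr4 := (@arr4 _ D).
Local Notation wt X := (wt (phiX X)).
Local Notation wneg X := (wneg (phiX X)).
Implicit Types (X Y Z : Pos L) (l : L) (b be : bool) (k : side) (C : {set W}).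
Implicit Types (F : set (Pos L)).

Lemma condA4 k : condA arr4 k.
Proof.
move=> F [X0 ->] X Y XF YF x y.
have e : arr_equiv arr4 X Y := arr_equiv_trans (arr_equiv_sym XF) YF.
have [ck cs] := case_exists (phiX X).
by rewrite (cell_eq_case _ cs) (cell_eq_case _ (agree_case (arr4_agree e) cs)).
Qed.

Section OneFacet.
Context F X ck (Ff : facet arr4 F) (FX : F X) (cs : is_case (phiX X) ck).

Lemma facet_eqE k : facet_eq k F =2 case_rel D ck k.
Proof.
move=> x y; apply/asboolP/idP => [[Y FY]|E].
  by rewrite (condA4 k Ff FY FX) (cell_eq_case _ cs).
by exists X; rewrite // (cell_eq_case _ cs).
Qed.

Lemma facet_cellsE k : facet_cells k F = equivalence_partition (case_rel D ck k) [set: W].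
Proof. exact: eq_equivalence_partition (facet_eqE k). Qed.

Lemma facet_hyperplane b : (F `<=` hyperplane (ebar (osb b)))%classic <-> wt X b = 0.
Proof.
rewrite wt_eq0 es_ebar -hyperplaneE; split=> [/(_ X FX)//|H Y FY].
have [X0 FE] := Ff; have e : arr_equiv arr4 X Y.
  by move: FX FY; rewrite FE => e e'; apply: arr_equiv_trans (arr_equiv_sym e) e'.
move: H; rewrite !hyperplaneE.
by have [-> ->] := arr4_agree e (vec_es _ b).
Qed.

Lemma W_facetE : W_facet F = case_grp D ck :> {set W}.
Proof.
have U : (\bigcup_(o : Sbar (dS D) | `[< (F `<=` hyperplane (ebar o))%classic >]) val o)%SET
    = [set x | [exists b, (wt X b == 0) && (x == gen b)]]%SET.
  apply/setP => x; rewrite inE; apply/bigcupP/existsP => [[o + xo]|[b /andP[/eqP b0 xb]]].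
    have [b oE] := osbP o; rewrite oE in xo * => /asboolP/facet_hyperplane/eqP b0.
    by exists b; rewrite b0 -mem_osb.
  by exists (osb b); [apply/asboolP/facet_hyperplane | rewrite mem_osb].
rewrite /W_facet /= U; have nz := wt_neq0 cs.
case: (ck) cs nz => [||be|be] /= c nz.
- rewrite -(dgen_full D); congr <<_>>%g; apply/setP => x; rewrite !inE.
  apply/existsP/orP => [[[] /andP[_ ->]]|[] xE]; [by left|by right| |].
    by exists true; rewrite c eqxx.
  by exists false; rewrite c eqxx.
- rewrite -[RHS]gen0; congr <<_>>%g; apply/setP => x; rewrite !inE.
  by apply/existsP => -[b /andP[b0 _]]; move: (nz b isT); rewrite b0.
- rewrite -[RHS]gen0; congr <<_>>%g; apply/setP => x; rewrite !inE.
  by apply/existsP => -[b /andP[b0 _]]; move: (nz b isT); rewrite b0.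
have o2 : #[gen (~~ be)]%g = 2.
  by apply: nt_prime_order; rewrite ?gen_neq1 // expgS expg1 dgen_inv.
rewrite -(cycle2g o2); congr <<_>>%g; apply/setP => x; rewrite !inE.
apply/existsP/eqP => [[b /andP[b0 /eqP ->]]|->]; last by exists (~~ be); rewrite c.1 !eqxx.
have [bE|bN] := eqVneq b be; last by move: bN; case: (b); case: (be).
by move: (nz b); rewrite bE eqxx -bE b0 => /(_ isT).
Qed.

Lemma condB2P k C : condB2 k F C <-> forall g h x, g \in case_grp D ck ->
  h \in case_grp D ck -> x \in C -> transl k g h x \in C.
Proof.
rewrite /condB2; case: k; rewrite !W_facetE.
- split=> [/fintype.subsetP H g h x gG _ xC|H]; first by apply: H; apply: mem_mulg.
  by apply/fintype.subsetP => _ /mulsgP[g x gG xC ->]; apply: (H g g).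
- split=> [/fintype.subsetP H g h x gG _ xC|H]; first by apply: H; apply: mem_mulg.
  by apply/fintype.subsetP => _ /mulsgP[x g xC gG ->]; apply: (H g g).
split=> [/fintype.subsetP H g h x gG hG xC|H]; first by apply: H; do 2 apply: mem_mulg => //.
by apply/fintype.subsetP => _ /mulsgP[_ h /mulsgP[g x gG xC ->] hG ->]; apply: H.
Qed.

Lemma facet_le_chamber Dm : chamber arr4 Dm -> facet_le F Dm ->
  exists Y be, [/\ Dm Y, is_case (phiX Y) (KG be) &
    case_refines ck be].
Proof.
move=> ch le; have [[Y DE] _] := ch.
have DY : Dm Y by rewrite DE; apply: arr_equiv_refl.
have [rf g] := chamber_refines ch (le _ (subset_closure FX)) DY.
have [be cY] := generic_KG g; exists Y, be; split=> //.
exact: refines_compat cs rf cY.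
Qed.

Lemma class_admissible k x : condB1 arr4 k F [set y | case_rel D ck k x y] /\
  condB2 k F [set y | case_rel D ck k x y].
Proof.
split; last first.
  apply/condB2P => g h y gG hG; rewrite !inE => xy.
  by apply: case_rel_trans xy _; apply: case_rel_transl.
move=> Dm ch le; have [Y [be [DY cY co]]] := facet_le_chamber ch le.
have fcE : facet_cells k Dm = equivalence_partition (case_rel D (KG be) k) [set: W].
  apply: eq_equivalence_partition => u v; apply/asboolP/idP => [[Y' DY']|E].
    by rewrite (condA4 k ch.1 DY' DY) (cell_eq_case _ cY).
  by exists Y; rewrite // (cell_eq_case _ cY).
rewrite fcE; apply/cover_closed; first exact: case_rel_equiv.
by move=> u v; rewrite !inE => xu uv; apply: case_rel_trans xu _; apply: coarsen uv.
Qed.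

End OneFacet.

Lemma condB1_closed F Dm Y be k C : chamber arr4 Dm -> facet_le F Dm -> Dm Y ->
  is_case (phiX Y) (KG be) -> condB1 arr4 k F C ->
  forall x y, x \in C -> relG D be k x y -> y \in C.
Proof.
move=> ch le DY cY b1; have := b1 _ ch le; rewrite (facet_cellsE ch.1 DY cY).
by move/cover_closed => /(_ (case_rel_equiv _ (KG be) k)).
Qed.

Lemma addE l l' o : (l + l') o = l o + l' o. Proof. exact: ffunE. Qed.
Lemma oppE l o : (- l) o = - l o. Proof. exact: ffunE. Qed.

Lemma coordB b (c : int) : {morph (fun l : L => c * l (osb b)) : x y / x - y}.
Proof. by move=> x y; rewrite addE oppE mulrDr mulrN. Qed.

Definition coordpos b (c : int) : Pos L := halfpos (coordB b c).

Lemma lex_refines X Z : refines X (lex X Z).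
Proof. by move=> l _; split=> H [H1 _]. Qed.

(** Of the vectors defining the arrangement, only the generator at [~~ b] has coordinate zero at
    [b], and its weight is nonzero; the refinement decides the sign of all the others. *)
Lemma lex_generic X b c : c != 0 -> wt X (~~ b) != 0 -> generic (lex X (coordpos b c)).
Proof.
move=> c0 nz l v [[Xl Zl] [Xn Zn]].
have lb : l (osb b) = 0.
  have h1 : 0 <= c * l (osb b) := Zl Xn.
  have h2 : 0 <= c * (- l) (osb b) by apply: Zn; rewrite opprK.
  move: h2; rewrite oppE mulrN oppr_ge0 => h2.
  apply/eqP; have : c * l (osb b) == 0 by rewrite eq_le h1 h2.
  by rewrite mulf_eq0 (negPf c0).
case: v lb => [[b' lE]|lE|lE]; rewrite lE ?addE ?oppE !es_osb.
- have [bE|bN] := eqVneq b' b => // _; have b'E : b' = ~~ b by move: bN; case: (b'); case: (b).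
  by move: nz => /eqP; apply; apply/wt_eq0; rewrite -b'E -lE.
- by case: (b).
- by case: (b).
Qed.

Lemma lex_chamber X Z : generic (lex X Z) ->
  chamber arr4 [set Y | arr_equiv arr4 (lex X Z) Y]%classic.
Proof.
move=> g; split; first by exists (lex X Z).
move=> H /arr4P[l v ->]; apply/seteqP; split=> // Y [/arr4_agree/(_ _ v)[e1 e2] /hyperplaneE].
by rewrite -e1 -e2; apply: g.
Qed.

(** Refining every point of [F] by the same [Z] stays in one facet, so all of [F] lies in the
    closure of that facet. *)
Lemma lex_facet_le F X Z : facet arr4 F -> F X ->
  facet_le F [set Y | arr_equiv arr4 (lex X Z) Y]%classic.
Proof.
move=> [X0 FE] FX; rewrite /facet_le.
rewrite [X in (_ `<=` X)%classic](closure_id _).1; last exact: closed_closure.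
apply: closureS => Y FY; apply: (@lex_closure _ _ _ Z) => /=.
have e : arr_equiv arr4 X Y.
  by move: FX FY; rewrite FE => e e'; apply: arr_equiv_trans (arr_equiv_sym e) e'.
move/arr_equivP: e => e; apply/arr_equivP => l l0 Al; have [e1 e2] := e l l0 Al.
by split; rewrite /= /lex_set /= ?opprK; tauto.
Qed.

(** The refinement goes in the direction that increases the absolute weight at [gen be], so both
    choices of [be] occur next to such a facet. *)
Lemma lex_equal X be : is_case (phiX X) KE ->
  is_case (phiX (lex X (coordpos be (if wneg X be then -1 else 1)))) (KG be).
Proof.
case=> ab nz; set c := (if _ then _ else _); set Y := lex _ _.
have c0 : c != 0 by rewrite /c; case: ifP.
have g : generic Y by apply: lex_generic.
split; last exact: generic_wt.
apply/wabs_lt; have rf : refines X Y := @lex_refines _ _.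
have vE b : vab Y b = vab X b by rewrite /vab (refines_sign rf (nz b)).
rewrite !vE => -[_ Zd].
have : 0 <= c * (vab X (~~ be) - vab X be) (osb be).
  apply: Zd; rewrite opprB; move/wabs_eq: ab => [h1 h2]; by case: (be).
have v1 : (vab X be) (osb be) = c.
  by rewrite /vab /c; case: ifP => _; rewrite ?oppE es_osb eqxx.
have v0 : (vab X (~~ be)) (osb be) = 0.
  by rewrite /vab; case: ifP => _; rewrite ?oppE es_osb; case: (be).
rewrite addE oppE v1 v0 add0r /c.
by case: (wneg X be).
Qed.

Lemma condB_closed F X ck k C : facet arr4 F -> F X -> is_case (phiX X) ck ->
  condB1 arr4 k F C -> condB2 k F C ->
  forall x y, x \in C -> case_rel D ck k x y -> y \in C.
Proof.
move=> Ff FX cs b1 /(condB2P Ff FX cs) b2.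
(* When a generator dominates, one adjacent chamber suffices; it is reached by refining along the
   coordinate whose weight may vanish. *)
have one be : wt X be != 0 -> case_refines ck be ->
    if ck is (KG _ | KH _) then forall x y, x \in C -> relG D be k x y -> y \in C else True.
  move=> nz co; set Y := lex X (coordpos (~~ be) 1).
  have g : generic Y by apply: lex_generic; rewrite ?negbK.
  have [be' cY] := generic_KG g.
  have := refines_compat cs (@lex_refines _ _) cY.
  have := condB1_closed (lex_chamber g) (lex_facet_le _ Ff FX) (@arr_equiv_refl _ _ _) cY b1.
  by case: (ck) co => // b /eqP -> H /eqP ->.
have nz := wt_neq0 cs.
case: ck cs b2 one nz => [||be|be] cs b2 one nz.
(* With both weights zero the parabolic subgroup is [W], and translations alone act transitively. *)
- move=> x y xC _; have G g : g \in case_grp D KZ by rewrite inE.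
  case: k {b1 one} b2 => b2.
  + by have := b2 (y * x^-1)%g 1%g x (G _) (G _) xC; rewrite /= mulgKV.
  + by have := b2 (x^-1 * y)%g 1%g x (G _) (G _) xC; rewrite /= mulKVg.
  + by have := b2 (y * x^-1)%g 1%g x (G _) (G _) xC; rewrite /= mulgKV mulg1.
- apply: relE_chain => be; have cY := lex_equal be cs.
  have g : generic (lex X (coordpos be (if wneg X be then -1 else 1))).
    by apply: lex_generic; [case: ifP | apply: nz].
  exact: condB1_closed (lex_chamber g) (lex_facet_le _ Ff FX) (@arr_equiv_refl _ _ _) cY b1.
- by apply: one; [apply: nz | exact: eqxx].
apply: relH_chain; first by apply: one; [apply: nz; exact: eqxx | exact: eqxx].
by move=> x; apply: b2; rewrite !inE eqxx ?orbT.
Qed.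

Lemma condB4 k : condB arr4 k.
Proof.
move=> F Ff C; have [X FE] := Ff; have FX : F X by rewrite FE; apply: arr_equiv_refl.
have [ck cs] := case_exists (phiX X).
rewrite (facet_cellsE Ff FX cs) ep_mem; apply: minset_class.
- exact: case_rel_equiv.
- move=> x; apply/andP; split; last exact/asboolP/(class_admissible Ff FX cs).
  by apply/finset.set0Pn; exists x; rewrite inE case_rel_refl.
move=> B /andP[B0 /asboolP[b1 b2]]; split=> //.
exact: condB_closed Ff FX cs b1 b2.
Qed.

Lemma arr4_admissible : admissible arr4.
Proof.
split; last by move=> k; split; [exact: condA4 | exact: condB4].
  split; first by rewrite /arr4 !finite_setU; do !split; exact: finite_set1.
  by move=> H /arr4P[l v ->]; exists l => //=; apply: vec_neq0.
by move=> o; have [b ->] := osbP o; rewrite es_ebar; apply/arr4_vec/vec_es.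
Qed.

End Facets.

(** * Minimality of the arrangement and additivity of characters *)

Section Essential.
Local Arguments wd : simpl never.
Local Open Scope ring_scope.
Context (W : finGroupType) (D : dihedral W).
Local Notation gen := (dgen D).
Local Notation n := (dn D).
Local Notation wd := (wd D).
Local Notation L := (ZSbar (dS D)).
Local Notation osb := (osb D).
Local Notation es := (es D).
Local Notation arr4 := (@arr4 _ D).
Local Notation wneg X := (wneg (phiX X)).
Implicit Types (X Y Z : Pos L) (l : L) (b be : bool) (k : side) (C : {set W}).

Section Antidiagonal.
Context (sg : bool).
Local Notation c := ((-1) ^+ sg : int).

(** The weighted sum with weight 1 at [gen true] and [- c] at the other generator. Its zero line is
    spanned by [es true + es false *~ c], so the half-plane it defines lies on that hyperplane. *)
Definition balance l : int := l (osb true) - c * l (osb false).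

Lemma balanceB : {morph balance : x y / x - y}.
Proof. by move=> x y; rewrite /balance !addE !oppE mulrDr mulrN !opprD !opprK addrACA. Qed.

Definition balanced : Pos L := halfpos balanceB.
Local Notation bal := balance.
Local Notation X0 := balanced.
Local Notation Y0 := (lex X0 (coordpos D true 1)).
Local Notation l0 := (es true + es false *~ c).

Lemma sign_sqr : c * c = 1.
Proof. by case: sg. Qed.

Lemma balancedE l : pos_set X0 l <-> 0 <= bal l. Proof. by []. Qed.

Lemma balanceN l : bal (- l) = - bal l.
Proof. by rewrite /balance !oppE mulrN opprD. Qed.

Lemma balanced_symm l : pos_set X0 l -> pos_set X0 (- l) -> l = l0 *~ l (osb true).
Proof.
rewrite !balancedE balanceN oppr_ge0 => h1 h2.
have : bal l = 0 by apply/eqP; rewrite eq_le h1 h2.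
move/eqP; rewrite subr_eq0 => /eqP lt.
have lf : l (osb false) = c * l (osb true) by rewrite lt mulrA sign_sqr mul1r.
apply/ffunP => o; have [b ->] := osbP o.
have mulzE (v : L) (z : int) o' : (v *~ z) o' = v o' *~ z.
  have nE (i : nat) : (v *+ i) o' = v o' *+ i.
    by elim: i => [|i IH]; [rewrite !mulr0n ffunE | rewrite !mulrS addE IH].
  by case: z => i; [exact: nE | rewrite !NegzE !mulrNz oppE -!pmulrn nE].
rewrite mulzE addE mulzE !es_osb; case: b => /=.
  by rewrite mul0rz addr0 intz.
by rewrite add0r intz -mulrzr intz mulrC lf mulrC.
Qed.

Lemma balanced_KE : is_case (phiX X0) KE.
Proof.
have bt : bal (es true) = 1 by rewrite /balance !es_osb mulr0 subr0.
have bf : bal (es false) = - c by rewrite /balance !es_osb mulr1 sub0r.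
have nt : wneg X0 true = false by rewrite wnegE; apply/negbF/asboolP/balancedE; rewrite bt.
have nf : wneg X0 false = ~~ sg.
  by rewrite wnegE; congr (~~ _); apply/asboolP/idP; rewrite balancedE bf; case: (sg).
have d0 : bal (vab X0 true - vab X0 false) = 0.
  by rewrite balanceB /vab nt nf; case: ifP; rewrite ?balanceN bt bf; case: (sg).
split.
  by apply/wabs_eq; split; apply/balancedE; [rewrite d0 | rewrite -opprB balanceN d0 oppr0].
move=> b; apply/eqP => /wt_eq0; rewrite !balancedE balanceN.
by case: b; rewrite ?bt ?bf; case: (sg) => -[].
Qed.

Lemma balanced_lex_KG : exists be, is_case (phiX Y0) (KG be).
Proof. by apply/generic_KG/lex_generic => //; apply: balanced_KE.2. Qed.

(* Outside the line spanned by [es true + es false *~ c], the sets [X0] and [Y0]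
   agree; but the cells at [Y0] separate a generator from a word of length two. *)
Lemma balanced_essential (B : set (set (Pos L))) : (forall k, condA B k) -> B (hyperplane l0).
Proof.
move=> cA; apply: contrapT => nB.
have eqv : arr_equiv B X0 Y0.
  apply/arr_equivP => l l_n0 Bl.
  have ns : ~ (pos_set X0 l /\ pos_set X0 (- l)).
    move=> [h1 h2]; apply: nB; have lE := balanced_symm h1 h2; move: Bl; rewrite lE.
    have z0 : l (osb true) != 0 by apply: contraNneq l_n0 => z; rewrite lE z mulr0z.
    suff -> : hyperplane (l0 *~ l (osb true)) = hyperplane l0 by [].
    by apply/predeqP => X; apply: pos_mulrz_symm.
  by split; rewrite /= /lex_set /= ?opprK; tauto.
have Ff : facet B [set Y | arr_equiv B X0 Y]%classic by exists X0.
have E := cA LeftSide _ Ff X0 Y0 (@arr_equiv_refl _ _ _) eqv.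
have [be cY] := balanced_lex_KG; have n4 := dn_ge4 D.
have h1 : gen (~~ be) = wd (~~ be) 1 by rewrite -[LHS]mulg1.
have [i1 i2 i3] : [/\ (1 <= n)%N, (2 <= n)%N & (2%N == n) = false] by split; lia.
have i4 : (1%N == n) = false by lia.
move: (E (gen (~~ be)) (wd be 2)).
rewrite (cell_eq_case _ balanced_KE) (cell_eq_case _ cY) /= /relE /relG.
rewrite !h1 !eq_1 // !eq_w0 // i3 i4 -h1 [in gen _ == gen _]eqxx (@eq_r _ D be be _ i2) /= h1.
by rewrite !rdesE // i3 i4; case: (be).
Qed.

End Antidiagonal.

(** Completeness forces [H_s] and [H_t]; condition (a) forces the other two. *)
Lemma arr4_essential : essential arr4.
Proof.
split; first exact: arr4_admissible.
move=> B [_ Bc Bk] H /arr4P[l v ->]; have cA k : condA B k by case: (Bk k).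
case: v => [[b ->]|->|->].
- by rewrite -es_ebar.
- by have := balanced_essential true cA; rewrite mulrN1z.
- by have := balanced_essential false cA.
Qed.

Lemma essential_eq (A : set (set (Pos L))) : essential A -> A = arr4.
Proof.
move=> [Aa Am]; apply/seteqP; split; first exact: Am (arr4_admissible D).
exact: arr4_essential.2 Aa.
Qed.

Lemma cells_case X ck k : is_case (phiX X) ck ->
  cells (phiX X) k = equivalence_partition (case_rel D ck k) [set: W].
Proof. by move=> cs; apply: eq_equivalence_partition (cell_eq_case k cs). Qed.

Lemma dihedral_Bminus : conjectureBminus (dS D).
Proof.
move=> A /essential_eq -> X C; have [ck cs] := case_exists (phiX X).
rewrite (cells_case _ cs) => /ep_mem[x CE] Dm Y ch cl DY.
have [rf g] := chamber_refines ch cl DY; have [be cY] := generic_KG g.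
have co := refines_compat cs rf cY.
have eqv := case_rel_equiv D (KG be) LeftSide.
set P := cells (phiX Y) LeftSide; have PE : P = equivalence_partition _ _ := cells_case _ cY.
have Ppart : finset.partition P [set: W].
  by rewrite PE; apply: equivalence_partitionP => u v w _ _ _; apply: eqv.
have /and3P[_ tP P0] := Ppart.
(* The cells at [Y] refine those at [X], so the ones contained in [C] cover it. *)
pose Q := [set C' in P | C' \subset C].
have QP : Q \subset P by apply/fintype.subsetP => C'; rewrite inE => /andP[].
have tQ : finset.trivIset Q by apply: trivIsetS tP.
have covQ : finset.cover Q = C.
  apply/setP => y; apply/bigcupP/idP => [[C' ]|yC].
    by rewrite inE => /andP[_ /fintype.subsetP sC] /sC.
  exists [set z | case_rel D (KG be) LeftSide y z]; last by rewrite inE case_rel_refl.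
  rewrite inE PE; apply/andP; split; first by apply/ep_mem; exists y.
  apply/fintype.subsetP => z; rewrite inE => yz; move: yC; rewrite CE !inE => xy.
  exact: case_rel_trans xy (coarsen co yz).
exists Q; split=> //.
  apply/and3P; split=> //; first by rewrite covQ.
  by apply: contra P0 => /(fintype.subsetP QP).
move=> w; have CL : C = lcell D ck x := CE.
(* [cell_char] makes sense for any subset. Once [C] is evaluated at [Y], the claim is the splitting
   of a sum of diagonal coefficients along a partition. *)
have -> : cell_char (phiX X) C w = cell_char (phiX Y) C w.
  by rewrite CL; apply: char_compare cs cY co _ _ _ => b nz; apply: refines_wsg.
rewrite -covQ; have [c [cKL _]] := case_basis cY.
under eq_bigr do rewrite (cell_charE cKL).
by rewrite (cell_charE cKL) /Sx finset.big_trivIset.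
Qed.

End Essential.

Local Open Scope ring_scope.

Theorem proposition7p1 (W : finGroupType) (S : {set W}) (s t : W) (m : nat)
    (hcox : coxeter_system S) (hS : S = [set s; t]) (hst : s != t)
    (hm : (2 <= m)%N) (hord : #[(s * t)%g]%g = (2 * m)%N) :
  [/\ t \notin (s ^: [set: W])%g /\ Sclasses S = [set [set s]; [set t]],
      conjectureA S,
      essential [set hyperplane (egen S s); hyperplane (egen S t);
                     hyperplane (egen S s - egen S t);
                     hyperplane (egen S s + egen S t)]%classic
    & conjectureBminus S].
Proof.
case: hcox => o2 gen _; subst S.
pose gn b := if b then s else t.
have inv b : (gn b * gn b = 1)%g.
  have : #[gn b]%g = 2%N by apply: o2; case: b; rewrite !inE eqxx ?orbT.
  by move=> o; have := expg_order (gn b); rewrite o expgS expg1.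
pose D : dihedral W := @Dihedral _ gn m hm inv hord gen.
rewrite -[[set s; t]]/(dS D); split.
- split; last exact: SclassesE.
  by apply/negP => /(@gen_class_eq _ D false true).
- exists (@arr4 _ D); exact: arr4_admissible.
- exact: (arr4_essential D).
- exact: dihedral_Bminus.
Qed.
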